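(* Let $k_0\ge 2$ be an integer and let $E=(T_k)_{1\le k\le k_0}$ be a $k_0$-balanced set of webs such that the web $\mathcal{W}(n,E)$ is ordinary for every $n\ge 2$. If $\mathcal{W}(n,E)$ has maximal rank $\rho(n,k_0)$ for every $n$ with $2\le n\le k_0$, then $\mathcal{W}(n,E)$ has maximal rank $\rho(n,k_0)$ for every $n\ge 2$. Moreover, in that case, for every $n\geq 2$, the abelian relations of $\mathcal{W}(n,E)$ can be expressed with at most $k_0$ variables (i.e. the space of abelian relations is spanned by abelian relations each of which involves at most $k_0$ of the variables $x_1,\dots,x_n$). Furthermore, for every integer $h$ with $2\le h\le k_0$ and every $n\ge h$, the dimension of the space of abelian relations of $\mathcal{W}(n,E)$ involving exactly $h$ of the variables $(x_1,\dots,x_n)$ equals $N(h,k_0)\binom{n}{h}$, where $N(h,k_0)$ denotes the dimension of the space of abelian relations of $\mathcal{W}(h,E)$ involving exactly all the $h$ variables $(x_1,\dots,x_h)$.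
   Context: Everything is holomorphic. For integers $n\ge 1$, $h\ge 0$, $c(n,h):=\binom{n+h-1}{h}$ is the dimension of the space of homogeneous polynomials of degree $h$ in $n$ variables, and $$\rho(n,k_0):=\sum_{h=1}^{k_0}\bigl(c(n,k_0)-c(n,h)\bigr)=k_0\,c(n,k_0)-c(n+1,k_0)+1 .$$ (This is the known upper bound for the rank of an ordinary $c(n,k_0)$-web in dimension $n$.) Webs. A $d$-web of codimension one on an open subset of $\mathbb{C}^n$ is given by $d$ holomorphic functions (first integrals) $u_1,\dots,u_d$ whose differentials are nonzero and pairwise linearly independent at each point (the foliations are $u_i=\mathrm{const}$). $k_0$-balanced sets. Fix $k_0\ge 2$. A $k_0$-balanced set of webs $E=(T_k)_{1\le k\le k_0}$ consists, for each $k=1,\dots,k_0$, of a $c(k,k_0-k)$-web $T_k$ on a nonempty connected open set $U_k\subset\mathbb{C}^k$, given by first integrals $u_b(x_1,\dots,x_k)$, $1\le b\le c(k,k_0-k)$ (in particular $T_1$ is given by a single function of one variable with nowhere zero derivative, e.g. $x\mapsto x$), such that: - each first integral $u_b$ of $T_k$ explicitly involves all the variables $x_1,\dots,x_k$, i.e. none of the partial derivatives $\partial u_b/\partial x_j$, $1\le j\le k$, vanishes identically on $U_k$; - for each $n\ge 2$, the superposition $\mathcal{W}(n,E)$ described next is a web on a nonempty open subset of $\mathbb{C}^n$. For a multi-index $I=(1\le i_1<\dots<i_k\le n)$ let $\pi_I^n:\mathbb{C}^n\to\mathbb{C}^k$, $(x_1,\dots,x_n)\mapsto(x_{i_1},\dots,x_{i_k})$.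 Then $\mathcal{W}(n,E)$ is the web whose first integrals are all the functions $u_b\circ\pi_I^n$, where $k$ runs over $1\le k\le \min(k_0,n)$, $I$ over all such multi-indices of length $k$, and $u_b$ over the first integrals of $T_k$. Its domain $D_n$ is the open set (assumed nonempty) of points $x\in\mathbb{C}^n$ such that $\pi_I^n(x)\in U_k$ for all these $k$ and $I$ and such that the differentials at $x$ of all these first integrals are pairwise linearly independent. The number of first integrals of $\mathcal{W}(n,E)$ is exactly $c(n,k_0)$. Ordinary webs. For a $d$-web $W$ in dimension $n$ with first integrals $u_1,\dots,u_d$ and an integer $h\ge 0$, $P_h(W)$ is the $c(n,h)\times d$ matrix of functions with columns indexed by $i\in\{1,\dots,d\}$, rows indexed by multi-indices $L=(\ell_1,\dots,\ell_n)$ of integers $\ell_\lambda\ge 0$ with $\ell_1+\dots+\ell_n=h$, and entries $\prod_{\lambda=1}^n(\partial u_i/\partial x_\lambda)^{\ell_\lambda}$. The web $W$ is ordinary at a point if all the matrices $P_h(W)$, $h\ge 1$, have maximal rank $\min(d,c(n,h))$ at (hence near) this point; ''$W$ is ordinary'' means ordinary at every point of a dense open subset of its domain. Abelian relations and rank. An abelian relation of $W$ at a point $x$ is a family $(F_i)_{1\le i\le d}$, where $F_i$ is a germ at $u_i(x)$ of holomorphic function of one variable, taken modulo additive constants, such that $\sum_{i=1}^d F_i\circ u_i$ is a constant germ at $x$; equivalently $\sum_i F_i'(u_i)\,du_i=0$. The abelian relations at $x$ form a complex vector space, whose dimension is the rank of $W$ at $x$. ''$\mathcal{W}(n,E)$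 has maximal rank $\rho(n,k_0)$'' means that its rank at every point of $D_n$ at which it is ordinary equals $\rho(n,k_0)$; statements on abelian relations are understood at such points. Number of variables. For a subset $J\subset\{1,\dots,n\}$, an abelian relation of $\mathcal{W}(n,E)$ involves only the variables $x_j$, $j\in J$, if its components $F_i$ are zero (constant) for all first integrals $u_i$ that depend on some variable $x_\lambda$ with $\lambda\notin J$. It involves at most $h$ variables if this holds for some $J$ with $|J|\le h$. Let $A^{\le h}_n$ denote the vector space spanned by the abelian relations of $\mathcal{W}(n,E)$ involving at most $h$ variables. The dimension of the space of abelian relations involving exactly $h$ variables is counted modulo those coming from fewer variables, that is, it is $\dim\bigl(A^{\le h}_n/A^{\le h-1}_n\bigr)$. *)

(* Defs.v *)
From HB Require Import structures.
From mathcomp Require Import all_boot all_order all_algebra.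
From mathcomp Require Import complex.
From mathcomp Require Import all_classical all_reals all_analysis.

Set Implicit Arguments.
Unset Strict Implicit.
Unset Printing Implicit Defensive.

Import Order.TTheory GRing.Theory Num.Theory.
Import numFieldNormedType.Exports.

Local Open Scope classical_set_scope.
Local Open Scope ring_scope.

(** The complex field, packed so that its topology and its structure of normed
    module over itself are inferred; differentiability of a map between normed
    modules over it is complex differentiability. *)
Definition Cplx (R : realType) : numClosedFieldType := R[i]%C.

Section LinearAlgebra.
Variables (K : fieldType) (V : lmodType K).
Implicit Types (S T : set V) (m : nat).

Definition lin_span S : set V :=
  [set v | exists m (a : 'I_m -> K) (e : 'I_m -> V),
     (forall j, S (e j)) /\ v = \sum_j a j *: e j].

(** For linear subspaces [T] of [S]: the quotient [S / T] has dimension [m],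
    i.e. there are [m] vectors of [S] whose classes form a basis of it. *)
Definition quot_dim S T m : Prop :=
  exists e : 'I_m -> V,
    [/\ forall j, S (e j),
        forall v, S v -> exists a : 'I_m -> K, T (v - \sum_j a j *: e j)
      & forall a : 'I_m -> K, T (\sum_j a j *: e j) -> forall j, a j = 0].

End LinearAlgebra.

(** Number of monomials of degree [h] in [n >= 1] variables. *)
Definition c (n h : nat) : nat := 'C(n + h - 1, h).

Definition rho (n k0 : nat) : nat := (\sum_(1 <= h < k0.+1) (c n k0 - c n h))%N.

Section Webs.
Variable R : realType.
Local Notation C := (Cplx R).

Definition holomorphic_on (V : normedModType C) (U : set V) (f : V -> C) : Prop :=
  forall z, U z -> differentiable f z.

Definition partial n (f : 'rV[C]_n -> C) (j : 'I_n) (x : 'rV[C]_n) : C :=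
  'D_(delta_mx 0 j) f x.

(** The differential of [f] at [x], in the basis [dx_0, ..., dx_(n-1)]. *)
Definition grad n (f : 'rV[C]_n -> C) (x : 'rV[C]_n) : 'rV[C]_n :=
  \row_j partial f j x.

Section Web.
Variables (n : nat) (I : finType) (u : I -> 'rV[C]_n -> C).

(** [u] defines a web of codimension one on [D]; the functions [u i] are total
    but only their restrictions to [D] matter. *)
Definition is_web (D : set 'rV[C]_n) : Prop :=
  [/\ open D,
      forall i, holomorphic_on D (u i),
      forall i x, D x -> grad (u i) x != 0
    & forall i j x, i != j -> D x -> free [:: grad (u i) x; grad (u j) x]].

(** Exponents of the monomials of degree [h] in [n] variables (an exponent of
    such a monomial is at most [h]). *)
Definition mon (h : nat) : {set {ffun 'I_n -> 'I_h.+1}} :=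
  [set L : {ffun 'I_n -> 'I_h.+1} | (\sum_l (L l : nat) == h)%N]%SET.

Definition Pmx (h : nat) (x : 'rV[C]_n) : 'M[C]_(#|mon h|, #|I|) :=
  \matrix_(r, i) \prod_l partial (u (enum_val i)) l x ^+ ((enum_val r : {ffun 'I_n -> 'I_h.+1}) l).

Definition ordinary_at (x : 'rV[C]_n) : Prop :=
  forall h, (1 <= h)%N -> \rank (Pmx h x) = minn #|I| (c n h).

Definition ordinary (D : set 'rV[C]_n) : Prop :=
  exists O : set 'rV[C]_n,
    [/\ open O, O `<=` D, D `<=` closure O
      & forall x, O x -> ordinary_at x].

(** Abelian relations at [x] are described by families of total functions
    representing the germs at the points [u i x].  Two families represent the
    same abelian relation when they differ by an element of [trivial_rel x], so
    the space of abelian relations at [x] is [abelian_rel x / trivial_rel x]. *)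
Definition abelian_rel (x : 'rV[C]_n) : set (I -> C -> C) :=
  [set F | (forall i, \forall z \near u i x, differentiable (F i) z) /\
           exists a : C, \forall y \near x, \sum_i F i (u i y) = a].

Definition const_germ (f : C -> C) (z0 : C) : Prop :=
  exists a : C, \forall z \near z0, f z = a.

Definition trivial_rel (x : 'rV[C]_n) : set (I -> C -> C) :=
  [set F | forall i, const_germ (F i) (u i x)].

Definition rank_at (x : 'rV[C]_n) (m : nat) : Prop :=
  quot_dim (abelian_rel x) (trivial_rel x) m.

Definition depends_on (D : set 'rV[C]_n) (f : 'rV[C]_n -> C) (l : 'I_n) : Prop :=
  exists2 y, D y & partial f l y != 0.

Definition involves_only (D : set 'rV[C]_n) (x : 'rV[C]_n) (J : {set 'I_n}) :
    set (I -> C -> C) :=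
  [set F | forall i l, l \notin J -> depends_on D (u i) l ->
             const_germ (F i) (u i x)].

(** The (representatives of the) space spanned by the abelian relations at [x]
    involving at most [h] variables; it contains [trivial_rel x]. *)
Definition abelian_le (D : set 'rV[C]_n) (x : 'rV[C]_n) (h : nat) :
    set (I -> C -> C) :=
  lin_span [set F | abelian_rel x F /\
    exists J : {set 'I_n}, (#|J| <= h)%N /\ involves_only D x J F].

(** The space of abelian relations at [x] involving exactly [h >= 1] variables,
    counted modulo those coming from fewer variables, has dimension [m]. *)
Definition exact_dim (D : set 'rV[C]_n) (x : 'rV[C]_n) (h m : nat) : Prop :=
  quot_dim (abelian_le D x h) (abelian_le D x h.-1) m.

End Web.

(** Multi-indices [0 <= i_1 < ... < i_k < n]. *)
Definition mindex (n k : nat) : finType :=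
  {J : k.-tuple 'I_n | sorted ltn (map val J)}.

Definition coord_proj n k (J : mindex n k) (x : 'rV[C]_n) : 'rV[C]_k :=
  \row_j x 0 (tnth (val J) j).

(** A family of webs [T_k], of domain [bdom k], given by the first integrals
    [bfi k b].  Only the values [1 <= k <= k0] are meaningful. *)
Record web_family (k0 : nat) := WebFamily {
  bdom : forall k, set 'rV[C]_k;
  bfi : forall k, 'I_(c k (k0 - k)) -> 'rV[C]_k -> C }.
Arguments bdom {k0} E k _ : rename.
Arguments bfi {k0} E {k} b _ : rename.

Section Superposition.
Variables (k0 : nat) (E : web_family k0).

(** Indices [(k, (J, b))] of the first integrals of [W(n, E)]; the component
    [k : 'I_k0] stands for the length [k.+1], and [mindex n k.+1] is empty
    if [n < k.+1]. *)
Definition Windex (n : nat) : finType :=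
  {k : 'I_k0 & (mindex n k.+1 * 'I_(c k.+1 (k0 - k.+1)))%type}.

Definition Wfi (n : nat) (i : Windex n) (x : 'rV[C]_n) : C :=
  bfi E (tagged i).2 (coord_proj (tagged i).1 x).

Definition Wdom (n : nat) : set 'rV[C]_n :=
  [set x | (forall k, (1 <= k <= k0)%N ->
              forall J : mindex n k, bdom E k (coord_proj J x)) /\
           (forall i j : Windex n, i != j ->
              free [:: grad (Wfi i) x; grad (Wfi j) x])].
Arguments Wdom n _ : clear implicits.

Definition balanced : Prop :=
  [/\ forall k, (1 <= k <= k0)%N ->
        [/\ bdom E k !=set0, connected (bdom E k)
          & is_web (bfi E (k := k)) (bdom E k)],
      forall k, (1 <= k <= k0)%N ->
        forall (b : 'I_(c k (k0 - k))) (j : 'I_k),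
          exists2 y, bdom E k y & partial (bfi E b) j y != 0
    & forall n, (2 <= n)%N ->
        Wdom n !=set0 /\ is_web (@Wfi n) (Wdom n)].

Definition Wordinary (n : nat) : Prop := ordinary (@Wfi n) (Wdom n).

Definition Wmax_rank (n : nat) : Prop :=
  forall x, Wdom n x -> ordinary_at (@Wfi n) x ->
    rank_at (@Wfi n) x (rho n k0).

End Superposition.
End Webs.
Arguments Wfi {R k0} E n i x.
Arguments Wdom {R k0} E n x.

(* Main.v *)
Require Import Defs.
From mathcomp Require Import all_boot all_order all_algebra complex.
From mathcomp Require Import all_classical all_reals all_analysis.
From mathcomp Require Import ring lra zify.

(** A relation [sum_i F_i o u_i = const] at [x] whose components vanish to
    order [m] has as leading coefficients a relation [sum_i a_i (du_i)^m = 0]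
    between [m]-th powers of linear forms.  Ordinarity at [x] means that the
    [k0]-th powers of the [du_i] are a basis of the forms of degree [k0].  This
    passes to every subset [J] of the variables, so for [m <= k0] the [m]-th
    powers of the [du_i] in the variables [J] span the forms of degree [m] in
    these variables; consequently each relation between [m]-th powers is a sum of
    relations in at most [k0] variables.  If [#|J| <= k0], the dimension count in
    the bound [rho] and the maximality of the rank force every relation between
    [m]-th powers in the variables [J] to be the leading part of an abelian
    relation in these variables.  By induction on the order of vanishing, abelian
    relations are sums of abelian relations in at most [k0] variables, and all
    dimensions follow by counting linear forms and monomials by support.

    Functions of one variable enter only through their Taylor expansions.  These
    come from Cauchy estimates, which need no integral: midpoint sums along the
    boundaries of dyadic squares are exactly additive under bisection. *)

(** Orders of vanishing beyond [k0] carry nothing: independence of the [k0]-th powers implies that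
    of all higher powers. So the filtration has [k0] steps. Since the [m]-th powers span, the step
    of order [m] embeds into a space of dimension c(n,k0) - c(n,m), and these numbers add up to
    [rho n k0]. Maximal rank is therefore equality at every step, and each relation between powers
    is a leading part. Ordinarity descends to [J] because independence is inherited by the first
    integrals in the variables [J], and by Vandermonde's identity these are exactly as many as the
    monomials of degree [k0] in [J], so they also span. An ordinary point projects to an ordinary
    point, hence the hypothesis on few variables applies at that very projection. The obstacle is
    the control of supports: to correct a relation from larger to smaller supports, each monomial
    must be written by powers of forms supported inside the support of that monomial. Projecting to
    the variables of the monomial before inverting the matrix of powers achieves this. Leading terms
    are computed along complex lines through [x], so expansions in several variables never occur. *)

Set Implicit Arguments.
Unset Strict Implicit.
Unset Printing Implicit Defensive.

Import Order.TTheory GRing.Theory Num.Theory.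
Import numFieldNormedType.Exports.

Local Open Scope classical_set_scope.
Local Open Scope ring_scope.

(** * Complex moduli and midpoint sums along squares *)

Section Modulus.
Local Open Scope complex_scope.
Variable R : realType.
Local Notation C := (R[i]).
Local Notation nm := (@Normc.normc R).
Local Notation Re := (@complex.Re R).
Local Notation Im := (@complex.Im R).
Implicit Types z w p d : C.

Lemma nm_ge0 z : 0 <= nm z.
Proof. by case: z => a b; rewrite sqrtr_ge0. Qed.

Lemma nm0 : nm 0 = 0. Proof. exact: Normc.normc0. Qed.
Lemma nm1 : nm 1 = 1. Proof. exact: Normc.normc1. Qed.
Lemma nmM z w : nm (z * w) = nm z * nm w. Proof. exact: Normc.normcM. Qed.
Lemma nmV z : nm z^-1 = (nm z)^-1. Proof. exact: Normc.normcV. Qed.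
Lemma nmN z : nm (- z) = nm z. Proof. exact: normcN. Qed.
Lemma nmD z w : nm (z + w) <= nm z + nm w. Proof. exact: le_normcD. Qed.
Lemma nmB z w : nm (z - w) <= nm z + nm w. Proof. by rewrite -(nmN w) nmD. Qed.
Lemma nmC z w : nm (z - w) = nm (w - z). Proof. by rewrite -opprB nmN. Qed.
Lemma nmX z n : nm (z ^+ n) = nm z ^+ n.
Proof. by elim: n => [|n IH]; rewrite ?expr0 ?nm1 // !exprS nmM IH. Qed.

Lemma nm_eq0 z : (nm z == 0) = (z == 0).
Proof. by apply/eqP/eqP => [/Normc.eq0_normc//|->]; rewrite nm0. Qed.

Lemma nm_gt0 z : (0 < nm z) = (z != 0).
Proof. by rewrite lt_neqAle nm_ge0 andbT eq_sym nm_eq0. Qed.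

Lemma nm_real (x : R) : nm x%:C = `|x|.
Proof. by rewrite /= expr0n /= addr0 sqrtr_sqr. Qed.

Lemma nmi : nm 'i = 1.
Proof. by rewrite /= expr0n /= add0r expr1n sqrtr1. Qed.

Lemma ImM z w : Im (z * w) = Re z * Im w + Im z * Re w.
Proof. by case: z => ? ?; case: w => ? ?. Qed.

Lemma ReD z w : Re (z + w) = Re z + Re w. Proof. by case: z => ? ?; case: w => ? ?. Qed.
Lemma ImD z w : Im (z + w) = Im z + Im w. Proof. by case: z => ? ?; case: w => ? ?. Qed.
Lemma ReN z : Re (- z) = - Re z. Proof. by case: z => ? ?. Qed.
Lemma ImN z : Im (- z) = - Im z. Proof. by case: z => ? ?. Qed.

Lemma sqr_nm z : nm z ^+ 2 = Re z ^+ 2 + Im z ^+ 2.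
Proof. by case: z => a b /=; rewrite sqr_sqrtr ?addr_ge0 ?sqr_ge0. Qed.

Lemma nm_Re z : `|Re z| <= nm z.
Proof.
rewrite -(@ler_pXn2r _ 2) ?nnegrE ?nm_ge0 // sqr_nm real_normK ?num_real //.
by rewrite lerDl sqr_ge0.
Qed.

Lemma nm_Im z : `|Im z| <= nm z.
Proof.
rewrite -(@ler_pXn2r _ 2) ?nnegrE ?nm_ge0 // sqr_nm real_normK ?num_real //.
by rewrite lerDr sqr_ge0.
Qed.

Lemma nm_le z : nm z <= `|Re z| + `|Im z|.
Proof.
rewrite -(@ler_pXn2r _ 2) ?nnegrE ?nm_ge0 ?addr_ge0 // sqr_nm sqrrD.
rewrite !real_normK ?num_real // lerD2r lerDl.
by rewrite mulrn_wge0 // mulr_ge0.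
Qed.

Lemma half_complex : (2^-1 : C) = (2^-1 : R)%:C.
Proof. by rewrite fmorphV rmorph_nat. Qed.

End Modulus.

(** * Midpoint sums along segments *)

Section SegmentSums.
Local Open Scope complex_scope.
Variable R : realType.
Local Notation C := (R[i]).
Local Notation nm := (@Normc.normc R).
Local Notation Re := (@complex.Re R).
Local Notation Im := (@complex.Im R).
Implicit Types (f g : C -> C) (z w p d : C).

(* Midpoint rule for the integral of [f] along the segment from [p] to [p + d],
   cut into [2 ^ N] pieces; the recursion makes bisection hold on the nose. *)
Fixpoint segsum N f p d : C :=
  if N is N'.+1 then segsum N' f p (d / 2) + segsum N' f (p + d / 2) (d / 2)
  else f (p + d / 2) * d.

Definition on_seg p d z := exists2 t : R, 0 <= t <= 1 & z = p + t%:C * d.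

Lemma on_seg_mid p d : on_seg p d (p + d / 2).
Proof.
exists 2^-1; last by rewrite -half_complex mulrC.
by lra.
Qed.

Lemma on_segl p d z : on_seg p (d / 2) z -> on_seg p d z.
Proof.
case=> t ht ->; exists (t / 2); first by lra.
by rewrite rmorphM /= -half_complex -mulrA [_ * d]mulrC.
Qed.

Lemma on_segr p d z : on_seg (p + d / 2) (d / 2) z -> on_seg p d z.
Proof.
case=> t ht ->; exists ((t + 1) / 2); first by lra.
by rewrite rmorphM rmorphD rmorph1 /= -half_complex; ring.
Qed.

Lemma eq_segsum N f g p d :
  (forall z, on_seg p d z -> f z = g z) -> segsum N f p d = segsum N g p d.
Proof.
elim: N p d => [|N IH] p d h /=; first by rewrite h //; exact: on_seg_mid.
by rewrite !IH // => z hz; apply: h; [exact: on_segr|exact: on_segl].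
Qed.

(** Reversal preserves midpoints and exchanges the two halves, so this is exact at every depth. It
    makes the common sides of adjacent squares cancel. *)
Lemma segsum_rev N f p d : segsum N f (p + d) (- d) = - segsum N f p d.
Proof.
elim: N p d => [|N IH] p d /=.
  by rewrite mulrN; congr (- (f _ * _)); field.
rewrite mulNr opprD addrC; congr (_ + _).
  by rewrite -IH; congr segsum; field.
by rewrite -IH; congr segsum; field.
Qed.

(** The midpoint rule is exact on affine functions. Hence their sums around a square vanish at every
    depth, without a limit, as if a primitive were available. *)
Lemma segsum_affine N a b p d :
  segsum N (fun z => a * z + b) p d = (a * (p + d / 2) + b) * d.
Proof. by elim: N p d => [|N IH] p d //=; rewrite !IH; field. Qed.

Lemma segsumD N f g p d :
  segsum N (fun z => f z + g z) p d = segsum N f p d + segsum N g p d.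
Proof. by elim: N p d => [|N IH] p d /=; rewrite ?IH; ring. Qed.

Lemma segsumZ N a f p d :
  segsum N (fun z => a * f z) p d = a * segsum N f p d.
Proof. by elim: N p d => [|N IH] p d /=; rewrite ?IH; ring. Qed.

Lemma segsum_bound N f p d (M : R) :
  (forall z, on_seg p d z -> nm (f z) <= M) -> nm (segsum N f p d) <= M * nm d.
Proof.
elim: N p d => [|N IH] p d h /=.
  by rewrite nmM ler_wpM2r ?nm_ge0 ?h //; exact: on_seg_mid.
rewrite (le_trans (nmD _ _)) //.
have -> : M * nm d = M * nm (d / 2) + M * nm (d / 2).
  rewrite nmM half_complex nm_real ger0_norm; last lra.
  by field.
apply: lerD; apply: IH => z hz; apply: h; [exact: on_segl|exact: on_segr].
Qed.

(** Halving [d] halves the pointwise bound, and the two halves of the segment add it up again. *)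
Lemma segsum_Im_ge N f p d (m : R) :
  (forall z, on_seg p d z -> m <= Im (f z * d)) -> m <= Im (segsum N f p d).
Proof.
elim: N p d m => [|N IH] p d m h /=; first by apply: h; exact: on_seg_mid.
rewrite ImD [leLHS](_ : m = m / 2 + m / 2); last by field.
have half z : m <= Im (f z * d) -> m / 2 <= Im (f z * (d / 2)).
  move=> hz; rewrite mulrA half_complex ImM /= mulr0 add0r.
  by apply: ler_wpM2r => //; lra.
by apply: lerD; apply: IH => z hz; apply: half; apply: h;
  [exact: on_segl|exact: on_segr].
Qed.

End SegmentSums.

(** * Midpoint sums around squares *)

Section SquareSums.
Local Open Scope complex_scope.
Variable R : realType.
Local Notation C := (R[i]).
Local Notation nm := (@Normc.normc R).
Local Notation Re := (@complex.Re R).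
Local Notation Im := (@complex.Im R).
Implicit Types (f g : C -> C) (z w p : C) (s : R).

Definition in_sq p s z :=
  (Re p <= Re z <= Re p + s) && (Im p <= Im z <= Im p + s).

Definition on_bd p s z :=
  [\/ on_seg p s%:C z, on_seg (p + s%:C) ('i * s%:C) z,
      on_seg (p + s%:C + 'i * s%:C) (- s%:C) z
    | on_seg (p + 'i * s%:C) (- ('i * s%:C)) z].

Definition sqsum N f p s : C :=
  segsum N f p s%:C + segsum N f (p + s%:C) ('i * s%:C)
  + segsum N f (p + s%:C + 'i * s%:C) (- s%:C)
  + segsum N f (p + 'i * s%:C) (- ('i * s%:C)).

Lemma sqsumE N f p s :
  sqsum N f p s = segsum N f p s%:C + segsum N f (p + s%:C) ('i * s%:C)
   - segsum N f (p + 'i * s%:C) s%:C - segsum N f p ('i * s%:C).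
Proof. by rewrite /sqsum segsum_rev (addrAC p) segsum_rev. Qed.

Lemma on_bd_sq p s z : 0 <= s -> on_bd p s z -> in_sq p s z.
Proof.
case: p => a b hs; rewrite /in_sq.
case=> -[t ht ->] /=; rewrite !(mul0r, mulr0, mulr1, mul1r, addr0, add0r,
  subr0, oppr0, sub0r, mulrN);
  apply/andP; split; nra.
Qed.

(** Each inner side is run through twice in opposite directions, and each outer side at depth [N.+1]
    is by definition two halves at depth [N]. *)
Lemma sqsumS N f p s : sqsum N.+1 f p s =
  sqsum N f p (s / 2) + sqsum N f (p + (s / 2)%:C) (s / 2)
  + sqsum N f (p + 'i * (s / 2)%:C) (s / 2)
  + sqsum N f (p + (s / 2)%:C + 'i * (s / 2)%:C) (s / 2).
Proof.
rewrite !sqsumE /= -!(mulrA 'i) rmorphM /= -half_complex.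
set q := s%:C / 2.
have -> : p + s%:C = p + q + q by rewrite /q; field.
have -> : p + 'i * s%:C = p + 'i * q + 'i * q by rewrite /q; field.
rewrite !(addrAC _ q ('i * q)).
by ring.
Qed.

Lemma eq_sqsum N f g p s :
  (forall z, on_bd p s z -> f z = g z) -> sqsum N f p s = sqsum N g p s.
Proof.
move=> h; rewrite /sqsum; congr (_ + _ + _ + _); apply: eq_segsum => z hz; apply: h.
- exact: Or41. - exact: Or42. - exact: Or43. - exact: Or44.
Qed.

Lemma sqsum_affine N a b p s : sqsum N (fun z => a * z + b) p s = 0.
Proof. by rewrite sqsumE !segsum_affine; field. Qed.

Lemma sqsumD N f g p s :
  sqsum N (fun z => f z + g z) p s = sqsum N f p s + sqsum N g p s.
Proof. by rewrite /sqsum !segsumD; ring. Qed.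

Lemma sqsumZ N a f p s : sqsum N (fun z => a * f z) p s = a * sqsum N f p s.
Proof. by rewrite /sqsum !segsumZ; ring. Qed.

Lemma sqsum_bound N f p s (M : R) : 0 <= s ->
  (forall z, on_bd p s z -> nm (f z) <= M) -> nm (sqsum N f p s) <= 4 * s * M.
Proof.
move=> hs h.
have ns : nm s%:C = s by rewrite nm_real ger0_norm.
have nis : nm ('i * s%:C) = s by rewrite nmM nmi mul1r.
have h1 : nm (segsum N f p s%:C) <= M * s.
  by rewrite -[s in leRHS]ns; apply: segsum_bound => z hz; apply: h; apply: Or41.
have h2 : nm (segsum N f (p + s%:C) ('i * s%:C)) <= M * s.
  by rewrite -[s in leRHS]nis; apply: segsum_bound => z hz; apply: h; apply: Or42.
have h3 : nm (segsum N f (p + s%:C + 'i * s%:C) (- s%:C)) <= M * s.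
  rewrite -[s in leRHS]ns -[nm _ in leRHS]nmN.
  by apply: segsum_bound => z hz; apply: h; apply: Or43.
have h4 : nm (segsum N f (p + 'i * s%:C) (- ('i * s%:C))) <= M * s.
  rewrite -[s in leRHS]nis -[nm _ in leRHS]nmN.
  by apply: segsum_bound => z hz; apply: h; apply: Or44.
rewrite /sqsum.
have := nmD (segsum N f p s%:C + segsum N f (p + s%:C) ('i * s%:C) +
   segsum N f (p + s%:C + 'i * s%:C) (- s%:C))
   (segsum N f (p + 'i * s%:C) (- ('i * s%:C))).
have := nmD (segsum N f p s%:C + segsum N f (p + s%:C) ('i * s%:C))
   (segsum N f (p + s%:C + 'i * s%:C) (- s%:C)).
have := nmD (segsum N f p s%:C) (segsum N f (p + s%:C) ('i * s%:C)).
lra.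
Qed.

Lemma in_sq_dist p s z w : in_sq p s z -> in_sq p s w -> nm (w - z) <= 2 * s.
Proof.
rewrite /in_sq => /andP[/andP[a1 a2] /andP[b1 b2]] /andP[/andP[c1 c2] /andP[d1 d2]].
have := nm_le (w - z); rewrite ReD ImD ReN ImN.
have : `|Re w - Re z| <= s by rewrite ler_norml; lra.
have : `|Im w - Im z| <= s by rewrite ler_norml; lra.
lra.
Qed.

End SquareSums.

(** * Goursat's theorem *)

Section NestedIntervals.
Local Open Scope complex_scope.
Variable R : realType.

Lemma nested_intervals (a l : nat -> R) :
    (forall k, 0 <= l k) ->
    (forall k, a k <= a k.+1 /\ a k.+1 + l k.+1 <= a k + l k) ->
  exists x, forall k, a k <= x <= a k + l k.
Proof.
move=> hl ha.
have am : {homo a : i j / (i <= j)%N >-> i <= j}.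
  by apply: homo_leq => [//|? ? ? /le_trans|k]; [exact|case: (ha k)].
have bm i j : (i <= j)%N -> a j + l j <= a i + l i.
  elim: j => [|j IH]; first by rewrite leqn0 => /eqP ->.
  rewrite leq_eqVlt => /predU1P[->//|/IH]; apply: le_trans.
  by case: (ha j).
have ub k j : a j <= a k + l k.
  case: (leqP j k) => [/am h|/ltnW /bm h]; first by rewrite (le_trans h) // lerDl.
  by rewrite (le_trans _ h) // lerDl.
pose A : set R := (range a)%classic.
have A0 : A (a 0%N) by exists 0%N.
exists (sup A) => k; apply/andP; split.
  apply: ub_le_sup; last by exists k.
  by exists (a 0%N + l 0%N) => _ [j _ <-]; exact: ub.
by apply: ge_sup; [exists (a 0%N)|move=> _ [j _ <-]; exact: ub].
Qed.

Lemma exists_half_pow (s d : R) : 0 < d -> exists k, s / 2 ^+ k < d.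
Proof.
move=> hd.
have [m hm] : exists m : nat, s / d < m%:R.
  exists (Num.truncn (Num.max 0 (s / d))).+1.
  apply: le_lt_trans (truncnS_gt _) => //.
  by rewrite le_max lexx orbT.
exists m; rewrite ltr_pdivrMr ?exprn_gt0 //.
rewrite ltr_pdivrMr // in hm; apply: lt_le_trans hm _.
rewrite mulrC ler_pM2l //.
by rewrite -natrX ler_nat ltnW // ltn_expl.
Qed.

End NestedIntervals.

Section Goursat.
Local Open Scope complex_scope.
Variable R : realType.
Local Notation C := (R[i]).
Local Notation nm := (@Normc.normc R).
Local Notation Re := (@complex.Re R).
Local Notation Im := (@complex.Im R).

Definition cdiff (f : C -> C) z := exists d : C, forall e : R, 0 < e ->
  exists2 t : R, 0 < t & forall w, nm w < t ->
    nm (f (z + w) - f z - d * w) <= e * nm w.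

Definition ccont (f : C -> C) z := forall e : R, 0 < e ->
  exists2 t : R, 0 < t & forall w, nm w < t -> nm (f (z + w) - f z) <= e.

Definition ssqrt (x : R) : R := if 0 <= x then Num.sqrt x else - Num.sqrt (- x).

Lemma ssqrt_mono : {homo ssqrt : x y / x <= y}.
Proof.
move=> x y hxy; rewrite /ssqrt; case: ifPn => hx.
  by rewrite (le_trans hx hxy) ler_sqrt // (le_trans hx).
rewrite -ltNge in hx; case: ifPn => hy.
  by rewrite (@le_trans _ _ 0) // ?sqrtr_ge0 // oppr_le0 sqrtr_ge0.
by rewrite lerN2 ler_sqrt ?lerN2 // oppr_ge0 ltW.
Qed.

(** The interval is cut by [x] into lengths u and v with u + v = s, and the increment is sqrt u +
    sqrt v, whose square is at least u + v. The infinite slope of [ssqrt] at 0 is what makes the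
    gain sqrt s. *)
Lemma ssqrt_gap (a x s : R) : 0 <= s -> a <= x <= a + s ->
  Num.sqrt s <= ssqrt (a + s - x) - ssqrt (a - x).
Proof.
move=> hs /andP[h1 h2]; rewrite /ssqrt.
have -> : (0 <= a + s - x) by lra.
set u := a + s - x; set v := - (a - x).
have -> : (if 0 <= a - x then Num.sqrt (a - x) else - Num.sqrt v) = - Num.sqrt v.
  case: ifPn => // h; have -> : a - x = 0 by lra.
  by rewrite /v (_ : a - x = 0) ?oppr0 ?sqrtr0 ?oppr0 //; lra.
rewrite opprK -(@ler_pXn2r _ 2) ?nnegrE ?addr_ge0 ?sqrtr_ge0 // sqrrD.
rewrite !sqr_sqrtr //; [|rewrite /v; lra|rewrite /u; lra].
have : 0 <= Num.sqrt u * Num.sqrt v by rewrite mulr_ge0 ?sqrtr_ge0.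
by rewrite /u /v; lra.
Qed.

(* A weight of squares, additive under bisection, which dominates the side of
   every square containing [a]. *)
Definition pwt (a p : C) (s : R) : R :=
  (ssqrt (Re p + s - Re a) - ssqrt (Re p - Re a)) *
  (ssqrt (Im p + s - Im a) - ssqrt (Im p - Im a)).

(** The error budget of a square. The area pays near a point of differentiability, where sums are
    o(s^2); the terms [pwt] pay near an exceptional point of [Z], where continuity gives only
    o(s). *)
Definition wt (Z : seq C) (p : C) (s : R) : R :=
  s ^+ 2 + \sum_(a <- Z) pwt a p s.

Lemma pwt_ge0 a p s : 0 <= s -> 0 <= pwt a p s.
Proof. by move=> hs; apply: mulr_ge0; rewrite subr_ge0 ssqrt_mono //; lra. Qed.

Lemma pwt_ge a p s : 0 <= s -> in_sq p s a -> s <= pwt a p s.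
Proof.
move=> hs /andP[h1 h2]; rewrite -[leLHS]sqr_sqrtr // expr2.
by apply: ler_pM; rewrite ?sqrtr_ge0 ?ssqrt_gap.
Qed.

(** Each [pwt] is a product of an increment in the real part and one in the imaginary part, hence
    additive on rectangles like an area. *)
Lemma wt_split Z p s : wt Z p s =
  wt Z p (s / 2) + wt Z (p + (s / 2)%:C) (s / 2)
  + wt Z (p + 'i * (s / 2)%:C) (s / 2)
  + wt Z (p + (s / 2)%:C + 'i * (s / 2)%:C) (s / 2).
Proof.
rewrite /wt.
have -> : \sum_(a <- Z) pwt a p s = \sum_(a <- Z) (pwt a p (s / 2) +
    pwt a (p + (s / 2)%:C) (s / 2) + pwt a (p + 'i * (s / 2)%:C) (s / 2)
   + pwt a (p + (s / 2)%:C + 'i * (s / 2)%:C) (s / 2)).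
  apply: eq_bigr => a _; case: p => p1 p2; rewrite /pwt /=.
  rewrite !(mul0r, mulr0, mul1r, addr0, add0r, subr0).
  have -> : p1 + s / 2 + s / 2 = p1 + s by field.
  have -> : p2 + s / 2 + s / 2 = p2 + s by field.
  by ring.
rewrite !big_split /= (_ : s ^+ 2 = 4 * (s / 2) ^+ 2); last by field.
by ring.
Qed.

Lemma wt_ge Z p s : 0 <= s -> s ^+ 2 <= wt Z p s.
Proof. by move=> hs; rewrite lerDl sumr_ge0 // => a _; exact: pwt_ge0. Qed.

Lemma wt_ge_mem Z p s a : 0 <= s -> a \in Z -> in_sq p s a -> s <= wt Z p s.
Proof.
move=> hs ha hin; rewrite /wt (big_rem a) //=.
have := pwt_ge hs hin; have : 0 <= s ^+ 2 by rewrite sqr_ge0.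
have : 0 <= \sum_(y <- rem a Z) pwt y p s.
  by rewrite sumr_ge0 // => b _; exact: pwt_ge0.
by lra.
Qed.

Section Fixed.
Local Open Scope complex_scope.
Variables (f : C -> C) (Z : seq C).

(** The bound is relative to the additive weight, so that four small quarters make a small square.
    It is asked only for large depths, since bisection lowers the depth by one. *)
Definition small_sum (e : R) (q : C * R) := exists N0, forall N, (N0 <= N)%N ->
  nm (sqsum N f q.1 q.2) <= e * wt Z q.1 q.2.

Lemma small_sum_quarters e p s :
  small_sum e (p, s / 2) -> small_sum e (p + (s / 2)%:C, s / 2) ->
  small_sum e (p + 'i * (s / 2)%:C, s / 2) ->
  small_sum e (p + (s / 2)%:C + 'i * (s / 2)%:C, s / 2) -> small_sum e (p, s).
Proof.
move=> [N1 h1] [N2 h2] [N3 h3] [N4 h4].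
exists (N1 + N2 + N3 + N4).+1 => -[//|N]; rewrite ltnS => hN; rewrite [X in sqsum _ _ X _]/= [X in sqsum _ _ _ X]/= [X in wt _ X _]/= [X in wt _ _ X]/=.
have {}h1 : nm (sqsum N f p (s / 2)) <= e * wt Z p (s / 2).
  by apply: h1; lia.
have {}h2 : nm (sqsum N f (p + (s / 2)%:C) (s / 2)) <= e * wt Z (p + (s / 2)%:C) (s / 2).
  by apply: h2; lia.
have {}h3 : nm (sqsum N f (p + 'i * (s / 2)%:C) (s / 2)) <= e * wt Z (p + 'i * (s / 2)%:C) (s / 2).
  by apply: h3; lia.
have {}h4 : nm (sqsum N f (p + (s / 2)%:C + 'i * (s / 2)%:C) (s / 2)) <= e * wt Z (p + (s / 2)%:C + 'i * (s / 2)%:C) (s / 2).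
  by apply: h4; lia.
rewrite sqsumS (wt_split Z p s).
rewrite (mulrDr e (_ + _ + _)) (mulrDr e (_ + _)) (mulrDr e (wt _ _ _)).
have := nmD (sqsum N f p (s / 2) + sqsum N f (p + (s / 2)%:C) (s / 2)
  + sqsum N f (p + 'i * (s / 2)%:C) (s / 2))
  (sqsum N f (p + (s / 2)%:C + 'i * (s / 2)%:C) (s / 2)).
have := nmD (sqsum N f p (s / 2) + sqsum N f (p + (s / 2)%:C) (s / 2))
  (sqsum N f (p + 'i * (s / 2)%:C) (s / 2)).
have := nmD (sqsum N f p (s / 2)) (sqsum N f (p + (s / 2)%:C) (s / 2)).
lra.
Qed.

(** The fourth quarter is returned untested: if the square is bad and the other three quarters are
    small, it has to be bad. *)
Definition bad_quarter e (q : C * R) : C * R :=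
  let p := q.1 in let s := q.2 / 2 in
  if ~~ `[< small_sum e (p, s) >] then (p, s) else
  if ~~ `[< small_sum e (p + s%:C, s) >] then (p + s%:C, s) else
  if ~~ `[< small_sum e (p + 'i * s%:C, s) >] then (p + 'i * s%:C, s)
  else (p + s%:C + 'i * s%:C, s).

Lemma bad_quarterP e q : ~ small_sum e q -> ~ small_sum e (bad_quarter e q).
Proof.
case: q => p s h; rewrite /bad_quarter /=.
do 3 (case: asboolP => //= ?); move=> ?.
by apply: h; apply: small_sum_quarters.
Qed.

Lemma bad_quarter2 e q : (bad_quarter e q).2 = q.2 / 2.
Proof. by rewrite /bad_quarter; repeat case: ifP => _. Qed.

Lemma bad_quarter_sub e q : 0 <= q.2 ->
  let q' := bad_quarter e q in
  (Re q.1 <= Re q'.1 /\ Re q'.1 + q'.2 <= Re q.1 + q.2) /\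
  (Im q.1 <= Im q'.1 /\ Im q'.1 + q'.2 <= Im q.1 + q.2).
Proof.
case: q => [[p1 p2] s] /= hs; rewrite /bad_quarter /=.
by repeat (case: ifP => _ /=); rewrite ?(mul0r, mulr0, mul1r, addr0, add0r, subr0);
  split; split; lra.
Qed.

Lemma small_sum_diff e z : 0 < e -> cdiff f z -> exists2 t, 0 < t &
  forall p s, 0 < s < t -> in_sq p s z -> small_sum e (p, s).
Proof.
(* The perimeter 4s times the distance bound 2s from [in_sq_dist] makes e/8 into e s^2; the affine
   part contributes zero. *)
move=> he [d hd]; have [|t ht H] := hd (e / 8); first lra.
exists (t / 2) => [|p s /andP[hs hst] hin]; first lra.
exists 0%N => N _ /=.
have -> : sqsum N f p s =
    sqsum N (fun w => (d * w + (f z - d * z)) + (f w - f z - d * (w - z))) p s.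
  by apply: eq_sqsum => w _; ring.
rewrite sqsumD sqsum_affine add0r.
apply: (@le_trans _ _ (4 * s * (e / 8 * (2 * s)))).
  apply: sqsum_bound => [|w /(on_bd_sq (ltW hs)) hw]; first exact: ltW.
  have hd2 := in_sq_dist hin hw.
  have := H (w - z); rewrite (addrC z) subrK => /(_ (ltac:(lra))) /le_trans; apply.
  by rewrite ler_pM2l //; lra.
apply: (@le_trans _ _ (e * s ^+ 2)); first by rewrite le_eqVlt; apply/orP; left; apply/eqP; field.
by rewrite ler_pM2l // wt_ge // ltW.
Qed.

Lemma small_sum_cont e z : 0 < e -> ccont f z -> z \in Z -> exists2 t, 0 < t &
  forall p s, 0 < s < t -> in_sq p s z -> small_sum e (p, s).
Proof.
(* With perimeter 4s the error is e s, only linear in s; the weight attached to [z] is at least s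
   and covers it. *)
move=> he hc hz; have [|t ht H] := hc (e / 4); first lra.
exists (t / 2) => [|p s /andP[hs hst] hin]; first lra.
exists 0%N => N _ /=.
have -> : sqsum N f p s =
    sqsum N (fun w => (0 * w + f z) + (f w - f z)) p s.
  by apply: eq_sqsum => w _; ring.
rewrite sqsumD sqsum_affine add0r.
apply: (@le_trans _ _ (4 * s * (e / 4))).
  apply: sqsum_bound => [|w /(on_bd_sq (ltW hs)) hw]; first exact: ltW.
  have hd2 := in_sq_dist hin hw.
  by have := H (w - z); rewrite (addrC z) subrK; apply; lra.
apply: (@le_trans _ _ (e * s)); first by rewrite le_eqVlt; apply/orP; left; apply/eqP; field.
by rewrite ler_pM2l // (wt_ge_mem _ hz) // ltW.
Qed.

Theorem goursat p s : 0 < s ->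
    (forall z, in_sq p s z -> cdiff f z \/ (z \in Z /\ ccont f z)) ->
  forall e, 0 < e -> exists N0, forall N, (N0 <= N)%N -> nm (sqsum N f p s) <= e.
Proof.
move=> hs hf e0 he0.
have w0 : 0 < wt Z p s by apply: lt_le_trans (wt_ge _ _ (ltW hs)); rewrite exprn_gt0.
(* The absolute error is turned into one relative to the weight, which is what bisection
   preserves. *)
suff [N0 H] : small_sum (e0 / wt Z p s) (p, s).
  by exists N0 => N /H /=; rewrite divfK // gt_eqF.
have : 0 < e0 / wt Z p s by rewrite divr_gt0.
move: (e0 / wt Z p s) => e he.
apply: contrapT => hbad.
pose q k := iter k (bad_quarter e) (p, s).
have qbad k : ~ small_sum e (q k).
  by elim: k => //= k IH; apply: bad_quarterP.
have q2 k : (q k).2 = s / 2 ^+ k.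
  elim: k => [|k IH] /=; first by rewrite divr1.
  by rewrite bad_quarter2 IH exprSr invfM mulrA.
have q2gt k : 0 < (q k).2 by rewrite q2 divr_gt0 // exprn_gt0.
have qsub k := bad_quarter_sub e (ltW (q2gt k)).
have [x hx] := @nested_intervals R (fun k => Re (q k).1) (fun k => (q k).2)
  (fun k => ltW (q2gt k)) (fun k => (qsub k).1).
have [y hy] := @nested_intervals R (fun k => Im (q k).1) (fun k => (q k).2)
  (fun k => ltW (q2gt k)) (fun k => (qsub k).2).
have hin k : in_sq (q k).1 (q k).2 (x +i* y) by rewrite /in_sq /= hx hy.
have [t ht H] : exists2 t, 0 < t & forall p s, 0 < s < t ->
    in_sq p s (x +i* y) -> small_sum e (p, s).
  case: (hf _ (hin 0%N)) => [hd|[hz hc]].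
    exact: small_sum_diff.
  exact: small_sum_cont.
have [k hk] := exists_half_pow s ht.
apply: (qbad k); rewrite [q k]surjective_pairing; apply: H => //.
by rewrite q2gt q2.
Qed.

End Fixed.
End Goursat.

(** * Cauchy estimates *)

Section DifferenceQuotients.
Local Open Scope complex_scope.
Variable R : realType.
Local Notation C := (R[i]).
Local Notation nm := (@Normc.normc R).
Implicit Types (f g : C -> C) (a z c d : C).

Definition slope f d a z := if z == a then d else (f z - f a) / (z - a).

Lemma slopeK f d a z : f z = f a + slope f d a z * (z - a).
Proof.
rewrite /slope; case: eqVneq => [->|h]; first by rewrite subrr mulr0 addr0.
by rewrite divfK ?subr_eq0 // addrC subrK.
Qed.

Lemma ccont_near f g z (t : R) : 0 < t ->
  (forall w, nm w < t -> f (z + w) = g (z + w)) -> ccont f z -> ccont g z.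
Proof.
move=> ht hfg hf e he; have [s hs H] := hf e he.
exists (Num.min s t) => [|w]; first by rewrite lt_min hs ht.
rewrite lt_min => /andP[h1 h2]; rewrite -hfg //.
by rewrite -[g z]addr0 -[z in g z]addr0 -?hfg ?nm0 // !addr0; exact: H.
Qed.

Lemma ccont_divB f c a z : z != a -> ccont f z ->
  ccont (fun w => (f w - c) / (w - a)) z.
Proof.
move=> hza hf e he.
have za : z - a != 0 by rewrite subr_eq0.
have hr : 0 < nm (z - a) by rewrite nm_gt0.
set r := nm (z - a) in hr.
pose q := (f z - c) / (z - a).
have [|s hs H] := hf (e * r / 4); first by rewrite !mulr_gt0 // invr_gt0.
have hq : 0 <= nm q := nm_ge0 q.
pose t := e * r / (4 * (nm q + 1)).
have ht : 0 < t by rewrite divr_gt0 ?mulr_gt0 //; lra.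
exists (Num.min s (Num.min t (r / 2))) => [|w].
  by rewrite !lt_min hs ht /=; lra.
rewrite !lt_min => /and3P[h1 h2 h3].
have hw : r / 2 < nm (z + w - a).
  have := nmB (z + w - a) w; rewrite (_ : z + w - a - w = z - a); last by ring.
  by rewrite -/r; lra.
have wn : z + w - a != 0 by rewrite -nm_gt0; lra.
have -> : (f (z + w) - c) / (z + w - a) - (f z - c) / (z - a) =
    ((f (z + w) - f z) - q * w) / (z + w - a).
  by rewrite /q; field; rewrite wn za.
rewrite nmM nmV ler_pdivrMr; last lra.
apply: (@le_trans _ _ (e * r / 2)).
  apply: le_trans (nmB _ _) _; rewrite nmM.
  have h4 := H w h1.
  have h5 : nm q * nm w <= e * r / 4.
    apply: (@le_trans _ _ (nm q * t)); first by rewrite ler_wpM2l // ltW.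
    rewrite /t mulrA ler_pdivrMr; last lra.
    have : 0 <= e * r by rewrite mulr_ge0 ?ltW.
    by nra.
  by lra.
by rewrite -mulrA ler_pM2l // ltW.
Qed.

Lemma ccontB f g z : ccont f z -> ccont g z -> ccont (fun w => f w - g w) z.
Proof.
move=> hf hg e he.
have [|s hs Hf] := hf (e / 2); first lra.
have [|t ht Hg] := hg (e / 2); first lra.
exists (Num.min s t) => [|w]; first by rewrite lt_min hs ht.
rewrite lt_min => /andP[/Hf h1 /Hg h2].
rewrite (_ : _ - _ - _ = (f (z + w) - f z) - (g (z + w) - g z)); last by ring.
by apply: le_trans (nmB _ _) _; lra.
Qed.

(** Carathéodory's form of differentiability; it reduces the rules below to continuity of
    quotients. *)
Lemma cdiffP f z : cdiff f z <-> exists d, ccont (slope f d z) z.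
Proof.
split=> -[d hd]; exists d => e he.
  have [t ht H] := hd e he; exists t => // w /H {}H.
  have e1 : z + w - z = w by ring.
  rewrite /slope eqxx -subr_eq0 e1.
  case: eqVneq => [_|w0]; first by rewrite subrr nm0 ltW.
  rewrite -(ler_pM2r (_ : 0 < nm w)) ?nm_gt0 // -nmM.
  by rewrite mulrBl divfK.
have [t ht H] := hd e he; exists t => // w /H.
have e1 : z + w - z = w by ring.
rewrite /slope eqxx -subr_eq0 e1.
case: eqVneq => [-> _|w0]; first by rewrite addr0 subrr mulr0 subr0 nm0 mulr0.
by rewrite -(ler_pM2r (_ : 0 < nm w)) ?nm_gt0 // -nmM mulrBl divfK.
Qed.

Lemma cdiff_ccont f z : cdiff f z -> ccont f z.
Proof.
move=> [d hd] e he; have [t ht H] := hd 1 ltr01.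
have hdp : 0 <= nm d := nm_ge0 d.
exists (Num.min t (e / (nm d + 1))) => [|w].
  by rewrite lt_min ht divr_gt0 //; lra.
rewrite lt_min => /andP[h1]; rewrite ltr_pdivlMr; last lra.
move=> h2; have := H w h1.
have := nmD (f (z + w) - f z - d * w) (d * w); rewrite subrK nmM.
by lra.
Qed.

Lemma cdiffB f g z : cdiff f z -> cdiff g z -> cdiff (fun w => f w - g w) z.
Proof.
move=> /cdiffP[d hd] /cdiffP[d' hd']; apply/cdiffP; exists (d - d').
apply: (ccont_near ltr01 _ (ccontB hd hd')) => w _.
by rewrite /slope; case: eqVneq => // _; rewrite -mulrBl; congr (_ / _); ring.
Qed.

Lemma slope_near f d a z : z != a -> exists2 t : R, 0 < t &
  forall w, nm w < t -> z + w != a /\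
    (f (z + w) - f a) / (z + w - a) = slope f d a (z + w).
Proof.
move=> hza; exists (nm (z - a)) => [|w hw]; first by rewrite nm_gt0 subr_eq0.
have hwa : z + w != a.
  apply/eqP => e; move: hw.
  by rewrite -e opprD addrA subrr sub0r nmN ltxx.
by split=> //; rewrite /slope (negbTE hwa).
Qed.

Lemma ccont_slope f d a z : z != a -> ccont f z -> ccont (slope f d a) z.
Proof.
move=> hza hf; have [t ht H] := slope_near f d hza.
by apply: (ccont_near ht _ (ccont_divB (f a) hza hf)) => w /H[].
Qed.

(** With g the slope function at [a], the slope of g at [z] is (slope of [f] at [z], minus g(z))
    divided by w - a, a quotient known to be continuous. *)
Lemma cdiff_slope f d a z : z != a -> cdiff f z -> cdiff (slope f d a) z.
Proof.
move=> hza /cdiffP[d1 hd1]; apply/cdiffP.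
set g := slope f d a.
exists ((d1 - g z) / (z - a)).
have [t ht H] := slope_near f d hza.
apply: (ccont_near ht _ (ccont_divB (g z) hza hd1)) => w /H[hwa].
rewrite -/g => Hw.
have za : z - a != 0 by rewrite subr_eq0.
have wa : z + w - a != 0 by rewrite subr_eq0.
have gz : g z = (f z - f a) / (z - a) by rewrite /g /slope (negbTE hza).
rewrite /slope; case: eqVneq => [->//|hw].
have w0 : z + w - z != 0 by rewrite subr_eq0.
have w1 : w != 0 by move: w0; rewrite addrC addKr.
by rewrite -Hw gz; field; rewrite wa za ?w0 ?w1.
Qed.

End DifferenceQuotients.

Section CauchyEstimate.
Local Open Scope complex_scope.
Variable R : realType.
Local Notation C := (R[i]).
Local Notation nm := (@Normc.normc R).
Local Notation Re := (@complex.Re R).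
Local Notation Im := (@complex.Im R).
Implicit Types (f : C -> C) (a z : C) (r : R).

Definition corner r : C := (- r) +i* (- r).
Definition csq r z := in_sq (corner r) (2 * r) z.
Definition cbd r z := on_bd (corner r) (2 * r) z.

Lemma csqE r z : csq r z = (`|Re z| <= r) && (`|Im z| <= r).
Proof. by rewrite /csq /in_sq /= !ler_norml; congr (_ && _); lra. Qed.

Lemma csq_nm r z : nm z <= r -> csq r z.
Proof.
move=> h; rewrite csqE (le_trans (nm_Re z) h).
exact: le_trans (nm_Im z) h.
Qed.

Lemma cbd_csq r z : 0 <= r -> cbd r z -> csq r z.
Proof. by move=> hr; apply: on_bd_sq; rewrite mulr_ge0. Qed.

Lemma cbd_nm r z : 0 <= r -> cbd r z -> r <= nm z <= 2 * r.
Proof.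
move=> hr hz; have := cbd_csq hr hz; rewrite csqE => /andP[h1 h2].
have := nm_le z; have := nm_Re z; have := nm_Im z.
suff : `|Re z| = r \/ `|Im z| = r.
  by case=> e; rewrite ?e in h1 h2 *; lra.
case: hz => -[t ht ->] /=; rewrite !(mul0r, mulr0, mulr1, mul1r, addr0, add0r,
  subr0, oppr0, sub0r, mulrN).
- by right; rewrite normrN ger0_norm.
- by left; rewrite (_ : _ + _ = r) ?ger0_norm //; ring.
- by right; rewrite (_ : _ + _ = r) ?ger0_norm //; ring.
- by left; rewrite normrN ger0_norm.
Qed.

Lemma cbd_dist r a z : 0 <= r -> nm a <= r / 2 -> cbd r z -> r / 2 <= nm (z - a).
Proof.
move=> hr ha /(cbd_nm hr) /andP[h1 _].
by have := nmD (z - a) a; rewrite subrK; lra.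
Qed.

(* This bound replaces the value [2 i pi] of the integral. *)
Lemma winding_ge N r a : 0 < r -> nm a <= r / 2 ->
  8 / 9 <= Im (sqsum N (fun z => (z - a)^-1) (corner r) (2 * r)).
Proof.
move=> hr ha.
have := le_trans (nm_Re a) ha; have := le_trans (nm_Im a) ha.
rewrite !ler_norml => /andP[b1 b2] /andP[a1 a2].
(* Write z - a = x + iy. On a side the imaginary part of d/(z - a) is m/(x^2 + y^2), where m is the
   length 2r times the distance from [a] to the side, so at least r^2. Since |x| and |y| are at most
   3r/2, the quotient is at least 2/9, and four sides give 8/9. *)
have key x y m : r / 2 <= `|x| \/ r / 2 <= `|y| ->
    `|x| <= 3 / 2 * r -> `|y| <= 3 / 2 * r -> r ^+ 2 <= m ->
    2 / 9 <= m / (x ^+ 2 + y ^+ 2).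
  move=> hxy hx hy hm.
  have hx2 : x ^+ 2 <= (3 / 2 * r) ^+ 2.
    by rewrite -(real_normK (num_real x)) ler_pXn2r ?nnegrE //; lra.
  have hy2 : y ^+ 2 <= (3 / 2 * r) ^+ 2.
    by rewrite -(real_normK (num_real y)) ler_pXn2r ?nnegrE //; lra.
  have hp : 0 < x ^+ 2 + y ^+ 2.
    case: hxy => h.
      have : 0 < x ^+ 2 by rewrite exprn_even_gt0 //= -normr_gt0; lra.
      by have := sqr_ge0 y; lra.
    have : 0 < y ^+ 2 by rewrite exprn_even_gt0 //= -normr_gt0; lra.
    by have := sqr_ge0 x; lra.
  by rewrite ler_pdivlMr //; nra.
case: a ha a1 a2 b1 b2 => a1 a2 ha /= ha1 ha2 hb1 hb2.
rewrite /sqsum !ImD.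
have h1 : 2 / 9 <= Im (segsum N (fun z => (z - (a1 +i* a2))^-1) (corner r) (2 * r)%:C).
  apply: segsum_Im_ge => _ [t /andP[ht1 ht2] ->] /=.
  rewrite !(mul0r, mulr0, mulr1, mul1r, addr0, add0r, subr0, oppr0, sub0r, mulrN).
  rewrite -mulNr mulrAC; apply: key; rewrite ?ler_norml; try nra.
  by right; rewrite ler_normr; apply/orP; right; lra.
have h2 : 2 / 9 <= Im (segsum N (fun z => (z - (a1 +i* a2))^-1)
    (corner r + (2 * r)%:C) ('i * (2 * r)%:C)).
  apply: segsum_Im_ge => _ [t /andP[ht1 ht2] ->] /=.
  rewrite !(mul0r, mulr0, mulr1, mul1r, addr0, add0r, subr0, oppr0, sub0r, mulrN).
  rewrite mulrAC; apply: key; rewrite ?ler_norml; try nra.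
  by left; rewrite ler_normr; apply/orP; left; lra.
have h3 : 2 / 9 <= Im (segsum N (fun z => (z - (a1 +i* a2))^-1)
    (corner r + (2 * r)%:C + 'i * (2 * r)%:C) (- (2 * r)%:C)).
  apply: segsum_Im_ge => _ [t /andP[ht1 ht2] ->] /=.
  rewrite !(mul0r, mulr0, mulr1, mul1r, addr0, add0r, subr0, oppr0, sub0r, mulrN, mulNr, opprK).
  rewrite mulrAC; apply: key; rewrite ?ler_norml; try nra.
  by right; rewrite ler_normr; apply/orP; left; lra.
have h4 : 2 / 9 <= Im (segsum N (fun z => (z - (a1 +i* a2))^-1)
    (corner r + 'i * (2 * r)%:C) (- ('i * (2 * r)%:C))).
  apply: segsum_Im_ge => _ [t /andP[ht1 ht2] ->] /=.
  rewrite !(mul0r, mulr0, mulr1, mul1r, addr0, add0r, subr0, oppr0, sub0r, mulrN).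
  rewrite mulrAC -[X in _ <= X]mulNr; apply: key; rewrite ?ler_norml; try nra.
  by left; rewrite ler_normr; apply/orP; right; lra.
lra.
Qed.

(** By Goursat, with [a] joined to the exceptional points, the sums of the slope function at [a]
    tend to 0. Hence f(a) times the winding sum is the sum of f(z)/(z - a) up to [e]. Perimeter 8r
    and |z - a| >= r/2 bound the latter by 16 M, and 18 is 16 divided by 8/9. *)
Lemma cauchy_estimate f (Z : seq C) r a (M : R) : 0 < r -> nm a <= r / 2 ->
    cdiff f a ->
    (forall z, csq r z -> cdiff f z \/ (z \in Z /\ ccont f z)) ->
    (forall z, cbd r z -> nm (f z) <= M) ->
  nm (f a) <= 18 * M.
Proof.
move=> hr ha [d hd] hf hM.
have hM0 : 0 <= M.
  apply: le_trans (nm_ge0 _) (hM (corner r) _).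
  by apply: Or41; exists 0; [lra|rewrite mul0r addr0].
have ghyp z : csq r z ->
    cdiff (slope f d a) z \/ (z \in a :: Z /\ ccont (slope f d a) z).
  move=> hz; case: (eqVneq z a) => [->|hza].
    right; split; first exact: mem_head.
    have /cdiffP[d' hd'] : cdiff f a by exists d.
    move=> e he; have [t ht H] := hd e he; exists t => // w /H {}H.
    have e1 : a + w - a = w by ring.
    rewrite /slope eqxx -subr_eq0 e1.
    case: eqVneq => [_|w0]; first by rewrite subrr nm0 ltW.
    rewrite -(ler_pM2r (_ : 0 < nm w)) ?nm_gt0 // -nmM.
    by rewrite mulrBl divfK.
  case: (hf z hz) => [h|[h1 h2]]; first by left; exact: cdiff_slope.
  by right; split; [rewrite in_cons h1 orbT|exact: ccont_slope].
suff H e : 0 < e -> nm (f a) * (8 / 9) <= 16 * M + e.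
  suff : nm (f a) * (8 / 9) <= 16 * M by lra.
  by apply/ler_addgt0Pr => e; exact: H.
move=> he.
have [|N0 /(_ N0 (leqnn _)) H] := goursat _ ghyp he; first lra.
set S := sqsum N0 (fun z => (z - a)^-1) (corner r) (2 * r).
have hS : 8 / 9 <= nm S.
  apply: le_trans (winding_ge N0 hr ha) _.
  exact: le_trans (ler_norm _) (nm_Im _).
have hd0 z : cbd r z -> z != a.
  move=> hz; rewrite -subr_eq0 -nm_gt0.
  by apply: lt_le_trans (cbd_dist (ltW hr) ha hz); lra.
have e1 : sqsum N0 (slope f d a) (corner r) (2 * r) =
    sqsum N0 (fun z => f z / (z - a)) (corner r) (2 * r) - f a * S.
  rewrite -mulNr /S -sqsumZ -sqsumD; apply: eq_sqsum => z hz.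
  by rewrite /slope (negbTE (hd0 z hz)) mulrBl mulNr.
have h1 : nm (sqsum N0 (fun z => f z / (z - a)) (corner r) (2 * r)) <= 16 * M.
  rewrite [leRHS](_ : _ = 4 * (2 * r) * (M / (r / 2))); last first.
    by field; rewrite gt_eqF.
  apply: sqsum_bound => [|z hz]; first lra.
  rewrite nmM nmV; apply: ler_pM; rewrite ?nm_ge0 ?invr_ge0 ?nm_ge0 ?hM //.
  have h := cbd_dist (ltW hr) ha hz.
  by rewrite lef_pV2 ?posrE //; lra.
have h2 : nm (f a) * nm S <= 16 * M + e.
  rewrite -nmM; have -> : f a * S = sqsum N0 (fun z => f z / (z - a)) (corner r) (2 * r)
     - sqsum N0 (slope f d a) (corner r) (2 * r) by rewrite e1; ring.
  by apply: le_trans (nmB _ _) _; apply: lerD.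
by apply: le_trans h2; rewrite ler_wpM2l ?nm_ge0.
Qed.

End CauchyEstimate.

(** * Removable singularities and Taylor expansions *)

Section Taylor.
Local Open Scope complex_scope.
Variable R : realType.
Local Notation C := (R[i]).
Local Notation nm := (@Normc.normc R).
Local Notation Re := (@complex.Re R).
Local Notation Im := (@complex.Im R).
Implicit Types (f : C -> C) (a z : C) (r : R).

Lemma exists_small (t : R) : 0 < t -> exists2 a : C, a != 0 & nm a < t.
Proof.
move=> ht; have h : nm (t / 2)%:C = t / 2 by rewrite nm_real ger0_norm; lra.
by exists (t / 2)%:C; rewrite -?nm_gt0 h; lra.
Qed.

(** The limit is the lower limit at 0, taken as the supremum of the numbers that bound [phi] from
    below on some punctured disc. *)
Lemma real_cauchy0 (phi : C -> R) :
  (forall e : R, 0 < e -> exists2 t : R, 0 < t & forall h k, h != 0 -> k != 0 ->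
     nm h < t -> nm k < t -> `|phi h - phi k| <= e) ->
  exists l, forall e : R, 0 < e -> exists2 t : R, 0 < t & forall h, h != 0 ->
     nm h < t -> `|phi h - l| <= e.
Proof.
move=> H.
pose A : set R := [set y | exists2 t : R, 0 < t &
  forall h, h != 0 -> nm h < t -> y <= phi h]%classic.
have ub e t k : (forall h k, h != 0 -> k != 0 ->
     nm h < t -> nm k < t -> `|phi h - phi k| <= e) ->
   0 < t -> k != 0 -> nm k < t -> ubound A (phi k + e).
  move=> Ht ht hk1 hk2 y [s hs Hs].
  have [|h h0] := @exists_small (Num.min s t); first by rewrite lt_min hs ht.
  rewrite lt_min => /andP[/(Hs _ h0) h1 h2].
  by have := Ht _ _ h0 hk1 h2 hk2; rewrite ler_norml; lra.
exists (sup A) => e he; have [t ht Ht] := H e he; exists t => // h h0 hh.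
have hA : A (phi h - e).
  by exists t => // k k0 hk; have := Ht _ _ h0 k0 hh hk; rewrite ler_norml; lra.
have h1 : phi h - e <= sup A.
  by apply: ub_le_sup => //; exists (phi h + e); exact: ub Ht ht h0 hh.
have h2 : sup A <= phi h + e by apply: ge_sup; [exists (phi h - e)|exact: ub Ht ht h0 hh].
by rewrite ler_norml; lra.
Qed.

Lemma complex_cauchy0 (phi : C -> C) :
  (forall e : R, 0 < e -> exists2 t : R, 0 < t & forall h k, h != 0 -> k != 0 ->
     nm h < t -> nm k < t -> nm (phi h - phi k) <= e) ->
  exists l, forall e : R, 0 < e -> exists2 t : R, 0 < t & forall h, h != 0 ->
     nm h < t -> nm (phi h - l) <= e.
Proof.
move=> H.
have [x Hx] : exists l, forall e : R, 0 < e -> exists2 t : R, 0 < t &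
    forall h, h != 0 -> nm h < t -> `|Re (phi h) - l| <= e.
  apply: real_cauchy0 => e /H[t ht Ht]; exists t => // h k h1 h2 h3 h4.
  by rewrite -ReN -ReD; apply: le_trans (nm_Re _) (Ht _ _ _ _ _ _).
have [y Hy] : exists l, forall e : R, 0 < e -> exists2 t : R, 0 < t &
    forall h, h != 0 -> nm h < t -> `|Im (phi h) - l| <= e.
  apply: real_cauchy0 => e /H[t ht Ht]; exists t => // h k h1 h2 h3 h4.
  by rewrite -ImN -ImD; apply: le_trans (nm_Im _) (Ht _ _ _ _ _ _).
exists (x +i* y) => e he.
have [|t ht Ht] := Hx (e / 2); first lra.
have [|s hs Hs] := Hy (e / 2); first lra.
exists (Num.min t s) => [|h h0]; first by rewrite lt_min ht hs.
rewrite lt_min => /andP[/(Ht _ h0) h1 /(Hs _ h0) h2].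
apply: le_trans (nm_le _) _; rewrite ReD ImD ReN ImN /=; lra.
Qed.

(* By the Cauchy estimate for the difference of the slope functions of [f] at
   two points [h] and [k], the slopes at [0] form a Cauchy filter. *)
Lemma removable f r (M : R) : 0 < r ->
    (forall z, csq r z -> z != 0 -> cdiff f z) -> ccont f 0 ->
    (forall z, cbd r z -> nm (f z) <= M) -> cdiff f 0.
Proof.
move=> hr hf hc hM.
have hM0 : 0 <= M.
  apply: le_trans (nm_ge0 _) (hM (corner r) _).
  by apply: Or41; exists 0; [lra|rewrite mul0r addr0].
have key e : 0 < e -> exists2 t : R, 0 < t & forall h k, h != 0 -> k != 0 ->
     nm h < t -> nm k < t -> nm ((f h - f 0) / h - (f k - f 0) / k) <= e.
  move=> he.
  set B := nm (f 0) + 1.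
  have hB : 1 <= B by rewrite lerDr nm_ge0.
  (* On the boundary (z - h)(z - k) has modulus at least r^2/4, so a numerator below [e1] makes the
     two slopes differ by at most e/20. The Cauchy estimate multiplies this by 18, and moving from 0
     to a nearby point costs another e/20. *)
  pose e1 := e / 20 * (r ^+ 2 / 4).
  have he1 : 0 < e1 by rewrite mulr_gt0 ?divr_gt0 ?exprn_gt0.
  pose eps := e1 / (8 * r).
  have heps : 0 < eps by rewrite divr_gt0 // mulr_gt0.
  have [|t0 ht0 H0] := hc (Num.min 1 eps); first by rewrite lt_min ltr01 heps.
  pose de := e1 / (4 * (M + B)).
  have hMB : 0 < M + B by lra.
  have hde : 0 < de by rewrite divr_gt0 // mulr_gt0.
  exists (Num.min t0 (Num.min (r / 2) de)) => [|h k h0 k0].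
    by rewrite !lt_min ht0 hde /= andbT; lra.
  rewrite !lt_min => /and3P[h1 h2 h3] /and3P[k1 k2 k3].
  have := H0 h h1; rewrite add0r le_min => /andP[h4 h5].
  have := H0 k k1; rewrite add0r le_min => /andP[k4 k5].
  have hh : csq r h by apply: csq_nm; lra.
  have hk : csq r k by apply: csq_nm; lra.
  have [dh hdh] := (cdiffP f h).1 (hf h hh h0).
  have [dk hdk] := (cdiffP f k).1 (hf k hk k0).
  pose D w := slope f dh h w - slope f dk k w.
  have hD0 : D 0 = (f h - f 0) / h - (f k - f 0) / k.
    rewrite /D /slope !(eq_sym 0) (negbTE h0) (negbTE k0) !sub0r.
    by field; rewrite h0 k0.
  have hDc z : csq r z -> ccont D z.
    move=> hz.
    have hfz : ccont f z.
      by case: (eqVneq z 0) => [->//|z0]; apply: cdiff_ccont; exact: hf.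
    apply: ccontB.
      by case: (eqVneq z h) => [->//|zh]; exact: ccont_slope.
    by case: (eqVneq z k) => [->//|zk]; exact: ccont_slope.
  have hDd z : csq r z -> z != 0 -> z != h -> z != k -> cdiff D z.
    by move=> hz z0 zh zk; apply: cdiffB; apply: cdiff_slope => //; exact: hf.
  have hDM z : cbd r z -> nm (D z) <= e / 20.
    move=> hz; have /andP[hz1 hz2] := cbd_nm (ltW hr) hz.
    have zh := cbd_dist (ltW hr) (ltW h2) hz.
    have zk := cbd_dist (ltW hr) (ltW k2) hz.
    have zh0 : z - h != 0 by rewrite -nm_gt0; lra.
    have zk0 : z - k != 0 by rewrite -nm_gt0; lra.
    (* Every term of the numerator is small with [h], [k] or with f(h) - f(k); the first two are
       controlled by [de], the last by [eps]. *)
    have -> : D z = (f z * (h - k) - z * (f h - f k) + k * f h - h * f k)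
        / ((z - h) * (z - k)).
      rewrite /D /slope -(subr_eq0 z h) -(subr_eq0 z k) (negbTE zh0) (negbTE zk0).
      by field; rewrite zh0 zk0.
    have hden : r ^+ 2 / 4 <= nm ((z - h) * (z - k)) by rewrite nmM; nra.
    rewrite nmM nmV ler_pdivrMr; last by apply: lt_le_trans hden; rewrite divr_gt0 // exprn_gt0.
    apply: (@le_trans _ _ e1); last by rewrite /e1 ler_pM2l //; lra.
    apply: le_trans (nmB _ _) _; apply: (@le_trans _ _ (e1 * (1/4 + 1/4) + e1 / 4 + e1 / 4)); last lra.
    have dM : de * M <= e1 / 4.
      by rewrite /de mulrAC ler_pdivrMr ?mulr_gt0 //; nra.
    have dB : de * (M + B) = e1 / 4 by rewrite /de; field; rewrite gt_eqF.
    have dr : 2 * r * (2 * eps) = e1 / 2 by rewrite /eps; field; rewrite gt_eqF.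
    have fB : nm (f h) <= B.
      by have := nmD (f h - f 0) (f 0); rewrite subrK /B; lra.
    have fB' : nm (f k) <= B.
      by have := nmD (f k - f 0) (f 0); rewrite subrK /B; lra.
    have t1 : nm (f z * (h - k)) <= M * (2 * de).
      rewrite nmM; apply: ler_pM; rewrite ?nm_ge0 ?hM //.
      by apply: le_trans (nmB _ _) _; lra.
    have t2 : nm (z * (f h - f k)) <= 2 * r * (2 * eps).
      rewrite nmM; apply: ler_pM; rewrite ?nm_ge0 //.
      rewrite (_ : f h - f k = (f h - f 0) - (f k - f 0)); last by ring.
      by apply: le_trans (nmB _ _) _; lra.
    have t3 : nm (k * f h) <= de * B.
      by rewrite nmM; apply: ler_pM; rewrite ?nm_ge0 // ltW.
    have t4 : nm (h * f k) <= de * B.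
      by rewrite nmM; apply: ler_pM; rewrite ?nm_ge0 // ltW.
    have := nmD (f z * (h - k) - z * (f h - f k)) (k * f h).
    have := nmB (f z * (h - k)) (z * (f h - f k)).
    by lra.
  rewrite -hD0.
  have c0 : csq r 0 by apply: csq_nm; rewrite nm0 ltW.
  have e20 : 0 < e / 20 by lra.
  have [t ht Ht] := hDc 0 c0 _ e20.
  (* At 0 only continuity of [D] is known, while the estimate needs a point of differentiability; it
     is applied at [a], close to 0 and distinct from 0, [h] and [k]. *)
  have [|a a0] := @exists_small (Num.min (r / 2) (Num.min t (Num.min (nm h) (nm k)))).
    by rewrite !lt_min !nm_gt0 h0 k0 ht !andbT; lra.
  rewrite !lt_min => /and4P[ar at_ ah ak].
  have aD : cdiff D a.
    apply: hDd => //; first by apply: csq_nm; lra.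
      by apply: contraTneq ah => ->; rewrite ltxx.
    by apply: contraTneq ak => ->; rewrite ltxx.
  have : nm (D a) <= 18 * (e / 20).
    apply: (@cauchy_estimate R D [:: 0; h; k] r) => //; first exact: ltW.
    move=> z hz; case: (boolP (z \in [:: 0; h; k])) => hin.
      by right; split => //; exact: hDc.
    by move: hin; rewrite !inE !negb_or => /and3P[? ? ?]; left; exact: hDd.
  have := Ht a at_; rewrite add0r nmC.
  by have := nmD (D 0 - D a) (D a); rewrite subrK; lra.
have [l hl] := complex_cauchy0 key.
exists l => e /hl[t ht Ht]; exists t => // w hw; rewrite add0r.
case: (eqVneq w 0) => [->|w0]; first by rewrite subrr mulr0 subr0 nm0 mulr0.
have := Ht w w0 hw.
by rewrite -(ler_pM2r (_ : 0 < nm w)) ?nm_gt0 // -nmM mulrBl divfK.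
Qed.

Definition has_slope0 f d := ccont (slope f d 0) 0.

(* The default value of [xget] is irrelevant when [f] is differentiable at 0. *)
Definition diffquot f : C -> C := slope f (xget 0 (has_slope0 f : set C)%classic) 0.

Definition hol_sq r f := forall z, csq r z -> cdiff f z.

Lemma diffquotK f z : f z = f 0 + z * diffquot f z.
Proof. by rewrite (slopeK f (xget 0 (has_slope0 f)) 0 z) subr0 mulrC. Qed.

(** On the boundary |z| >= r, and |f(z) - f(0)| <= M + 18 M by the Cauchy estimate at 0. *)
Lemma diffquot_bound r f (M : R) : 0 < r -> hol_sq r f ->
  (forall z, cbd r z -> nm (f z) <= M) ->
  forall z, cbd r z -> nm (diffquot f z) <= 19 / r * M.
Proof.
move=> hr hf hM z hz; have /andP[h1 _] := cbd_nm (ltW hr) hz.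
have z0 : z != 0 by rewrite -nm_gt0; lra.
have h0 : nm (f 0) <= 18 * M.
  apply: (@cauchy_estimate R f [::] r) => //; first by rewrite nm0; lra.
    by apply: hf; apply: csq_nm; rewrite nm0 ltW.
  by move=> w hw; left; exact: hf.
rewrite /diffquot /slope (negbTE z0) subr0 nmM nmV.
rewrite ler_pdivrMr; last lra.
apply: le_trans (nmB _ _) _.
have hMz := hM z hz.
have M0 : 0 <= M by apply: le_trans (nm_ge0 _) hMz.
apply: (@le_trans _ _ (19 / r * M * r)).
  by rewrite mulrAC divfK ?gt_eqF //; lra.
by rewrite ler_wpM2l // mulr_ge0 // divr_ge0 // ltW.
Qed.

(** The singularity of the quotient at 0 is removable. The square does not shrink, so the operation
    can be iterated without loss of radius. *)
Lemma diffquot_hol r f (M : R) : 0 < r -> hol_sq r f ->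
  (forall z, cbd r z -> nm (f z) <= M) -> hol_sq r (diffquot f).
Proof.
move=> hr hf hM.
have hz z : csq r z -> z != 0 -> cdiff (diffquot f) z.
  by move=> hz z0; apply: cdiff_slope => //; exact: hf.
move=> z hzr; case: (eqVneq z 0) => [->|]; last exact: hz.
apply: (removable hr hz); last exact: diffquot_bound hr hf hM.
rewrite /diffquot; case: xgetP => [d -> //|h].
have : cdiff f 0 by apply: hf; apply: csq_nm; rewrite nm0 ltW.
by case/cdiffP => d /h.
Qed.

(** The coefficients are the values at 0 of the iterated difference quotients. The remainder of
    order m is exactly w^m times the m-th iterate, whose boundary bound grows by the factor 19/r at
    each iteration. *)
Lemma taylor0 r f (M : R) : 0 < r -> hol_sq r f ->
    (forall z, cbd r z -> nm (f z) <= M) ->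
  exists c : nat -> C, forall m w, nm w <= r / 2 ->
    nm (f w - \sum_(j < m) c j * w ^+ j) <= 18 * M * (19 / r * nm w) ^+ m.
Proof.
move=> hr hf hM.
pose F k := iter k diffquot f.
have HF k : hol_sq r (F k) /\
    forall z, cbd r z -> nm (F k z) <= (19 / r) ^+ k * M.
  elim: k => [|k [IH1 IH2]]; first by split => // z; rewrite expr0 mul1r; exact: hM.
  split=> [|z hz]; first exact: diffquot_hol hr IH1 IH2.
  by rewrite exprS -mulrA; exact: diffquot_bound hr IH1 IH2 z hz.
exists (fun k => F k 0) => m w hw.
have -> : f w - \sum_(j < m) F j 0 * w ^+ j = w ^+ m * F m w.
  elim: m => [|m IH]; first by rewrite big_ord0 subr0 expr0 mul1r.
  rewrite big_ord_recr /= opprD addrA IH.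
  by rewrite {1}(diffquotK (F m) w) -/(F m.+1) exprSr /=; ring.
have [H1 H2] := HF m.
have : nm (F m w) <= 18 * ((19 / r) ^+ m * M).
  apply: (@cauchy_estimate R (F m) [::] r) => //.
    by apply: H1; apply: csq_nm; lra.
  by move=> z hz; left; exact: H1.
move=> h; rewrite nmM nmX exprMn.
have -> : 18 * M * ((19 / r) ^+ m * nm w ^+ m) = nm w ^+ m * (18 * ((19 / r) ^+ m * M)) by ring.
by rewrite ler_wpM2l // exprn_ge0 ?nm_ge0.
Qed.

End Taylor.

(** * Germs of holomorphic functions of one variable *)

Section Germs.
Local Open Scope complex_scope.
Variable R : realType.
Local Notation C := (Cplx R).
Local Notation nm := (@Normc.normc R).
Implicit Types (F G : C -> C) (z w : C).

Lemma nm_lt (z : C) (t : R) : (`|z| < (t%:C : C)) = (nm z < t).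
Proof. by rewrite -ltcR. Qed.

Lemma near_nmP z (P : C -> Prop) : (\forall w \near z, P w) <->
  exists2 t : R, 0 < t & forall w, nm (w - z) < t -> P w.
Proof.
split=> [/nbhs_ballP[e /= he H]|[t ht H]].
  (* Radii of balls are elements of the complex field; a positive one is real. *)
  have e1 : e = (complex.Re e)%:C.
    by move: he; case: (e) => a b; rewrite ltcE /= => /andP[/eqP -> _].
  exists (complex.Re e) => [|w hw].
    by move: he; rewrite ltcE /= => /andP[].
  by apply: H; rewrite -ball_normE /= e1 distrC nm_lt.
apply/nbhs_ballP; exists (t%:C : C) => [|w]; first by rewrite /= ltcR.
by rewrite -ball_normE /= distrC nm_lt => /H.
Qed.

Lemma line_near n (x v : 'rV[C]_n) (P : 'rV[C]_n -> Prop) :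
  (\forall y \near x, P y) ->
  exists2 t : R, 0 < t & forall s : C, nm s < t -> P (s *: v + x).
Proof.
move=> hP.
have hc : {for (0 : C), continuous (fun s : C => s *: v + x)}.
  by apply: continuousD; [exact: scalel_continuous|exact: cst_continuous].
have e0 : 0 *: v + x = x by rewrite scale0r add0r.
have {}hP : nbhs (0 *: v + x) P by rewrite e0.
have /near_nmP[t ht H] := hc _ hP.
by exists t => // s hs; apply: H; rewrite subr0.
Qed.

Lemma derivable_slope n (u : 'rV[C]_n -> C) (x v : 'rV[C]_n) :
  derivable u x v -> ccont (slope (fun s : C => u (s *: v + x)) ('D_v u x) 0) 0.
Proof.
move=> hd e he.
have /cvgrPdist_lt H : (fun h : C => h^-1 *: ((u \o shift x) (h *: v) - u x)) @ 0^' --> 'D_v u x := hd.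
have he' : 0 < (e%:C : C) by rewrite ltcR.
have /near_nmP[t ht {}H] := H _ he'.
exists t => // w hw; rewrite add0r /slope eqxx.
case: eqVneq => [_|w0]; first by rewrite subrr nm0 ltW.
have hw' : nm (w - 0) < t by rewrite subr0.
have := H w hw' w0.
rewrite /= nm_lt nmC subr0 scale0r add0r /GRing.scale /= mulrC => h.
exact: ltW.
Qed.

Lemma differentiable_cdiff F z : differentiable F z -> cdiff F z.
Proof.
move=> hF; have hd : derivable F z 1 by exact: diff_derivable.
have /cvgrPdist_lt H : (fun h : C => h^-1 *: ((F \o shift z) (h *: 1) - F z)) @ 0^' --> 'D_1 F z := hd.
apply/cdiffP; exists ('D_1 F z) => e he.
have he' : 0 < (e%:C : C) by rewrite ltcR.
have /near_nmP[t ht {}H] := H _ he'.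
exists t => // w hw; rewrite /slope eqxx.
have e1 : z + w - z = w by ring.
rewrite -subr_eq0 e1.
case: eqVneq => [_|w0]; first by rewrite subrr nm0 ltW.
have hw' : nm (w - 0) < t by rewrite subr0.
have := H w hw' w0.
rewrite /= nm_lt nmC /GRing.scale /= mulr1 (addrC w) mulrC => h.
exact: ltW.
Qed.

(** The constants are the same for all orders [m], so that the vanishing of all coefficients implies
    local vanishing, not merely flatness. *)
Definition taylor_at F z (c : nat -> C) := exists r K M : R,
  [/\ 0 < r, 0 <= K, 0 <= M & forall m w, nm w <= r ->
     nm (F (z + w) - \sum_(j < m) c j * w ^+ j) <= M * (K * nm w) ^+ m].

Definition hol_germ F z := \forall w \near z, differentiable F w.

Lemma taylor_exists F z : hol_germ F z -> exists c, taylor_at F z c.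
Proof.
move=> /near_nmP[t ht H].
pose f w := F (z + w).
have hd w : nm w < t -> cdiff f w.
  move=> hw; have : cdiff F (z + w).
    by apply/differentiable_cdiff/H; rewrite addrC addKr.
  case=> d hd; exists d => e /hd[s hs Hs]; exists s => // v /Hs.
  by rewrite /f addrA.
have [|s hs Hs] := cdiff_ccont (hd 0 _) ltr01; first by rewrite nm0.
pose r := Num.min (s / 3) (t / 3).
have hr : 0 < r by rewrite lt_min !divr_gt0.
have rs : r <= s / 3 by rewrite /r ge_min lexx.
have rt : r <= t / 3 by rewrite /r ge_min lexx orbT.
have hol : hol_sq r f.
  move=> w; rewrite csqE => /andP[h1 h2]; apply: hd.
  by have := nm_le w; lra.
have bd w : cbd r w -> nm (f w) <= nm (f 0) + 1.
  move=> /(cbd_nm (ltW hr)) /andP[_ hw].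
  have : nm w < s by lra.
  move=> /Hs; rewrite add0r.
  by have := nmD (f w - f 0) (f 0); rewrite subrK; lra.
have [c hc] := taylor0 hr hol bd.
exists c, (r / 2), (19 / r), (18 * (nm (f 0) + 1)); split => //.
- by lra.
- by rewrite divr_ge0 // ltW.
- by have := nm_ge0 (f 0); lra.
Qed.

Lemma taylor0E F z c : taylor_at F z c -> F z = c 0%N.
Proof.
move=> [r [K [M [hr _ _ H]]]]; have := H 1%N 0.
rewrite nm0 mulr0 expr1 mulr0 big_ord1 expr0 mulr1 addr0 => /(_ (ltW hr)) h.
apply/eqP; rewrite -subr_eq0 -nm_eq0.
by rewrite eq_le h nm_ge0.
Qed.

Lemma taylor_lead F z c m : taylor_at F z c -> (0 < m)%N ->
    (forall j, (0 < j < m)%N -> c j = 0) ->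
  exists r M : R, [/\ 0 < r, 0 <= M & forall w, nm w <= r ->
    nm (F (z + w) - F z - c m * w ^+ m) <= M * nm w ^+ m.+1].
Proof.
move=> hc hm hj; have e0 := taylor0E hc.
case: hc => r [K [M [hr hK hM H]]].
exists r, (M * K ^+ m.+1); split=> // [|w hw].
  by rewrite mulr_ge0 // exprn_ge0.
have := H m.+1 w hw; rewrite exprMn mulrA.
case: m hm hj => // m _ hj.
rewrite big_ord_recl big_ord_recr /= expr0 mulr1 big1 ?add0r => [|i _].
  by rewrite e0 opprD addrA.
by rewrite hj ?mul0r //= /bump /= add1n ltnS ltn_ord.
Qed.

Lemma taylor_linear F G z c c' (a : C) : taylor_at F z c -> taylor_at G z c' ->
  taylor_at (fun w => a * F w + G w) z (fun j => a * c j + c' j).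
Proof.
move=> [r [K [M [hr hK hM H]]]] [r' [K' [M' [hr' hK' hM' H']]]].
exists (Num.min r r'), (K + K'), (nm a * M + M').
have ha := nm_ge0 a; split.
- by rewrite lt_min hr.
- lra.
- by rewrite addr_ge0 // mulr_ge0.
move=> m w; rewrite le_min => /andP[/(H m) {}H /(H' m) {}H'].
have -> : a * F (z + w) + G (z + w) - \sum_(j < m) (a * c j + c' j) * w ^+ j =
    a * (F (z + w) - \sum_(j < m) c j * w ^+ j) +
    (G (z + w) - \sum_(j < m) c' j * w ^+ j).
  have -> : \sum_(j < m) (a * c j + c' j) * w ^+ j =
      a * (\sum_(j < m) c j * w ^+ j) + \sum_(j < m) c' j * w ^+ j.
    rewrite mulr_sumr -big_split /=; apply: eq_bigr => j _; ring.
  by ring.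
apply: le_trans (nmD _ _) _; rewrite nmM mulrDl.
have hw := nm_ge0 w.
apply: lerD.
  rewrite -mulrA ler_wpM2l //; apply: le_trans H _.
  rewrite ler_wpM2l // lerXn2r ?nnegrE ?mulr_ge0 ?addr_ge0 //.
  by rewrite ler_wpM2r // lerDl.
apply: le_trans H' _.
rewrite ler_wpM2l // lerXn2r ?nnegrE ?mulr_ge0 ?addr_ge0 //.
by rewrite ler_wpM2r // lerDr.
Qed.

Lemma taylor_zero z c : taylor_at (fun=> 0) z c -> forall j, c j = 0.
Proof.
move=> [r [K [M [hr hK hM H]]]].
elim/ltn_ind => m IH.
have hm w : nm w <= r -> nm (c m) * nm w ^+ m <= M * K ^+ m.+1 * nm w ^+ m.+1.
  move=> hw; have := H m.+1 w hw; rewrite exprMn mulrA.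
  rewrite big_ord_recr /= big1 ?add0r ?sub0r ?nmN ?nmM ?nmX //.
  by move=> i _; rewrite IH ?mul0r.
apply/eqP; rewrite -nm_eq0 eq_le nm_ge0 andbT.
apply/ler_addgt0Pr => e he; rewrite add0r.
set B := M * K ^+ m.+1 in hm.
have hB : 0 <= B by rewrite mulr_ge0 // exprn_ge0.
have [|w w0] := @exists_small R (Num.min r (e / (B + 1))).
  by rewrite lt_min hr divr_gt0 //; lra.
rewrite lt_min => /andP[/ltW /hm h1]; rewrite ltr_pdivlMr; last lra.
move=> h2; have wp : 0 < nm w by rewrite nm_gt0.
move: h1; rewrite exprSr mulrA [B * _ * _]mulrAC ler_pM2r ?exprn_gt0 //.
by lra.
Qed.

Lemma taylor_uniq F z c c' : taylor_at F z c -> taylor_at F z c' -> c =1 c'.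
Proof.
move=> h h' j.
have : taylor_at (fun=> 0) z (fun j => (-1) * c j + c' j).
  have := taylor_linear (-1) h h'.
  by have -> : (fun w => -1 * F w + F w) = (fun=> 0) by apply/funext => w; ring.
move=> /taylor_zero /(_ j) /eqP; rewrite mulN1r addrC subr_eq0 => /eqP ->//.
Qed.

Lemma taylor_near F G z c : (\forall w \near z, F w = G w) -> taylor_at F z c ->
  taylor_at G z c.
Proof.
move=> /near_nmP[t ht H] [r [K [M [hr hK hM Hr]]]].
exists (Num.min r (t / 2)), K, M; split => //; first by rewrite lt_min hr; lra.
move=> m w; rewrite le_min => /andP[hw1 hw2]; rewrite -H ?Hr //.
by rewrite addrC addKr; lra.
Qed.

Lemma taylor_cst (a : C) z : taylor_at (fun=> a) z (fun j => if j == 0%N then a else 0).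
Proof.
exists 1, 1, (nm a); split => //; first exact: nm_ge0.
case=> [|m] w hw; first by rewrite big_ord0 subr0 expr0 mulr1.
rewrite big_ord_recl /= big1 => [|i _]; last by rewrite mul0r.
rewrite addr0 mulr1 subrr nm0 mulr_ge0 ?nm_ge0 // exprn_ge0 // mulr_ge0 //.
exact: nm_ge0.
Qed.

(** Where K |w| < 1/2 the remainders M (K |w|)^m tend to 0 with m, so a function with no coefficient
    of positive degree is locally constant. *)
Lemma taylor_const_germ F z c : taylor_at F z c ->
  const_germ F z <-> forall j, (0 < j)%N -> c j = 0.
Proof.
move=> hc; split=> [[a ha] [//|j] _|h].
  have := taylor_near ha hc.
  by move=> /taylor_uniq /(_ (taylor_cst a z)) ->.
have e0 := taylor0E hc; case: hc => r [K [M [hr hK hM H]]].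
exists (c 0%N); apply/near_nmP.
have hK1 : 0 < K + 1 by lra.
exists (Num.min r (1 / (2 * (K + 1)))) => [|w].
  by rewrite lt_min hr divr_gt0 // mulr_gt0.
rewrite lt_min => /andP[h1]; rewrite ltr_pdivlMr ?mulr_gt0 // => h2.
have hm m : nm (F w - c 0%N) <= M / 2 ^+ m.+1.
  have := H m.+1 (w - z) (ltW h1).
  rewrite big_ord_recl big1 => [|i _]; last by rewrite h ?mul0r.
  rewrite expr0 mulr1 addr0 (addrC z) subrK => /le_trans; apply.
  rewrite ler_wpM2l // -exprVn lerXn2r ?nnegrE ?mulr_ge0 ?nm_ge0 //.
  by have := nm_ge0 (w - z); nra.
apply/eqP; rewrite -subr_eq0 -nm_eq0 eq_le nm_ge0 andbT.
apply/ler_addgt0Pr => e he; rewrite add0r.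
have [k hk] := exists_half_pow M he.
apply: le_trans (hm k) _; apply: le_trans _ (ltW hk).
by rewrite ler_wpM2l // lef_pV2 ?posrE ?exprn_gt0 // ler_eXn2l ?ltr1n.
Qed.

(** For a holomorphic germ this is the unique expansion, by [taylor_exists] and [taylor_uniq]; the
    default 0 occurs only when there is none. *)
Definition tcoef F z : nat -> C := xget (fun=> 0) (taylor_at F z).

Lemma tcoefP F z : hol_germ F z -> taylor_at F z (tcoef F z).
Proof. by move=> /taylor_exists[c hc]; rewrite /tcoef; apply: xgetPex; exists c. Qed.

Lemma hol_germ_linear F G z (a : C) : hol_germ F z -> hol_germ G z ->
  hol_germ (fun w => a * F w + G w) z.
Proof.
move=> hF hG; rewrite /hol_germ; near=> w; apply: differentiableD; last by near: w.
by apply: differentiableZ; near: w.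
Unshelve. all: by end_near. Qed.

Lemma tcoef_linear F G z (a : C) j : hol_germ F z -> hol_germ G z ->
  tcoef (fun w => a * F w + G w) z j = a * tcoef F z j + tcoef G z j.
Proof.
move=> hF hG.
have h := taylor_linear a (tcoefP hF) (tcoefP hG).
exact: (taylor_uniq (tcoefP (hol_germ_linear a hF hG)) h).
Qed.

Lemma tcoef_const_germ F z : hol_germ F z ->
  const_germ F z <-> forall j, (0 < j)%N -> tcoef F z j = 0.
Proof. by move=> /tcoefP /taylor_const_germ. Qed.

End Germs.

(** * Leading terms of abelian relations *)

Section ContinuityAlgebra.
Local Open Scope complex_scope.
Variable R : realType.
Local Notation C := (R[i]).
Local Notation nm := (@Normc.normc R).
Implicit Types (f g : C -> C) (z : C).

Lemma ccont_cst (a : C) z : ccont (fun=> a) z.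
Proof. by move=> e he; exists 1 => // w _; rewrite subrr nm0 ltW. Qed.

Lemma ccontD f g z : ccont f z -> ccont g z -> ccont (fun w => f w + g w) z.
Proof.
move=> hf hg; have := ccontB hf (ccontB (ccont_cst 0 z) hg).
by apply: (ccont_near ltr01) => w _; ring.
Qed.

Lemma ccontM f g z : ccont f z -> ccont g z -> ccont (fun w => f w * g w) z.
Proof.
move=> hf hg e he; have hA := nm_ge0 (f z); have hB := nm_ge0 (g z).
set D := nm (f z) + nm (g z) + 1; have hD : 1 <= D by rewrite /D; lra.
pose d := Num.min 1 (e / (2 * D)).
have hd : 0 < d by rewrite lt_min ltr01 divr_gt0 // mulr_gt0 //; lra.
have d1 : d <= 1 by rewrite /d ge_min lexx.
have d2 : d * (2 * D) <= e.
  by rewrite -ler_pdivlMr ?mulr_gt0 //; [rewrite /d ge_min lexx orbT|lra].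
have [t ht Ht] := hf d hd; have [s hs Hs] := hg d hd.
exists (Num.min t s) => [|w]; first by rewrite lt_min ht hs.
rewrite lt_min => /andP[/Ht h1 /Hs h2].
rewrite (_ : _ - _ = (f (z + w) - f z) * (g (z + w) - g z) +
  (f (z + w) - f z) * g z + f z * (g (z + w) - g z)); last by ring.
apply: le_trans (nmD _ _) _; apply: le_trans (lerD (nmD _ _) (lexx _)) _.
rewrite !nmM; have := nm_ge0 (f (z + w) - f z); have := nm_ge0 (g (z + w) - g z).
set p := nm (f _ - _) in h1 *; set q := nm (g _ - _) in h2 * => hq hp.
have : p * q <= d * 1 by apply: ler_pM => //; apply: le_trans d1.
have : p * nm (g z) <= d * nm (g z) by rewrite ler_wpM2r.
have : nm (f z) * q <= d * nm (f z) by rewrite mulrC ler_wpM2r.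
move: d2; rewrite /D; lra.
Qed.

Lemma ccontX f z m : ccont f z -> ccont (fun w => f w ^+ m) z.
Proof.
move=> hf; elim: m => [|m IH]; first exact: ccont_cst.
have := ccontM hf IH; apply: (ccont_near ltr01) => w _; by rewrite exprS.
Qed.

Lemma ccont_sum (I : Type) (r : seq I) (f : I -> C -> C) z :
  (forall i, ccont (f i) z) -> ccont (fun w => \sum_(i <- r) f i w) z.
Proof.
move=> hf; elim: r => [|i r IH].
  by have := ccont_cst 0 z; apply: (ccont_near ltr01) => w _; rewrite big_nil.
have := ccontD (hf i) IH; apply: (ccont_near ltr01) => w _; by rewrite big_cons.
Qed.

Lemma ccont0_eq0 f (t E : R) : ccont f 0 -> 0 < t -> 0 <= E ->
  (forall s, s != 0 -> nm s < t -> nm (f s) <= E * nm s) -> f 0 = 0.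
Proof.
move=> hf ht hE H; apply/eqP; rewrite -nm_eq0 eq_le nm_ge0 andbT.
apply/ler_addgt0Pr => e he; rewrite add0r.
have [|s hs Hs] := hf (e / 2); first lra.
have [|w w0] := @exists_small R (Num.min t (Num.min s (e / (2 * (E + 1))))).
  by rewrite !lt_min ht hs divr_gt0 // mulr_gt0 //; lra.
rewrite !lt_min => /and3P[h1 h2]; rewrite ltr_pdivlMr; last by rewrite mulr_gt0 //; lra.
move=> h3; have := Hs w h2; rewrite add0r nmC => h4.
have := nmD (f 0 - f w) (f w); rewrite subrK.
have := H w w0 h1; have := nm_ge0 w.
by nra.
Qed.

Lemma finite_small (I : finType) (P : I -> C -> Prop) :
  (forall i, exists2 t : R, 0 < t & forall s, nm s < t -> P i s) ->
  exists2 t : R, 0 < t & forall s, nm s < t -> forall i, P i s.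
Proof.
move=> H.
suff [t ht Ht] : exists2 t : R, 0 < t &
    forall s, nm s < t -> forall i, i \in enum I -> P i s.
  by exists t => // s hs i; apply: Ht; rewrite ?mem_enum.
elim: (enum I) => [|i r [t ht Ht]]; first by exists 1.
have [t' ht' Ht'] := H i.
exists (Num.min t t') => [|s]; first by rewrite lt_min ht.
rewrite lt_min => /andP[h1 h2] j; rewrite inE => /predU1P[->|]; first exact: Ht'.
exact: Ht.
Qed.

End ContinuityAlgebra.

Section LeadingTerm.
Local Open Scope complex_scope.
Variable R : realType.
Local Notation C := (Cplx R).
Local Notation nm := (@Normc.normc R).
Variables (n : nat) (I : finType) (u : I -> 'rV[C]_n -> C) (x : 'rV[C]_n).

(** On the line through [x] in direction [v], f equals f(x) + s psi(s) with psi continuous at 0 and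
    bounded near it; substituting this into the one-variable expansion of [F] gives the error
    term. *)
Lemma leading_term_bound (F : C -> C) (f : 'rV[C]_n -> C) (v : 'rV[C]_n) m :
    differentiable f x -> hol_germ F (f x) -> (0 < m)%N ->
    (forall j, (0 < j < m)%N -> tcoef F (f x) j = 0) ->
  exists2 E : R, 0 <= E & exists2 t : R, 0 < t & forall s : C, nm s < t ->
    nm (F (f (s *: v + x)) - F (f x)
        - tcoef F (f x) m * (s * slope (fun s : C => f (s *: v + x)) ('D_v f x) 0 s) ^+ m)
      <= E * nm s ^+ m.+1.
Proof.
move=> hf hF hm hj.
have [r [M [hr hM H]]] := taylor_lead (tcoefP hF) hm hj.
have hc : ccont (slope (fun s : C => f (s *: v + x)) ('D_v f x) 0) 0.
  by apply: derivable_slope; exact: diff_derivable.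
set psi := slope _ _ _ in hc *.
have [t ht Ht] := hc 1 ltr01.
set B := nm (psi 0) + 1; have hB : 1 <= B by rewrite lerDr nm_ge0.
exists (M * B ^+ m.+1); first by rewrite mulr_ge0 // exprn_ge0 //; lra.
exists (Num.min t (r / B)) => [|s]; first by rewrite lt_min ht divr_gt0 //; lra.
rewrite lt_min ltr_pdivlMr; last lra.
move=> /andP[h1 h2].
have hs : nm (psi s) <= B.
  have := Ht s h1; rewrite add0r.
  by have := nmD (psi s - psi 0) (psi 0); rewrite subrK /B; lra.
have e1 : f (s *: v + x) = f x + s * psi s.
  have := slopeK (fun s : C => f (s *: v + x)) ('D_v f x) 0 s.
  by rewrite scale0r add0r subr0 -/psi mulrC.
have hns := nm_ge0 s; have hnp := nm_ge0 (psi s).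
have hw : nm (s * psi s) <= r by rewrite nmM; nra.
rewrite e1; apply: le_trans (H _ hw) _.
rewrite nmM -mulrA ler_wpM2l // -exprMn lerXn2r ?nnegrE ?mulr_ge0 //; last by rewrite mulrC ler_wpM2r.
by lra.
Qed.

(** Along a line the relation cancels everything but the terms of order m up to O(s^(m+1)). Dividing
    by s^m and letting s tend to 0 leaves the claimed sum, since each slope tends to the directional
    derivative. *)
Lemma leading_term (F : I -> C -> C) m :
    (forall i, differentiable (u i) x) -> abelian_rel u x F -> (0 < m)%N ->
    (forall i j, (0 < j < m)%N -> tcoef (F i) (u i x) j = 0) ->
  forall v, \sum_i tcoef (F i) (u i x) m * ('D_v (u i) x) ^+ m = 0.
Proof.
move=> hu [hF [a ha]] hm hj v.
have hb i := leading_term_bound v (hu i) (hF i) hm (hj i).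
pose psi i := slope (fun s : C => u i (s *: v + x)) ('D_v (u i) x) 0.
pose c i := tcoef (F i) (u i x) m.
have {}hb i : exists E : R, 0 <= E /\ exists2 t : R, 0 < t &
    forall s : C, nm s < t -> nm (F i (u i (s *: v + x)) - F i (u i x)
        - c i * (s * psi i s) ^+ m) <= E * nm s ^+ m.+1.
  by have [E h1 h2] := hb i; exists E.
have [E HE] := choice hb.
have [t ht Ht] := finite_small (fun i => (HE i).2).
have [t' ht' Ht'] := line_near v ha.
pose G s := \sum_i c i * psi i s ^+ m.
have hG0 : G 0 = \sum_i c i * 'D_v (u i) x ^+ m.
  by apply: eq_bigr => i _; rewrite /psi /slope eqxx.
rewrite -hG0.
apply: (@ccont0_eq0 R G (Num.min t t') (\sum_i E i)).
- apply: ccont_sum => i; apply: ccontM; first exact: ccont_cst.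
  apply: ccontX; apply: derivable_slope.
  exact: diff_derivable.
- by rewrite lt_min ht ht'.
- by apply: sumr_ge0 => i _; exact: (HE i).1.
move=> s s0; rewrite lt_min => /andP[h1 h2].
have hsp : 0 < nm s by rewrite nm_gt0.
rewrite -(ler_pM2r (exprn_gt0 m hsp)) -mulrA -exprS -nmX -nmM.
have ha0 : \sum_i F i (u i x) = a.
  have := Ht' 0; rewrite nm0 scale0r add0r; exact.
have -> : G s * s ^+ m = - \sum_i (F i (u i (s *: v + x)) - F i (u i x)
        - c i * (s * psi i s) ^+ m).
  rewrite !sumrB (Ht' s h2) ha0 subrr sub0r opprK mulr_suml.
  by apply: eq_bigr => i _; rewrite exprMn; ring.
rewrite nmN mulr_suml.
have : forall (r : seq I) (f : I -> C) (g : I -> R),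
    (forall i, nm (f i) <= g i) -> nm (\sum_(i <- r) f i) <= \sum_(i <- r) g i.
  move=> r f g h; elim: r => [|i r IH]; first by rewrite !big_nil nm0.
  by rewrite !big_cons; apply: le_trans (nmD _ _) _; exact: lerD.
apply=> i; exact: Ht.
Qed.

End LeadingTerm.

(** * From identities between powers to identities between monomials *)

Section Polarization.
Local Open Scope complex_scope.
Variable K : numFieldType.

Lemma poly_eq0_nat (p : {poly K}) : (forall t, p.[t] = 0) -> p = 0.
Proof.
move=> h; apply/eqP; apply: contraT => p0.
have := @max_poly_roots K p [seq i%:R | i <- iota 0 (size p)] p0.
rewrite size_map size_iota ltnn => -> //.
  by apply/allP => z _; rewrite rootE h.
rewrite map_inj_in_uniq ?iota_uniq // => i j _ _ /eqP.
by rewrite eqr_nat => /eqP.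
Qed.

Variables (n : nat) (I : finType) (q : I -> 'rV[K]_n).

(* Take the coefficient of [t] in the relation at [v + t *: delta_mx 0 l]. *)
Lemma polarization m (b : I -> K) :
    (forall v : 'rV[K]_n, \sum_i b i * (\sum_l v 0 l * q i 0 l) ^+ m = 0) ->
  forall s : seq 'I_n, size s = m -> \sum_i b i * \prod_(l <- s) q i 0 l = 0.
Proof.
elim: m b => [|m IH] b H s.
  move=> /size0nil ->; rewrite -[RHS](H 0); apply: eq_bigr => i _.
  by rewrite big_nil expr0.
case: s => [//|l s] [hs].
under eq_bigr do rewrite big_cons mulrA.
apply: IH hs => v.
pose al i := \sum_l v 0 l * q i 0 l.
pose P := \sum_i b i *: ((al i)%:P + q i 0 l *: 'X) ^+ m.+1.
have P0 : P = 0.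
  apply: poly_eq0_nat => t; rewrite horner_sum -[RHS](H (v + t *: delta_mx 0 l)).
  apply: eq_bigr => i _; rewrite hornerZ horner_exp hornerD hornerC hornerZ hornerX.
  congr (_ * _ ^+ _).
  under [RHS]eq_bigr do rewrite !mxE eqxx /= mulrDl.
  rewrite big_split /=; congr (_ + _).
  rewrite (bigD1 l) //= big1 => [|j hj]; last by rewrite (negbTE hj) mulr0 mul0r.
  by rewrite eqxx mulr1 addr0 mulrC.
have : (P^`()).[0] = 0 by rewrite P0 deriv0 horner0.
rewrite /P (raddf_sum (@deriv K)) /= horner_sum.
have dE i : (b i *: ((al i)%:P + q i 0 l *: 'X) ^+ m.+1)^`().[0] =
    (b i * q i 0 l * al i ^+ m) *+ m.+1.
  rewrite derivZ deriv_exp derivD derivC derivZ derivX add0r /=.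
  rewrite hornerZ hornerMn hornerM horner_exp hornerD hornerC !hornerZ hornerX.
  by rewrite mulr0 addr0 hornerC mulr1 mulrnAr mulrA.
rewrite (eq_bigr _ (fun i _ => dE i)).
(* Characteristic zero: the factor m + 1 from the derivative is cancelled. *)
rewrite sumrMnl => /eqP; rewrite mulrn_eq0 /= => /eqP h.
by rewrite -[RHS]h; apply: eq_bigr => i _.
Qed.

End Polarization.

(** * Dimensions of quotients *)

Section QuotDim.
Variables (K : fieldType) (V : lmodType K).
Implicit Types (S T : set V) (m : nat).

(** Subspaces are plain sets because the ambient space, families of total functions, is
    infinite-dimensional; only quotients of its subspaces are finite. *)
Definition subsp S := S 0 /\ forall (a : K) u v, S u -> S v -> S (a *: u + v).

Definition indep_mod S T m (e : 'I_m -> V) :=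
  (forall j, S (e j)) /\
  forall a : 'I_m -> K, T (\sum_j a j *: e j) -> forall j, a j = 0.

Lemma subsp0 S : subsp S -> S 0. Proof. by case. Qed.

Lemma subspZ S a v : subsp S -> S v -> S (a *: v).
Proof. by move=> [h0 h] hv; rewrite -[_ *: _]addr0; exact: h. Qed.

Lemma subspD S u v : subsp S -> S u -> S v -> S (u + v).
Proof. by move=> [h0 h] hu hv; rewrite -[u]scale1r; exact: h. Qed.

Lemma subspB S u v : subsp S -> S u -> S v -> S (u - v).
Proof. by move=> [h0 h] hu hv; rewrite addrC -scaleN1r; exact: h. Qed.

Lemma subsp_sum S (I : Type) (r : seq I) (P : pred I) (f : I -> V) :
  subsp S -> (forall i, P i -> S (f i)) -> S (\sum_(i <- r | P i) f i).
Proof.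
move=> hS hf; apply: (big_ind S) => //; first exact: subsp0.
by move=> u v; exact: subspD.
Qed.

Lemma subspI S T : subsp S -> subsp T -> subsp (S `&` T).
Proof.
move=> [h0 h] [k0 k]; split; first by split.
by move=> a u v [? ?] [? ?]; split; [exact: h|exact: k].
Qed.

Lemma subsp_set0 : subsp [set 0].
Proof. by split=> // a u v -> ->; rewrite scaler0 addr0. Qed.

Lemma quot_dim_indep S T m : quot_dim S T m ->
  exists2 e, indep_mod S T e & forall v, S v -> exists a : 'I_m -> K, T (v - \sum_j a j *: e j).
Proof. by move=> [e [h1 h2 h3]]; exists e. Qed.

(** Steinitz: the coordinates of [e] modulo [T] form a p x m matrix, which for p > m has a nonzero
    left kernel vector, that is, a dependence modulo [T]. *)
Lemma indep_mod_leq S T m p (e : 'I_p -> V) : subsp T -> quot_dim S T m ->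
  indep_mod S T e -> (p <= m)%N.
Proof.
move=> hT [f [hf1 hf2 _]] [he1 he2].
have /choice[M hM] : forall j, exists a : 'I_m -> K, T (e j - \sum_k a k *: f k).
  by move=> j; apply: hf2.
rewrite leqNgt; apply/negP => hlt.
pose A : 'M[K]_(p, m) := \matrix_(j, k) M j k.
have : kermx A != 0.
  rewrite -mxrank_eq0 mxrank_ker subn_eq0 -ltnNge.
  exact: leq_ltn_trans (rank_leq_col A) hlt.
case/rowV0Pn => v hv; case/negP; apply/eqP/rowP => j; rewrite mxE.
apply: (he2 (fun j => v 0 j)).
have hvA : v *m A = 0 by apply/eqP; rewrite -sub_kermx.
have -> : \sum_j v 0 j *: e j = \sum_j v 0 j *: (e j - \sum_k M j k *: f k).
  rewrite -[LHS]subr0 -[X in _ - X = _](_ : \sum_k (v *m A) 0 k *: f k = 0); last first.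
    by rewrite hvA big1 // => k _; rewrite mxE scale0r.
  under [X in _ - X]eq_bigr do rewrite !mxE scaler_suml.
  rewrite exchange_big /= -sumrB; apply: eq_bigr => i _.
  rewrite scalerBr scaler_sumr; congr (_ - _); apply: eq_bigr => k _.
  by rewrite mxE scalerA.
by apply: subsp_sum => // i _; apply: subspZ.
Qed.

Lemma quot_dim_uniq S T m p : subsp T -> quot_dim S T m -> quot_dim S T p -> m = p.
Proof.
move=> hT hm hp; apply/eqP; rewrite eqn_leq.
have [e he _] := quot_dim_indep hm; have [f hf _] := quot_dim_indep hp.
by rewrite (indep_mod_leq hT hp he) (indep_mod_leq hT hm hf).
Qed.

(** An independent family of maximal size generates, since a vector outside its span modulo [T]
    could be appended. *)
Lemma quot_dim_exists S T b : subsp T ->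
  (forall p (e : 'I_p -> V), indep_mod S T e -> (p <= b)%N) ->
  exists m, quot_dim S T m.
Proof.
move=> hT hb.
pose P p := `[< exists e : 'I_p -> V, indep_mod S T e >].
have exP : exists p, P p.
  exists 0%N; apply/asboolP; exists (fun=> 0).
  by split=> [[]|a _ []].
have ubP p : P p -> (p <= b)%N by move=> /asboolP[e /hb].
case: (ex_maxnP exP ubP) => m /asboolP[e [he1 he2]] hmax.
exists m, e; split => // v hv.
apply: contrapT => hn.
suff /hmax : P m.+1 by rewrite ltnn.
apply/asboolP; exists (fun j => if unlift ord_max j is Some k then e k else v).
split=> [j|a]; first by case: unliftP => [k|].
rewrite big_ord_recr /= unlift_none.
have -> : \sum_(i < m) a (widen_ord (leqnSn m) i) *:
    (if unlift ord_max (widen_ord (leqnSn m) i) is Some k then e k else v) =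
    \sum_(i < m) a (widen_ord (leqnSn m) i) *: e i.
  apply: eq_bigr => i _; have -> : widen_ord (leqnSn m) i = lift ord_max i.
    by apply: val_inj; rewrite /= /bump leqNgt ltn_ord.
  by rewrite liftK.
move=> h; case: (eqVneq (a ord_max) 0) => [a0|a0].
  move: h; rewrite a0 scale0r addr0 => /he2 h j.
  case: (unliftP ord_max j) => [k ->|->//].
  rewrite -(h k); congr a; apply: val_inj.
  by rewrite /= /bump leqNgt ltn_ord.
case: hn; exists (fun i => - (a ord_max)^-1 * a (widen_ord (leqnSn m) i)).
have -> : v - \sum_j (- (a ord_max)^-1 * a (widen_ord (leqnSn m) j)) *: e j =
    (a ord_max)^-1 *: (\sum_(i < m) a (widen_ord (leqnSn m) i) *: e i + a ord_max *: v).
  rewrite scalerDr scalerA mulVf // scale1r addrC; congr (_ + _).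
  rewrite scaler_sumr -sumrN; apply: eq_bigr => i _.
  by rewrite scalerA mulNr scaleNr opprK.
exact: subspZ.
Qed.

Lemma quot_dim_quo S T S' m : subsp T -> subsp S' -> T `<=` S' ->
  quot_dim S T m -> exists p, quot_dim S S' p.
Proof.
move=> hT hS' hTS' h; apply: (@quot_dim_exists _ _ m) => // p e [he1 he2].
by apply: (indep_mod_leq hT h (e := e)); split=> // a /hTS' /he2.
Qed.

Lemma quot_dim_sub S T S' m : subsp T -> S' `<=` S ->
  quot_dim S T m -> exists2 p, quot_dim S' T p & (p <= m)%N.
Proof.
move=> hT hS'S h.
have hle p (e : 'I_p -> V) : indep_mod S' T e -> (p <= m)%N.
  by move=> [he1 he2]; apply: (indep_mod_leq hT h (e := e)); split=> // j; exact: hS'S.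
have [p hp] := quot_dim_exists hT hle.
by exists p => //; have [e /hle] := quot_dim_indep hp.
Qed.

Lemma quot_dim_add S S' T m p : subsp S' -> S' `<=` S -> T `<=` S' ->
  quot_dim S S' m -> quot_dim S' T p -> quot_dim S T (m + p).
Proof.
move=> hS' hS'S hTS' [e [e1 e2 e3]] [f [f1 f2 f3]].
pose g (j : 'I_(m + p)) := match fintype.split j with inl i => e i | inr k => f k end.
have gl i : g (lshift p i) = e i by rewrite /g (unsplitK (inl i)).
have gr k : g (rshift m k) = f k by rewrite /g (unsplitK (inr k)).
have gsum (a : 'I_(m + p) -> K) : \sum_j a j *: g j =
    \sum_i a (lshift p i) *: e i + \sum_k a (rshift m k) *: f k.
  by rewrite big_split_ord /=; congr (_ + _); apply: eq_bigr => i _; rewrite ?gl ?gr.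
exists g; split=> [j|v hv|a].
- by rewrite /g; case: splitP => [i _|k _] //; apply: hS'S.
- have [a ha] := e2 v hv; have [b hb] := f2 _ ha.
  exists (fun j => match fintype.split j with inl i => a i | inr k => b k end).
  rewrite gsum opprD addrA.
  under eq_bigr do rewrite (unsplitK (inl _)).
  by under [X in T (_ - X)]eq_bigr do rewrite (unsplitK (inr _)).
rewrite gsum => h.
have ha := e3 (fun i => a (lshift p i)).
have {}ha i : a (lshift p i) = 0.
  apply: ha; rewrite -[X in S' X](addrK (\sum_k a (rshift m k) *: f k)).
  apply: subspB => //; first exact: hTS'.
  by apply: subsp_sum => // k _; exact: subspZ.
move: h; rewrite big1 ?add0r => [h|i _]; last by rewrite ha scale0r.
have hb := f3 (fun k => a (rshift m k)) h.
by move=> j; rewrite -(splitK j); case: (fintype.split j) => i /=.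
Qed.

Lemma quot_dim_refl S : subsp S -> quot_dim S S 0.
Proof.
move=> hS; exists (fun=> 0); split=> [[]//|v hv|a _ []//].
by exists (fun=> 0); rewrite big_ord0 subr0.
Qed.

Lemma quot_dim0_sub S T : quot_dim S T 0 -> S `<=` T.
Proof. by move=> [e [_ h _]] v /h[a]; rewrite big_ord0 subr0. Qed.

Lemma quot_dim_eq_sub S S' T m : subsp T -> subsp S' -> S' `<=` S -> T `<=` S' ->
  quot_dim S T m -> quot_dim S' T m -> S `<=` S'.
Proof.
move=> hT hS' h1 h2 hS hS'm.
have [p hp] := quot_dim_quo hT hS' h2 hS.
have := quot_dim_uniq hT hS (quot_dim_add hS' h1 h2 hp hS'm).
move=> e; have p0 : p = 0%N by lia.
by apply: quot_dim0_sub; rewrite -p0.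
Qed.

Lemma quot_dim_filtration (F : nat -> set V) (g : nat -> nat) M :
    (forall m, subsp (F m)) -> (forall m, F m.+1 `<=` F m) ->
    (forall m, (m < M)%N -> quot_dim (F m) (F m.+1) (g m)) ->
  quot_dim (F 0%N) (F M) (\sum_(m < M) g m).
Proof.
move=> hF hd; elim: M => [|M IH] hg; first by rewrite big_ord0; exact: quot_dim_refl.
rewrite big_ord_recr /=; apply: (@quot_dim_add _ (F M)) => //; last exact: hg.
  elim: M {IH hg} => [//|M IH]; apply: subset_trans (hd M) IH.
by apply: IH => m hm; apply: hg; exact: ltnW.
Qed.

End QuotDim.

Section LinearImage.
Variables (K : fieldType) (V W : lmodType K).

(** The isomorphism theorem for a map assumed linear only on [S]. Taylor coefficients are of this
    kind: they are linear on families of holomorphic germs, not on all total functions. *)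
Lemma quot_dim_image (S T : set V) (G : set W) (f : V -> W) m :
    subsp S -> (forall a u v, S u -> S v -> f (a *: u + v) = a *: f u + f v) ->
    (forall v, S v -> G (f v)) -> (forall w, G w -> exists2 v, S v & f v = w) ->
    (forall v, S v -> T v <-> f v = 0) ->
  quot_dim G [set 0] m -> quot_dim S T m.
Proof.
move=> hS fl hG hG' hT [e [e1 e2 e3]].
have /choice[d hd] : forall j, exists v, S v /\ f v = e j.
  by move=> j; have [v h1 h2] := hG' _ (e1 j); exists v.
have f0 : f 0 = 0.
  have := fl 1 0 0 (subsp0 hS) (subsp0 hS).
  by rewrite !scale1r addr0 => h; apply: (addrI (f 0)); rewrite addr0 -h.
have fsum (a : 'I_m -> K) : f (\sum_j a j *: d j) = \sum_j a j *: e j.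
  have [_ //] : S (\sum_j a j *: d j) /\ f (\sum_j a j *: d j) = \sum_j a j *: e j.
  elim/big_rec2: _ => [|j y x _ [h1 h2]]; first by split; [exact: subsp0|].
  have [h3 h4] := hd j.
  by split; [apply: hS.2|rewrite fl // h2 h4].
have Ssum (a : 'I_m -> K) : S (\sum_j a j *: d j).
  by apply: subsp_sum => // j _; apply: subspZ => //; case: (hd j).
exists d; split=> [j|v hv|a]; first by case: (hd j).
  have [a ha] := e2 _ (hG v hv); exists a.
  apply/hT; first exact: subspB.
  have -> : v - \sum_j a j *: d j = (-1) *: (\sum_j a j *: d j) + v.
    by rewrite scaleN1r addrC.
  by rewrite fl // fsum scaleN1r addrC; exact: ha.
move=> /(hT _ (Ssum a)); rewrite fsum => h; exact: e3.
Qed.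

End LinearImage.

Section Coordinates.
Variables (K : fieldType) (I : finType).

Definition coord_subsp (P : pred I) : set (I -> K^o) :=
  [set a | forall i, ~~ P i -> a i = 0].

Lemma subsp_coord P : subsp (coord_subsp P).
Proof.
split=> [i _ //|a u v hu hv i hi].
by rewrite /= /GRing.add /= /GRing.scale /= hu // hv // scaler0 addr0.
Qed.

Lemma quot_dim_coord (P : pred I) : quot_dim (coord_subsp P) [set 0] #|P|.
Proof.
pose e (j : 'I_#|P|) : I -> K^o := fun i => (i == enum_val j)%:R.
have sumE (a : I -> K) i :
    (\sum_(j < #|P|) a (enum_val j) *: e j) i = if P i then a i else 0.
  rewrite fct_sumE /=.
  have -> : \sum_(j < #|P|) (a (enum_val j) *: e j) i =
      (\sum_(k in P) a k * (i == k)%:R : K).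
    by rewrite [RHS]big_enum_val; apply: eq_bigr.
  case: (boolP (P i)) => hi.
    rewrite (bigD1 i) //= eqxx mulr1 big1 ?addr0 // => k /andP[_ hk].
    by rewrite eq_sym (negbTE hk) mulr0.
  rewrite big1 // => k hk; case: eqVneq => [ik|]; last by rewrite mulr0.
  by move: hi; rewrite ik -[P k]/(k \in P) hk.
exists e; split.
- move=> j i hi; rewrite /e; case: eqVneq => // h; move: hi.
  by rewrite h -[P _]/(_ \in P) enum_valP.
- move=> v hv; exists (fun j => v (enum_val j)); apply/funext => i.
  apply/eqP; rewrite subr_eq0 sumE; case: (boolP (P i)) => // hi.
  by rewrite hv.
move=> a h j.
pose b i : K := \sum_(j < #|P|) a j * (i == enum_val j)%:R.
have hb k : b (enum_val k) = a k.
  rewrite /b (bigD1 k) //= eqxx mulr1 big1 ?addr0 // => i hi.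
  by rewrite (inj_eq enum_val_inj) eq_sym (negbTE hi) mulr0.
rewrite -hb.
have := congr1 (fun f => f (enum_val j)) h.
by rewrite fct_sumE.
Qed.

End Coordinates.

(** * Power sums of linear forms *)

Section Exponents.
Variable n : nat.
Implicit Types (h m : nat) (e : 'I_n -> nat).

Lemma leq_sum_term e h l : (\sum_j e j)%N = h -> (e l <= h)%N.
Proof. by move=> <-; rewrite (bigD1 l) //= leq_addr. Qed.

(** Faithful when [e] has total degree [h], since no exponent then exceeds [h]; the default of
    [inord] is never met in that case. *)
Definition expo h e : {ffun 'I_n -> 'I_h.+1} := [ffun l => inord (e l)].

Lemma expoE h e l : (\sum_j e j)%N = h -> expo h e l = e l :> nat.
Proof. by move=> he; rewrite ffunE inordK // ltnS; exact: leq_sum_term he. Qed.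

Lemma expo_mon h e : (\sum_j e j)%N = h -> expo h e \in mon n h.
Proof.
move=> he; rewrite inE; apply/eqP; rewrite -[RHS]he.
by apply: eq_bigr => l _; exact: expoE.
Qed.

Lemma mon_sum h (L : {ffun 'I_n -> 'I_h.+1}) :
  L \in mon n h -> (\sum_j (L j : nat))%N = h.
Proof. by rewrite inE => /eqP. Qed.

Lemma mon_inj h (L M : {ffun 'I_n -> 'I_h.+1}) :
  (forall l, L l = M l :> nat) -> L = M.
Proof. by move=> H; apply/ffunP => l; apply: val_inj; exact: H. Qed.

Definition msupp h (L : {ffun 'I_n -> 'I_h.+1}) : {set 'I_n} :=
  [set l | (L l : nat) != 0%N].

Lemma card_msupp h (L : {ffun 'I_n -> 'I_h.+1}) : L \in mon n h -> (#|msupp L| <= h)%N.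
Proof.
move=> /mon_sum hL; rewrite -[X in (_ <= X)%N]hL -sum1_card.
rewrite [X in (_ <= X)%N](bigID (mem (msupp L))) /=.
apply: leq_trans (leq_addr _ _); apply: leq_sum => l; rewrite inE; lia.
Qed.

End Exponents.

Lemma card_mon n h : (0 < n)%N -> #|mon n h| = c n h.
Proof.
case: n => // n _; rewrite /c (_ : (n.+1 + h - 1 = n + h)%N); last by lia.
rewrite -(bin_sub (leq_addl n h)) addnK.
rewrite -card_ord_partitions.
pose f (t : n.+1.-tuple 'I_h.+1) : {ffun 'I_n.+1 -> 'I_h.+1} := [ffun i => tnth t i].
have finj : injective f.
  by move=> s t e; apply: eq_from_tnth => i; have := congr1 (fun g : {ffun _ -> _} => g i) e; rewrite !ffunE.
rewrite -(card_imset _ finj); apply: eq_card => L; apply/idP/imsetP.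
  rewrite inE => /eqP hL; exists [tuple L i | i < n.+1].
    rewrite inE; apply/eqP; rewrite -[RHS]hL big_tuple.
    by apply: eq_bigr => i _; rewrite tnth_mktuple.
  by apply/ffunP => i; rewrite ffunE tnth_mktuple.
case=> t; rewrite inE => /eqP ht ->; rewrite inE; apply/eqP.
by rewrite -[RHS]ht big_tuple; apply: eq_bigr => i _; rewrite ffunE.
Qed.

Section PowerSums.
Variables (K : numFieldType) (n : nat) (I : finType) (p : I -> 'rV[K]_n).

Definition mval (q : 'rV[K]_n) (e : 'I_n -> nat) : K := \prod_l q 0 l ^+ e l.

(** With p_i read as a linear form, this is the coefficient of the monomial [e] in the sum of the
    a_i p_i^h, up to a multinomial factor (h the degree of [e]). *)
Definition msum (a : I -> K) (e : 'I_n -> nat) : K := \sum_i a i * mval (p i) e.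

(** Independence of the [h]-th powers of the forms p_i. *)
Definition col_indep (h : nat) := forall a : I -> K,
  (forall L, L \in mon n h -> msum a (fun l => L l) = 0) -> forall i, a i = 0.

(** No nonzero form of degree [h] vanishes at all points p_i; dually, the [h]-th powers of the p_i
    span the forms of degree [h]. *)
Definition row_indep (h : nat) := forall q : {ffun 'I_n -> 'I_h.+1} -> K,
  (forall i, \sum_(L in mon n h) q L * mval (p i) (fun l => L l) = 0) ->
  forall L, L \in mon n h -> q L = 0.

Definition Vmx (h : nat) : 'M[K]_(#|mon n h|, #|I|) :=
  \matrix_(r, i) mval (p (enum_val i)) (fun l => (enum_val r : {ffun 'I_n -> 'I_h.+1}) l).

Lemma msum_linear (k : K) a b e : msum (fun i => k * a i + b i) e = k * msum a e + msum b e.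
Proof. by rewrite /msum mulr_sumr -big_split /=; apply: eq_bigr => i _; ring. Qed.

Lemma msum_sum (T : Type) (r : seq T) (P : pred T) (k : T -> K) (a : T -> I -> K) e :
  msum (fun i => \sum_(t <- r | P t) k t * a t i) e = \sum_(t <- r | P t) k t * msum (a t) e.
Proof.
rewrite /msum; under eq_bigr do rewrite mulr_suml.
rewrite exchange_big /=; apply: eq_bigr => t _; rewrite mulr_sumr.
by apply: eq_bigr => i _; rewrite mulrA.
Qed.

Lemma mval_expo h e q : (\sum_j e j)%N = h -> mval q (fun l => expo h e l) = mval q e.
Proof. by move=> he; apply: eq_bigr => l _; rewrite expoE. Qed.

Lemma col_indepP h : col_indep h <-> \rank (Vmx h) = #|I|.
Proof.
have E (a : I -> K) (r : 'I_#|mon n h|) :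
    ((\row_i a (enum_val i)) *m (Vmx h)^T) 0 r = msum a (fun l => (enum_val r : {ffun 'I_n -> 'I_h.+1}) l).
  rewrite mxE /msum [RHS]big_enum_val /=.
  by rewrite (eq_bigl xpredT) //; apply: eq_bigr => i _; rewrite !mxE.
split=> [H|H].
  rewrite -mxrank_tr; apply/eqP; rewrite -/(row_free _) -kermx_eq0.
  apply: contraT => /rowV0Pn[v hv v0]; case/negP: v0; apply/eqP/rowP => j; rewrite mxE.
  have hv0 : v *m (Vmx h)^T = 0 by apply/eqP; rewrite -sub_kermx.
  have := H (fun i => v 0 (enum_rank i)) _ (enum_val j); rewrite enum_valK; apply.
  move=> L hL; rewrite -[L](enum_rankK_in hL hL) -E.
  have -> : \row_i v 0 (enum_rank (enum_val i)) = v by apply/rowP => i; rewrite mxE enum_valK.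
  by rewrite hv0 mxE.
move=> a ha i.
have hfree : row_free (Vmx h)^T by rewrite /row_free mxrank_tr H.
have : \row_i a (enum_val i) = 0 :> 'rV_#|I|.
  by apply: (row_free_inj hfree); rewrite /= mul0mx; apply/rowP => r; rewrite E ha ?mxE ?enum_valP.
by move=> /rowP /(_ (enum_rank i)); rewrite !mxE enum_rankK.
Qed.

Lemma row_indepP h : row_indep h <-> \rank (Vmx h) = #|mon n h|.
Proof.
have E (q : {ffun 'I_n -> 'I_h.+1} -> K) (i : 'I_#|I|) :
    ((\row_r q (enum_val r)) *m (Vmx h)) 0 i =
    \sum_(L in mon n h) q L * mval (p (enum_val i)) (fun l => L l).
  by rewrite mxE [RHS]big_enum_val /=; apply: eq_bigr => r _; rewrite !mxE.
split=> [H|H].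
  apply/eqP; rewrite -/(row_free _) -kermx_eq0.
  apply: contraT => /rowV0Pn[v hv v0]; case/negP: v0; apply/eqP/rowP => j; rewrite mxE.
  have hv0 : v *m (Vmx h) = 0 by apply/eqP; rewrite -sub_kermx.
  pose L0 := enum_val j.
  have := H (fun L => v 0 (enum_rank_in (enum_valP j) L)) _ L0 (enum_valP j).
  rewrite enum_valK_in; apply => i.
  rewrite -(enum_rankK i) -E.
  have -> : \row_r v 0 (enum_rank_in (enum_valP j) (enum_val r)) = v.
    by apply/rowP => r; rewrite mxE enum_valK_in.
  by rewrite hv0 mxE.
move=> q hq L hL.
have hfree : row_free (Vmx h) by rewrite /row_free H.
have : \row_r q (enum_val r) = 0 :> 'rV_#|mon n h|.
  by apply: (row_free_inj hfree); rewrite /= mul0mx; apply/rowP => i; rewrite E hq mxE.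
by move=> /rowP /(_ (enum_rank_in hL L)); rewrite !mxE enum_rankK_in.
Qed.

(** The coefficients are the column of index [L] of a right inverse of the matrix of powers. *)
Lemma row_indep_delta h L : row_indep h -> L \in mon n h ->
  exists a, forall M, M \in mon n h -> msum a (fun l => M l) = (M == L)%:R.
Proof.
move=> /row_indepP H hL.
have hfree : row_free (Vmx h) by rewrite /row_free H.
pose W := pinvmx (Vmx h).
exists (fun i => W (enum_rank i) (enum_rank_in hL L)) => M hM.
have := mulmxVp hfree => /matrixP /(_ (enum_rank_in hL M) (enum_rank_in hL L)).
rewrite !mxE => e.
have -> : (M == L) = (enum_rank_in hL M == enum_rank_in hL L).
  by apply/eqP/eqP => [->//|/enum_rank_in_inj]; apply.
rewrite -[RHS]e /msum [LHS]big_enum_val /=.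
rewrite (eq_bigl xpredT) //; apply: eq_bigr => i _.
by rewrite !mxE enum_rankK_in // enum_valK mulrC.
Qed.

Definition bump_exp (e : 'I_n -> nat) (j : 'I_n) (d : nat) : 'I_n -> nat :=
  fun l => (e l + (if l == j then d else 0))%N.

Lemma sum_bump_exp e j d : (\sum_l bump_exp e j d l)%N = (\sum_l e l + d)%N.
Proof. by rewrite big_split /= -big_mkcond /= big_pred1_eq. Qed.

Lemma mval_bump_exp q e j d : mval q (bump_exp e j d) = mval q e * q 0 j ^+ d.
Proof.
rewrite /mval; under eq_bigr do rewrite exprD.
rewrite big_split /=; congr (_ * _).
rewrite (bigD1 j) //= eqxx big1 ?mulr1 // => l hl.
by rewrite (negbTE hl) expr0.
Qed.

(** A form of degree m vanishing at all p_i, multiplied by the (k - m)-th power of the variable [j],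
    is such a form of degree k; the multiplication is injective. *)
Lemma row_indep_leq k m (j : 'I_n) : (m <= k)%N -> row_indep k -> row_indep m.
Proof.
move=> hmk H q hq L hL.
pose sh (L : {ffun 'I_n -> 'I_m.+1}) := bump_exp (fun l => L l) j (k - m).
have shs M : M \in mon n m -> (\sum_l sh M l)%N = k.
  by move=> /mon_sum hM; rewrite sum_bump_exp hM subnKC.
pose q' (L' : {ffun 'I_n -> 'I_k.+1}) : K :=
  \sum_(M in mon n m) q M * (expo k (sh M) == L')%:R.
have Hq' : forall i, \sum_(L' in mon n k) q' L' * mval (p i) (fun l => L' l) = 0.
  move=> i; rewrite -[RHS](mul0r (p i 0 j ^+ (k - m))) -[in RHS](hq i) mulr_suml.
  under eq_bigr do rewrite mulr_suml.
  rewrite exchange_big /=; apply: eq_bigr => M hM.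
  rewrite (bigD1 (expo k (sh M))) /=; last exact: expo_mon (shs M hM).
  rewrite eqxx mulr1 big1 ?addr0 => [|L' /andP[_ hL']].
    by rewrite mval_expo ?shs // mval_bump_exp mulrA.
  by rewrite eq_sym (negbTE hL') mulr0 mul0r.
rewrite -[RHS](H q' Hq' _ (expo_mon (shs L hL))) /q' (bigD1 L) //= eqxx mulr1.
rewrite big1 ?addr0 // => M /andP[hM hML].
case: eqP => [e|]; last by rewrite mulr0.
case/eqP: hML; apply: mon_inj => l.
have := congr1 (fun g : {ffun 'I_n -> 'I_k.+1} => (g l : nat)) e.
by rewrite /= !expoE ?shs // /sh /bump_exp => /addIn.
Qed.

Lemma col_indep_neq0 k i : (0 < k)%N -> col_indep k -> p i != 0.
Proof.
move=> hk H; apply: contra_neq (oner_neq0 K) => p0.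
have := H (fun j => (j == i)%:R) _ i; rewrite eqxx; apply => L /mon_sum hL.
rewrite /msum (bigD1 i) //= eqxx mul1r big1 ?addr0 => [|j hj]; last first.
  by rewrite (negbTE hj) mul0r.
have [l hl] : exists l, (0 < L l)%N.
  apply/existsP; apply: contraT; rewrite negb_exists => /forallP h.
  move: hk; rewrite -hL big1 // => l _; apply/eqP; by rewrite -leqn0 leqNgt h.
by rewrite /mval (bigD1 l) //= p0 mxE expr0n gtn_eqF // mul0r.
Qed.

(** Restricting a relation between m-th powers to monomials divisible by the (m - k)-th power of a
    variable j gives the relation a_i p_ij^(m-k) between k-th powers; j is chosen with p_ij nonzero
    for the index at hand. *)
Lemma col_indep_geq k m : (k <= m)%N -> (forall i, p i != 0) ->
  col_indep k -> col_indep m.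
Proof.
move=> hkm hp H a ha i.
have [j hj] : exists j, p i 0 j != 0.
  apply/existsP; apply: contraT; rewrite negb_exists => /forallP h.
  case/eqP: (hp i); apply/rowP => j; rewrite mxE; apply/eqP; by rewrite -[_ == _]negbK h.
have : a i * p i 0 j ^+ (m - k) = 0.
  apply: (H (fun i => a i * p i 0 j ^+ (m - k))) => L /mon_sum hL.
  have hs : (\sum_l bump_exp (fun l => L l) j (m - k) l)%N = m.
    by rewrite sum_bump_exp hL subnKC.
  rewrite -[RHS](ha _ (expo_mon hs)); apply: eq_bigr => i' _.
  by rewrite mval_expo // mval_bump_exp; ring.
by move=> /eqP; rewrite mulf_eq0 expf_eq0 (negbTE hj) andbF orbF => /eqP.
Qed.

(** In degree k the matrix is square, so independent columns mean independent rows. Full row rank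
    then goes down to smaller degrees and full column rank up to larger ones. *)
Lemma ordinaryP k : (0 < n)%N -> (0 < k)%N -> #|I| = #|mon n k| ->
  col_indep k <->
  (forall m, (1 <= m)%N -> \rank (Vmx m) = minn #|I| #|mon n m|).
Proof.
move=> hn hk hI; split=> [H m hm|H]; last first.
  by apply/col_indepP; rewrite H // -hI minnn.
have hrow : row_indep k.
  by apply/row_indepP; have /col_indepP -> := H.
case: (leqP m k) => hmk.
  have hr : \rank (Vmx m) = #|mon n m|.
    exact/row_indepP/(row_indep_leq (Ordinal hn) hmk hrow).
  have := rank_leq_col (Vmx m); rewrite hr => /minn_idPr ->.
  by [].
have hm' : \rank (Vmx m) = #|I|.
  apply/col_indepP; apply: (col_indep_geq (ltnW hmk) _ H).
  by move=> i; exact: (col_indep_neq0 i hk H).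
have := rank_leq_row (Vmx m); rewrite hm' => /minn_idPl ->.
by [].
Qed.

End PowerSums.

(** * Relations between powers, sorted by support *)

Section Decomposition.
Variables (K : numFieldType) (n : nat) (I : finType) (p : I -> 'rV[K]_n).
Variables (supp : I -> {set 'I_n}) (k0 : nat).
Hypothesis psupp : forall i l, l \notin supp i -> p i 0 l = 0.
Hypothesis delta : forall m (L : {ffun 'I_n -> 'I_m.+1}), (1 <= m <= k0)%N ->
  L \in mon n m -> exists a : I -> K,
    (forall i, ~~ (supp i \subset msupp L) -> a i = 0) /\
    forall M, M \in mon n m -> msum p a (fun l => M l) = (M == L)%:R.
Hypothesis supp0 : forall i, supp i != finset.set0.

Lemma mval_supp m (L : {ffun 'I_n -> 'I_m.+1}) i :
  ~~ (msupp L \subset supp i) -> mval (p i) (fun l => L l) = 0.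
Proof.
move=> /subsetPn[l]; rewrite inE => hl /psupp h.
by rewrite /mval (bigD1 l) //= h expr0n (negbTE hl) mul0r.
Qed.

Definition relation m (a : I -> K) :=
  forall L : {ffun 'I_n -> 'I_m.+1}, L \in mon n m -> msum p a (fun l => L l) = 0.

Lemma relation_linear m (k : K) a b : relation m a -> relation m b ->
  relation m (fun i => k * a i + b i).
Proof. by move=> ha hb L hL; rewrite msum_linear ha // hb // mulr0 addr0. Qed.

(* By induction on [h]: for [#|S| = h.+1] the part of [a] with support exactly
   [S] has a sum of powers supported on monomials in fewer variables, so it
   becomes a relation after a correction by elements of smaller support. *)
Lemma relation_decomp m h (a : I -> K) : (1 <= m <= k0)%N ->
    relation m a -> (forall i, (h < #|supp i|)%N -> a i = 0) ->
  exists A : {set 'I_n} -> I -> K,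
    [/\ forall S, relation m (A S),
        forall (S : {set 'I_n}) i, ~~ (supp i \subset S) -> A S i = 0,
        forall (S : {set 'I_n}) i, (h < #|S|)%N -> A S i = 0
      & forall i, a i = \sum_S A S i].
Proof.
move=> hm; elim: h a => [|h IH] a ha hsup.
  have a0 i : a i = 0 by apply: hsup; rewrite card_gt0.
  exists (fun _ _ => 0); split => //.
    by move=> S L _; rewrite /msum big1 // => i _; rewrite mul0r.
  by move=> i; rewrite a0 big1.
pose aS (S : {set 'I_n}) i := if supp i == S then a i else 0.
(* A monomial with support S is reached only by indices of support exactly S, larger supports being
   excluded, so its coefficient is that of [a], namely zero. A monomial not contained in S is not
   reached at all. *)
have aSL (S : {set 'I_n}) (L : {ffun 'I_n -> 'I_m.+1}) : #|S| = h.+1 ->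
    L \in mon n m -> ~~ (msupp L \proper S) -> msum p (aS S) (fun l => L l) = 0.
  move=> hS hL; rewrite finset.properEneq negb_and negbK => /orP[/eqP hLS|hLS].
    rewrite -[RHS](ha L hL); apply: eq_bigr => i _; rewrite /aS.
    case: eqVneq => // hi; rewrite mul0r.
    case: (leqP #|supp i| h.+1) => hi2; last by rewrite hsup ?mul0r.
    rewrite mval_supp ?mulr0 // hLS; apply: contra hi => hsub.
    by rewrite eq_sym eqEcard hsub hS.
  rewrite /msum big1 // => i _; rewrite /aS; case: eqP => [e|_]; last by rewrite mul0r.
  by rewrite mval_supp ?mulr0 // e.
have /choice[d hd] : forall L : {ffun 'I_n -> 'I_m.+1}, exists b : I -> K,
    L \in mon n m -> (forall i, ~~ (supp i \subset msupp L) -> b i = 0) /\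
      forall M, M \in mon n m -> msum p b (fun l => M l) = (M == L)%:R.
  move=> L; case: (boolP (L \in mon n m)) => hL; last by exists (fun=> 0).
  by have [b hb] := delta hm hL; exists b.
pose cS (S : {set 'I_n}) i := \sum_(L in mon n m | msupp L \proper S)
  msum p (aS S) (fun l => L l) * d L i.
have cS_out (S : {set 'I_n}) i : ~~ (supp i \proper S) -> cS S i = 0.
  move=> hi; rewrite /cS big1 // => L /andP[hL hLS].
  rewrite (hd L hL).1 ?mulr0 //; apply: contra hi => h1.
  exact: sub_proper_trans h1 hLS.
have cS_sum (S : {set 'I_n}) M : #|S| = h.+1 -> M \in mon n m ->
    msum p (cS S) (fun l => M l) = msum p (aS S) (fun l => M l).
  move=> hS hM; rewrite msum_sum.
  case: (boolP (msupp M \proper S)) => hMS.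
    rewrite (bigD1 M) /=; last by rewrite hM.
    rewrite (hd M hM).2 // eqxx mulr1 big1 ?addr0 // => L /andP[/andP[hL _] hLM].
    by rewrite (hd L hL).2 // eq_sym (negbTE hLM) mulr0.
  rewrite (aSL S M) // big1 // => L /andP[hL hLS].
  rewrite (hd L hL).2 //; case: eqP => [e|]; last by rewrite mulr0.
  by move: hMS; rewrite e hLS.
pose B (S : {set 'I_n}) i := aS S i - cS S i.
have Brel (S : {set 'I_n}) : #|S| = h.+1 -> relation m (B S).
  move=> hS L hL.
  have -> : msum p (B S) (fun l => L l) =
      msum p (fun i => (-1) * cS S i + aS S i) (fun l => L l).
    by apply: eq_bigr => i _; rewrite /B; ring.
  by rewrite msum_linear cS_sum // mulN1r addNr.
(* This clears all indices of support size h + 1: [B S] agrees with [a] on those of support S, and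
   its correction [cS S] lives on strictly smaller supports. *)
pose a' i := a i - \sum_(S : {set 'I_n} | #|S| == h.+1) B S i.
have a'rel : relation m a'.
  move=> L hL.
  have -> : msum p a' (fun l => L l) =
     msum p (fun i => (-1) * (\sum_(S : {set 'I_n} | #|S| == h.+1) 1 * B S i) + a i) (fun l => L l).
    apply: eq_bigr => i _; rewrite /a'; congr (_ * _).
    by under [in RHS]eq_bigr do rewrite mul1r; ring.
  rewrite msum_linear ha // msum_sum big1 ?mulr0 ?addr0 // => S /eqP hS.
  by rewrite Brel // mulr0.
have [i|A [A1 A2 A3 A4]] := IH a' a'rel.
  rewrite leq_eqVlt => /predU1P[hi|hi]; last first.
    rewrite /a' hsup // sub0r big1 ?oppr0 // => S /eqP hS.
    rewrite /B /aS cS_out; last first.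
      apply/negP => /proper_card; rewrite hS => h2; move: (ltn_trans h2 hi); by rewrite ltnn.
    by case: eqP => [e|_]; rewrite ?subr0 //; move: hi; rewrite e hS ltnn.
  rewrite /a' (bigD1 (supp i)) /=; last by rewrite -hi.
  rewrite big1 => [|S /andP[/eqP hS hSi]].
    rewrite /B /aS eqxx cS_out ?fintype.properxx //.
    by rewrite subr0 addr0 subrr.
  rewrite /B /aS eq_sym (negbTE hSi) cS_out ?subr0 //.
  by apply/negP => /proper_card; rewrite hS -hi ltnn.
exists (fun S : {set 'I_n} => if #|S| == h.+1 then B S else A S); split.
- by move=> S; case: eqP => [/Brel|] .
- move=> S i hi; case: eqP => [hS|_]; last exact: A2.
  rewrite /B /aS; case: eqP => [e|_]; first by move: hi; rewrite e subxx.
  by rewrite cS_out ?subr0 //; apply: contra hi; exact: proper_sub.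
- move=> S i hS; rewrite gtn_eqF //; apply: A3; exact: ltnW.
- move=> i; rewrite (bigID (fun S : {set 'I_n} => #|S| == h.+1)) /=.
  rewrite (eq_bigr (fun S => B S i)) => [|S ->//].
  rewrite [X in _ + X](_ : _ = a' i); first by rewrite /a'; ring.
  rewrite A4 [RHS](bigID (fun S : {set 'I_n} => #|S| == h.+1)) /=.
  rewrite [X in _ = X + _]big1 ?add0r => [|S /eqP hS]; last by rewrite A3 // hS.
  by apply: eq_bigr => S /negbTE ->.
Qed.

Definition rel_le m h : set (I -> K^o) :=
  [set a | relation m a /\ forall i, ~~ (#|supp i| <= h)%N -> a i = 0]%classic.

Lemma subsp_rel_le m h : subsp (rel_le m h).
Proof.
split.
  by split=> [L _|i _ //]; rewrite /msum big1 // => i _; rewrite mul0r.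
move=> a u v [u1 u2] [v1 v2]; split; first exact: relation_linear.
by move=> i hi; rewrite /= /GRing.add /= /GRing.scale /= u2 // v2 // scaler0 addr0.
Qed.

(** Rank-nullity for the map sending coefficients to their power sum. It is onto the forms whose
    monomials have at most h variables because [delta] never enlarges supports. *)
Lemma quot_dim_rel_le m h : (1 <= m <= k0)%N ->
  exists2 d, quot_dim (rel_le m h) [set 0]%classic d &
    (#|[set L in mon n m | (#|msupp L| <= h)%N]%SET| + d = #|[set i | (#|supp i| <= h)%N]%SET|)%N.
Proof.
move=> hm.
pose P i := (#|supp i| <= h)%N.
pose Q := fun L : {ffun 'I_n -> 'I_m.+1} => (L \in mon n m) && (#|msupp L| <= h)%N.
have hC := @quot_dim_coord K I P.
have hD := @quot_dim_coord K _ Q.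
have hsub : (rel_le m h `<=` coord_subsp P)%classic by move=> a [_ ha].
have [d hd _] := quot_dim_sub (subsp_set0 _) hsub hC.
exists d => //.
pose f (a : I -> K^o) (L : {ffun 'I_n -> 'I_m.+1}) : K^o :=
  if L \in mon n m then msum p a (fun l => L l) else 0.
have hq : quot_dim (coord_subsp P) (rel_le m h) #|Q|.
  apply: (quot_dim_image (f := f)) hD.
  - exact: subsp_coord.
  - move=> a u v _ _; apply/funext => L.
    rewrite /f [RHS]/= [RHS]/GRing.add /= [X in _ = X + _]/GRing.scale /=.
    case: ifP => hL; first exact: msum_linear.
    by rewrite scaler0 addr0.
  - move=> a ha L; rewrite /Q negb_and /f; case: ifP => // hL /= hLh.
    rewrite /msum big1 // => i _; case: (boolP (P i)) => hi; last by rewrite ha ?mul0r.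
    rewrite mval_supp ?mulr0 //; apply: contra hLh => /subset_leq_card h1.
    exact: leq_trans h1 hi.
  - move=> b hb.
    have /choice[e he] : forall L : {ffun 'I_n -> 'I_m.+1}, exists a : I -> K,
        L \in mon n m -> (forall i, ~~ (supp i \subset msupp L) -> a i = 0) /\
          forall M, M \in mon n m -> msum p a (fun l => M l) = (M == L)%:R.
      move=> L; case: (boolP (L \in mon n m)) => hL; last by exists (fun=> 0).
      by have [a ha] := delta hm hL; exists a.
    exists (fun i => \sum_(L | Q L) b L * e L i).
      move=> i hi; rewrite big1 // => L /andP[hL hLh].
      rewrite (he L hL).1 ?mulr0 //; apply: contra hi => /subset_leq_card h1.
      exact: leq_trans h1 hLh.
    apply/funext => M; rewrite /f; case: ifP => hM; last first.
      by rewrite hb // /Q hM.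
    rewrite msum_sum; case: (boolP (Q M)) => hQM.
      rewrite (bigD1 M) //= (he M hM).2 // eqxx mulr1 big1 ?addr0 // => L /andP[/andP[hL _] hLM].
      by rewrite (he L hL).2 // eq_sym (negbTE hLM) mulr0.
    rewrite hb // big1 // => L /[dup] hQL /andP[hL _].
    rewrite (he L hL).2 //; case: eqP => [e1|]; last by rewrite mulr0.
    by move: hQM; rewrite e1 hQL.
  move=> a ha; split=> [[h1 h2]|h1].
    by apply/funext => L; rewrite /f; case: ifP => // hL; exact: h1.
  split=> // L hL; have := congr1 (fun g => g L) h1.
  by rewrite /f hL.
have h0 : ([set 0] `<=` rel_le m h)%classic.
  by move=> _ ->; exact: subsp0 (subsp_rel_le m h).
have e := quot_dim_uniq (subsp_set0 _) hC (quot_dim_add (subsp_rel_le m h) hsub h0 hq hd).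
rewrite !cardsE -/P; apply/esym; exact: e.
Qed.

End Decomposition.

(** * Multi-indices and indices of the superposed web *)

Section MultiIndices.

Definition mset n k (J : mindex n k) : {set 'I_n} := [set tnth (val J) j | j : 'I_k]%SET.

Lemma mindex_ltn n k (J : mindex n k) (i j : 'I_k) :
  (i < j)%N -> (tnth (val J) i < tnth (val J) j)%N.
Proof.
move=> hij; have := valP J; rewrite sorted_map => hs.
have l0 := tnth (val J) i.
rewrite !(tnth_nth l0).
have := @sorted_ltn_nth _ (relpre val ltn) _ l0 (val J) hs i j.
rewrite !inE size_tuple => H; apply: H => //.
by move=> a b c; apply: ltn_trans.
Qed.

Lemma mindex_inj n k (J : mindex n k) : injective (tnth (val J)).
Proof.
move=> i j e; apply/val_inj; case: (ltngtP i j) => // /(mindex_ltn J); by rewrite e ltnn.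
Qed.

Lemma card_mset n k (J : mindex n k) : #|mset J| = k.
Proof. by rewrite card_imset ?card_ord //; exact: mindex_inj. Qed.

Lemma mindex_mono n k (J : mindex n k) (i j : 'I_k) :
  (tnth (val J) i < tnth (val J) j)%N = (i < j)%N.
Proof.
case: (ltngtP i j) => [/mindex_ltn -> //|h|/val_inj ->]; last by rewrite ltnn.
by apply/negbTE; rewrite -leqNgt ltnW // mindex_ltn.
Qed.

Lemma mk_mindex_subproof n k (f : 'I_k -> 'I_n) :
  (forall i j : 'I_k, (i < j)%N -> (f i < f j)%N) ->
  sorted ltn (map val [tuple f i | i < k]).
Proof.
move=> hf; rewrite sorted_map.
case: k f hf => [|k] f hf; first by rewrite (size0nil (size_tuple [tuple f i | i < 0])).
apply/(sortedP (f ord0)) => i; rewrite size_tuple => hi.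
set T := [tuple f i | i < k.+1].
have e1 := tnth_nth (f ord0) T (Ordinal (ltnW hi)).
have e2 := tnth_nth (f ord0) T (Ordinal hi).
rewrite !tnth_mktuple /= in e1 e2.
suff : (nth (f ord0) T i < nth (f ord0) T i.+1)%N by [].
by rewrite -e1 -e2; apply: hf.
Qed.

Definition mk_mindex n k (f : 'I_k -> 'I_n)
  (hf : forall i j : 'I_k, (i < j)%N -> (f i < f j)%N) : mindex n k :=
  exist (fun J : k.-tuple 'I_n => sorted ltn (map val J))
    [tuple f i | i < k] (mk_mindex_subproof hf).

Lemma mk_mindexE n k (f : 'I_k -> 'I_n) hf i : tnth (val (@mk_mindex n k f hf)) i = f i.
Proof. by rewrite /= tnth_mktuple. Qed.

Lemma mindex_eqP n k (J J' : mindex n k) :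
  (forall i, tnth (val J) i = tnth (val J') i) -> J = J'.
Proof. by move=> H; apply/val_inj/eq_from_tnth. Qed.

Definition mcomp n h k (J : mindex n h) (J' : mindex h k) : mindex n k :=
  mk_mindex (fun (i j : 'I_k) (hij : (i < j)%N) => mindex_ltn J (mindex_ltn J' hij)).

Lemma mcompE n h k (J : mindex n h) (J' : mindex h k) i :
  tnth (val (mcomp J J')) i = tnth (val J) (tnth (val J') i).
Proof. exact: mk_mindexE. Qed.

Lemma mcomp_inj n h k (J : mindex n h) : injective (@mcomp n h k J).
Proof.
move=> A B e; apply: mindex_eqP => i; apply: (@mindex_inj _ _ J).
by rewrite -!mcompE e.
Qed.

Lemma mcomp_factor n h k (J : mindex n h) (L : mindex n k) :
  mset L \subset mset J -> exists J', L = mcomp J J'.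
Proof.
move=> hsub.
have hf i : exists j, tnth (val J) j = tnth (val L) i.
  have /(fintype.subsetP hsub) /imsetP[j _ ->] : tnth (val L) i \in mset L by apply: imset_f.
  by exists j.
have [f {}hf] := choice hf.
have hm (i j : 'I_k) : (i < j)%N -> (f i < f j)%N.
  by move=> hij; rewrite -(mindex_mono J) !hf mindex_ltn.
exists (mk_mindex hm); apply: mindex_eqP => i.
by rewrite mcompE mk_mindexE hf.
Qed.

Lemma mindex_of_set n (S : {set 'I_n}) : exists J : mindex n #|S|, mset J = S.
Proof.
pose f (i : 'I_#|S|) : 'I_n := enum_val i.
have hs : sorted ltn [seq val x | x <- enum S].
  have eS : enum S = seq.filter (mem S) (enum 'I_n) by rewrite enumT.
  have tr : transitive (relpre (val : 'I_n -> nat) ltn) by move=> a b d; exact: ltn_trans.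
  rewrite eS sorted_map; apply: (sorted_filter tr).
  by have := iota_ltn_sorted 0 n; rewrite -val_enum_ord sorted_map.
have hm (i j : 'I_#|S|) : (i < j)%N -> (f i < f j)%N.
  move=> hij; rewrite sorted_map in hs.
  have x0 := f i.
  rewrite /f !(enum_val_nth x0).
  have := @sorted_ltn_nth _ (relpre val ltn) _ x0 (enum S) hs i j.
  rewrite !inE -!cardE => H; apply: H => //.
  by move=> a b c; apply: ltn_trans.
exists (mk_mindex hm); apply/setP => l; apply/imsetP/idP.
  by case=> i _ ->; rewrite mk_mindexE enum_valP.
move=> hl; exists (enum_rank_in hl l) => //.
by rewrite mk_mindexE /f enum_rankK_in.
Qed.

Lemma card_mindex n k : #|{: mindex n k}| = 'C(n, k).
Proof.
rewrite card_sub -card_ltn_sorted_tuples; apply: eq_card => t.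
by rewrite !inE.
Qed.

Lemma coord_proj_mcomp (R : realType) n h k (J : mindex n h) (J' : mindex h k) (x : 'rV[Cplx R]_n) :
  coord_proj (mcomp J J') x = coord_proj J' (coord_proj J x).
Proof. by apply/rowP => i; rewrite !mxE mcompE. Qed.

End MultiIndices.

Section WebIndices.
Variable k0 : nat.

Definition isupp n (i : Windex k0 n) : {set 'I_n} := mset (tagged i).1.

Lemma card_isupp n (i : Windex k0 n) : #|isupp i| = (tag i).+1.
Proof. exact: card_mset. Qed.

Lemma isupp_neq0 n (i : Windex k0 n) : isupp i != finset.set0.
Proof. by rewrite -card_gt0 card_isupp. Qed.

(* Index in [W(n, E)] of the pullback of a first integral of [W(h, E)]. *)
Definition wlift n h (J : mindex n h) (i : Windex k0 h) : Windex k0 n :=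
  existT _ (tag i) (mcomp J (tagged i).1, (tagged i).2).

Lemma wlift_inj n h (J : mindex n h) : injective (wlift J).
Proof.
move=> [k [A b]] [k' [A' b']] e.
have ek := congr1 tag e; rewrite /= in ek; subst k'.
move: e => /eqP; rewrite /wlift /= -/(Tagged _ _) -/(Tagged _ _).
rewrite eq_Tagged => /eqP e.
by rewrite (mcomp_inj (congr1 fst e : mcomp J A = mcomp J A')) (congr1 snd e : b = b').
Qed.

Lemma isupp_wlift n h (J : mindex n h) i : isupp (wlift J i) = [set tnth (val J) j | j in isupp i]%SET.
Proof.
apply/setP => l; apply/imsetP/imsetP.
  case=> j _ ->; exists (tnth (val (tagged i).1) j); first exact: imset_f.
  exact: mcompE.
case=> j' /imsetP[j _ ->] ->; exists j => //; exact/esym/mcompE.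
Qed.

Lemma isupp_wlift_sub n h (J : mindex n h) i : isupp (wlift J i) \subset mset J.
Proof.
rewrite isupp_wlift; apply/fintype.subsetP => _ /imsetP[j _ ->]; exact: imset_f.
Qed.

Lemma wlift_factor n h (J : mindex n h) (i : Windex k0 n) :
  isupp i \subset mset J -> exists i', i = wlift J i'.
Proof.
case: i => k [A b] /mcomp_factor[/= A' eA].
by exists (existT _ k (A', b)); rewrite /wlift /= eA.
Qed.

Lemma card_isupp_eq n h : (1 <= h <= k0)%N ->
  #|[set i : Windex k0 n | #|isupp i| == h]%SET| = ('C(n, h) * c h (k0 - h))%N.
Proof.
case: h => // h /= hh.
pose f (q : mindex n h.+1 * 'I_(c h.+1 (k0 - h.+1))) : Windex k0 n :=
  existT (fun k : 'I_k0 => (mindex n k.+1 * 'I_(c k.+1 (k0 - k.+1)))%type) (Ordinal hh) q.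
have finj : injective f.
  by move=> p q /eqP; rewrite -/(Tagged _ _) eq_Tagged => /eqP.
rewrite -card_mindex -[X in (_ * X)%N]card_ord -card_prod -cardsT -(card_imset _ finj).
apply: eq_card => i; rewrite inE card_isupp; apply/eqP/imsetP; last by case=> q _ ->.
case: i => k q /= [ek].
have e : k = Ordinal hh by apply: val_inj.
by subst k; exists q; rewrite ?inE.
Qed.

(** Here c(k, k0 - k) is the binomial coefficient of k0 - 1 over k0 - k, so the sum over k is
    Vandermonde's; its term k = 0 vanishes. *)
Lemma card_Windex n : (0 < k0)%N -> #|Windex k0 n| = c n k0.
Proof.
move=> hk; rewrite card_tagged sumnE big_map big_enum /=.
under eq_bigr do rewrite card_prod card_mindex card_ord.
have -> : c n k0 = 'C(n + (k0 - 1), k0) by rewrite /c; congr 'C(_, _); lia.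
rewrite -binomial.Vandermonde big_ord_recl /= bin0 mul1n subn0 bin_small ?add0n; last by lia.
apply: eq_bigr => k _; rewrite /bump /= add1n /c; congr (_ * 'C(_, _))%N.
by have := ltn_ord k; lia.
Qed.

End WebIndices.

(** * Restriction of the web to fewer variables *)

Section Projections.
Variable R : realType.
Local Notation C := (Cplx R).
Variables (n h : nat) (J : mindex n h).

Lemma coord_proj_linear (a : C) (v x : 'rV[C]_n) :
  coord_proj J (a *: v + x) = a *: coord_proj J v + coord_proj J x.
Proof. by apply/rowP => j; rewrite !mxE. Qed.

Lemma coord_proj_near (x : 'rV[C]_n) (P : 'rV[C]_h -> Prop) :
  (\forall z \near coord_proj J x, P z) -> \forall y \near x, P (coord_proj J y).
Proof.
move=> /nbhs_ballP[e he H]; apply/nbhs_ballP; exists e => // y hy.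
by case: hy => h1 h2; apply: H; split=> // i j; rewrite !mxE; exact: h2.
Qed.

(** The difference quotients coincide by linearity of the projection, so no chain rule
    intervenes. *)
Lemma derive_coord_proj (u : 'rV[C]_h -> C) (x v : 'rV[C]_n) :
  'D_v (u \o coord_proj J) x = 'D_(coord_proj J v) u (coord_proj J x).
Proof.
have e : (fun t : C => t^-1 *: (((u \o coord_proj J) \o shift x) (t *: v)
      - (u \o coord_proj J) x)) =
    (fun t : C => t^-1 *: ((u \o shift (coord_proj J x)) (t *: coord_proj J v)
      - u (coord_proj J x))).
  by apply/funext => t /=; rewrite coord_proj_linear.
by rewrite /derive e.
Qed.

Lemma partial_coord_proj (u : 'rV[C]_h -> C) (x : 'rV[C]_n) (j : 'I_h) :
  partial (u \o coord_proj J) (tnth (val J) j) x = partial u j (coord_proj J x).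
Proof.
rewrite /partial derive_coord_proj; congr derive; apply/rowP => k.
by rewrite !mxE /= (inj_eq (@mindex_inj _ _ J)).
Qed.

Lemma partial_coord_proj_out (u : 'rV[C]_h -> C) (x : 'rV[C]_n) (l : 'I_n) :
  l \notin mset J -> partial (u \o coord_proj J) l x = 0.
Proof.
move=> hl; rewrite /partial derive_coord_proj.
have -> : coord_proj J (delta_mx 0 l) = 0 :> 'rV[C]_h.
  apply/rowP => k; rewrite !mxE /=; case: eqP => // e.
  by move: hl; rewrite -e imset_f.
rewrite /derive (_ : (fun t : C => _) = cst 0) ?lim_cst //.
apply/funext => t; rewrite /= scaler0 add0r subrr; exact: scaler0.
Qed.

End Projections.

Section Gradients.
Variables (R : realType) (k0 : nat) (E : web_family R k0).
Local Notation C := (Cplx R).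
Hypothesis hk0 : (0 < k0)%N.

Definition pgrad n (x : 'rV[C]_n) (i : Windex k0 n) : 'rV[C]_n := grad (Wfi E n i) x.

Lemma Wfi_wlift n h (J : mindex n h) i :
  Wfi E n (wlift J i) = Wfi E h i \o coord_proj J.
Proof. by apply/funext => x; rewrite /Wfi /= coord_proj_mcomp. Qed.

Lemma Wfi_wliftE n h (J : mindex n h) i x :
  Wfi E n (wlift J i) x = Wfi E h i (coord_proj J x).
Proof. by rewrite Wfi_wlift. Qed.

Lemma partial_supp n (i : Windex k0 n) l x :
  l \notin isupp i -> partial (Wfi E n i) l x = 0.
Proof. exact: partial_coord_proj_out. Qed.

Lemma pgrad_supp n (x : 'rV[C]_n) i l : l \notin isupp i -> pgrad x i 0 l = 0.
Proof. by move=> hl; rewrite mxE partial_supp. Qed.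

Lemma pgrad_wlift n h (J : mindex n h) (x : 'rV[C]_n) i j :
  pgrad x (wlift J i) 0 (tnth (val J) j) = pgrad (coord_proj J x) i 0 j.
Proof. by rewrite !mxE Wfi_wlift partial_coord_proj. Qed.

Lemma big_mset (T : Type) (idx : T) (op : Monoid.com_law idx) n h (J : mindex n h)
    (F : 'I_n -> T) : (forall l, l \notin mset J -> F l = idx) ->
  \big[op/idx]_l F l = \big[op/idx]_j F (tnth (val J) j).
Proof.
move=> hF; rewrite (bigID (mem (mset J))) /= [X in op _ X]big1 // Monoid.mulm1.
by rewrite big_imset //= => i j _ _; exact: mindex_inj.
Qed.

Lemma mval_wlift n h (J : mindex n h) (x : 'rV[C]_n) i (e : 'I_n -> nat) :
  (forall l, l \notin mset J -> e l = 0%N) ->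
  mval (pgrad x (wlift J i)) e =
  mval (pgrad (coord_proj J x) i) (fun j => e (tnth (val J) j)).
Proof.
move=> he; rewrite /mval (@big_mset _ _ _ _ _ J) => [|l hl]; last by rewrite he ?expr0.
by apply: eq_bigr => j _; rewrite pgrad_wlift.
Qed.

Lemma mval_wlift_out n h (J : mindex n h) (x : 'rV[C]_n) i (e : 'I_n -> nat) l :
  l \notin mset J -> e l != 0%N -> mval (pgrad x (wlift J i)) e = 0.
Proof.
move=> hl hel; rewrite /mval (bigD1 l) //= pgrad_supp ?expr0n ?(negbTE hel) ?mul0r //.
by apply: contra hl; apply/fintype.subsetP; exact: isupp_wlift_sub.
Qed.

Definition push n h (J : mindex n h) (a : Windex k0 h -> C) (i : Windex k0 n) : C :=
  \sum_i' (wlift J i' == i)%:R * a i'.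

Lemma push_wlift n h (J : mindex n h) a i : push J a (wlift J i) = a i.
Proof.
rewrite /push (bigD1 i) //= eqxx mul1r big1 ?addr0 // => j hj.
by rewrite (inj_eq (@wlift_inj k0 _ _ J)) (negbTE hj) mul0r.
Qed.

Lemma push_out n h (J : mindex n h) a i : ~~ (isupp i \subset mset J) -> push J a i = 0.
Proof.
move=> hi; rewrite /push big1 // => j _; case: eqP => [e|_]; last by rewrite mul0r.
by move: hi; rewrite -e isupp_wlift_sub.
Qed.

Lemma msum_push n h (J : mindex n h) (x : 'rV[C]_n) a e :
  msum (pgrad x) (push J a) e = \sum_i a i * mval (pgrad x (wlift J i)) e.
Proof.
rewrite /msum /push; under eq_bigr do rewrite mulr_suml.
rewrite exchange_big /=; apply: eq_bigr => i' _.
rewrite (bigD1 (wlift J i')) //= eqxx mul1r big1 ?addr0 // => i hi.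
by rewrite eq_sym (negbTE hi) !mul0r.
Qed.

Lemma msum_push_in n h (J : mindex n h) (x : 'rV[C]_n) a (e : 'I_n -> nat) :
  (forall l, l \notin mset J -> e l = 0%N) ->
  msum (pgrad x) (push J a) e =
  msum (pgrad (coord_proj J x)) a (fun j => e (tnth (val J) j)).
Proof. by move=> he; rewrite msum_push; apply: eq_bigr => i _; rewrite mval_wlift. Qed.

Lemma msum_push_out n h (J : mindex n h) (x : 'rV[C]_n) a (e : 'I_n -> nat) l :
  l \notin mset J -> e l != 0%N -> msum (pgrad x) (push J a) e = 0.
Proof.
move=> hl he; rewrite msum_push big1 // => i _.
by rewrite (mval_wlift_out _ _ hl he) mulr0.
Qed.

(** A relation downstairs, extended by zero, is a relation upstairs: monomials with a variable
    outside [J] receive nothing, the others keep their coefficients. *)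
Lemma col_indep_proj n h (J : mindex n h) (x : 'rV[C]_n) k :
  col_indep (pgrad x) k -> col_indep (pgrad (coord_proj J x)) k.
Proof.
move=> H a ha i; rewrite -(push_wlift J); apply: H => L hL.
case: (boolP [exists l, (l \notin mset J) && (L l != 0%N :> nat)]) => [/existsP[l /andP[h1 h2]]|].
  exact: msum_push_out h1 h2.
rewrite negb_exists => /forallP hout.
have he l : l \notin mset J -> L l = 0%N :> nat.
  by move=> hl; have := hout l; rewrite hl /= negbK => /eqP.
rewrite msum_push_in //.
have hs : (\sum_j (L (tnth (val J) j) : nat))%N = k.
  by apply: etrans (mon_sum hL); apply/esym/(@big_mset _ _ _ _ _ J).
have := ha _ (expo_mon hs); rewrite /msum => e.
by rewrite -[RHS]e; apply: eq_bigr => i' _; rewrite mval_expo.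
Qed.

Lemma ordinary_atP n (x : 'rV[C]_n) : (0 < n)%N ->
  ordinary_at (Wfi E n) x <-> col_indep (pgrad x) k0.
Proof.
move=> hn; rewrite (@ordinaryP _ _ _ (pgrad x) k0 hn hk0); last by rewrite card_Windex // card_mon.
have e h : Pmx (Wfi E n) h x = Vmx (pgrad x) h.
  by apply/matrixP => r i; rewrite !mxE; apply: eq_bigr => l _; rewrite mxE.
by split=> H m hm; [rewrite -e|rewrite e]; rewrite (H m hm) card_mon.
Qed.

(** Projecting to exactly the variables of [L] keeps ordinarity, hence spanning in degree m; the
    combination found there is extended by zero, which yields the control of supports. *)
Lemma pgrad_delta n (x : 'rV[C]_n) m (L : {ffun 'I_n -> 'I_m.+1}) :
    col_indep (pgrad x) k0 -> (1 <= m <= k0)%N -> L \in mon n m ->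
  exists a : Windex k0 n -> C,
    (forall i, ~~ (isupp i \subset msupp L) -> a i = 0) /\
    forall M, M \in mon n m -> msum (pgrad x) a (fun l => M l) = (M == L)%:R.
Proof.
move=> H /andP[hm hmk] hL.
have [J hJ] := mindex_of_set (msupp L).
have h0 : (0 < #|msupp L|)%N.
  rewrite card_gt0; apply/negP => /eqP e; move: hm; have := mon_sum hL; rewrite big1 => [<- //|l _].
  by apply/eqP; apply: contraT => hl; have : l \in msupp L by [rewrite inE]; rewrite e inE.
have H' := @col_indep_proj n _ J x k0 H.
have hrow : row_indep (pgrad (coord_proj J x)) k0.
  apply/row_indepP; have /col_indepP -> := H'.
  by rewrite card_Windex // card_mon.
have hrowm := row_indep_leq (Ordinal h0) hmk hrow.
have sumJ (M : {ffun 'I_n -> 'I_m.+1}) : M \in mon n m ->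
    (forall l, l \notin mset J -> M l = 0%N :> nat) ->
    (\sum_j (M (tnth (val J) j) : nat))%N = m.
  by move=> hM he; apply: etrans (mon_sum hM); apply/esym/(@big_mset _ _ _ _ _ J).
have outL l : l \notin mset J -> L l = 0%N :> nat.
  by rewrite hJ inE negbK => /eqP.
have hsL := sumJ L hL outL.
have [a ha] := row_indep_delta hrowm (expo_mon hsL).
exists (push J a); split=> [i hi|M hM]; first by rewrite push_out ?hJ.
case: (boolP [exists l, (l \notin mset J) && (M l != 0%N :> nat)]) => [/existsP[l /andP[h1 h2]]|].
  rewrite (msum_push_out _ _ h1 h2); case: eqP => // e.
  by move: h2; rewrite e outL.
rewrite negb_exists => /forallP hout.
have he l : l \notin mset J -> M l = 0%N :> nat.
  by move=> hl; have := hout l; rewrite hl /= negbK => /eqP.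
have hsM := sumJ M hM he.
rewrite msum_push_in //.
have := ha _ (expo_mon hsM).
have -> : (expo m (fun j => M (tnth (val J) j)) == expo m (fun j => L (tnth (val J) j))) = (M == L).
  apply/eqP/eqP => [e|-> //]; apply: mon_inj => l.
  case: (boolP (l \in mset J)) => hl; last by rewrite he ?outL.
  case/imsetP: hl => j _ ->.
  have := congr1 (fun g : {ffun 'I_#|msupp L| -> 'I_m.+1} => (g j : nat)) e.
  by rewrite /= (expoE _ hsM) (expoE _ hsL).
move=> <-; apply: eq_bigr => i _; by rewrite mval_expo.
Qed.

(* Otherwise the [k0]-th power of the [i]-th form would be a combination of
   those with support in [isupp i :\ l], contradicting independence. *)
Lemma pgrad_neq0 n (x : 'rV[C]_n) i l :
  col_indep (pgrad x) k0 -> l \in isupp i -> pgrad x i 0 l != 0.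
Proof.
move=> H hl; apply/eqP => p0.
pose S := isupp i :\ l.
have /choice[d hd] : forall L : {ffun 'I_n -> 'I_k0.+1}, exists b : Windex k0 n -> C,
    L \in mon n k0 -> (forall i, ~~ (isupp i \subset msupp L) -> b i = 0) /\
      forall M, M \in mon n k0 -> msum (pgrad x) b (fun l => M l) = (M == L)%:R.
  move=> L; case: (boolP (L \in mon n k0)) => hL; last by exists (fun=> 0).
  by have [|b hb] := pgrad_delta H _ hL; [rewrite hk0 leqnn|exists b].
pose a i' := \sum_(L in mon n k0 | msupp L \subset S) mval (pgrad x i) (fun l => L l) * d L i'.
have aE M : M \in mon n k0 -> msum (pgrad x) a (fun l => M l) = mval (pgrad x i) (fun l => M l).
  move=> hM; rewrite msum_sum; case: (boolP (msupp M \subset S)) => hMS.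
    rewrite (bigD1 M) /=; last by rewrite hM.
    rewrite (hd M hM).2 // eqxx mulr1 big1 ?addr0 // => L /andP[/andP[hL _] hLM].
    by rewrite (hd L hL).2 // eq_sym (negbTE hLM) mulr0.
  rewrite big1 => [|L /andP[hL hLS]]; last first.
    rewrite (hd L hL).2 //; case: eqP => [e|]; last by rewrite mulr0.
    by move: hMS; rewrite e hLS.
  case/fintype.subsetPn: hMS => l'; rewrite inE => hl'.
  rewrite !inE negb_and negbK => hl2; apply/esym.
  rewrite /mval (bigD1 l') //=.
  have -> : pgrad x i 0 l' = 0.
    by case/orP: hl2 => [/eqP -> //|]; exact: pgrad_supp.
  by rewrite expr0n (negbTE hl') mul0r.
have := H (fun i' => (-1) * (i' == i)%:R + a i') _ i; rewrite eqxx mulr1.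
have -> : a i = 0.
  rewrite /a big1 // => L /andP[hL hLS]; rewrite (hd L hL).1 ?mulr0 //.
  apply/negP => /fintype.subsetP /(_ l hl) /(fintype.subsetP hLS).
  by rewrite !inE eqxx.
rewrite addr0 => h; have : (-1 : C) = 0.
  apply: h => L hL; rewrite msum_linear aE //.
  rewrite {1}/msum (bigD1 i) //= eqxx mul1r big1 ?addr0 ?mulN1r ?addNr // => j hj.
  by rewrite (negbTE hj) mul0r.
by move/eqP; rewrite oppr_eq0 oner_eq0.
Qed.

Lemma free2P (K : fieldType) (V : vectType K) (a b : V) :
  reflect (forall s t, s *: a + t *: b = 0 -> s = 0 /\ t = 0) (free [:: a; b]).
Proof.
apply: (iffP (freeP (X := in_tuple [:: a; b]))) => H.
  move=> s t e; pose k (i : 'I_2) := if i == ord0 then s else t.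
  have := H k; rewrite /= !big_ord_recl big_ord0 addr0 /= => /(_ e) hk.
  by split; [exact: (hk ord0)|exact: (hk (lift ord0 ord0))].
move=> k /=; rewrite !big_ord_recl big_ord0 addr0 /= => /H[h1 h2] i.
case: (unliftP ord0 i) => [j ->|-> //].
by rewrite (ord1 j).
Qed.

Lemma free2_proj (K : fieldType) n h (f : 'I_h -> 'I_n) (a b : 'rV[K]_n) (a' b' : 'rV[K]_h) :
  (forall j, a 0 (f j) = a' 0 j) -> (forall j, b 0 (f j) = b' 0 j) ->
  (forall l, l \notin codom f -> a 0 l = 0) -> (forall l, l \notin codom f -> b 0 l = 0) ->
  free [:: a; b] -> free [:: a'; b'].
Proof.
move=> ha hb ha0 hb0 /free2P H; apply/free2P => s t e.
suff : s *: a + t *: b = 0 by exact: H.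
apply/rowP => l; rewrite !mxE; case: (boolP (l \in codom f)) => hl.
  case/codomP: hl => j ->; rewrite ha hb.
  by move/rowP/(_ j): e; rewrite !mxE.
by rewrite ha0 // hb0 // !mulr0 addr0.
Qed.

(** Gradients of lifted first integrals vanish outside [J] and restrict to those downstairs, so
    pairwise independence descends. *)
Lemma Wdom_proj n h (J : mindex n h) (x : 'rV[C]_n) :
  Wdom E n x -> Wdom E h (coord_proj J x).
Proof.
move=> [h1 h2]; split=> [k hk J'|i j hij].
  by rewrite -coord_proj_mcomp; exact: h1.
have hij' : wlift J i != wlift J j by rewrite (inj_eq (@wlift_inj k0 _ _ J)).
have out i' l : l \notin codom (tnth (val J)) -> pgrad x (wlift J i') 0 l = 0.
  move=> hl; apply: pgrad_supp; apply: contra hl => hl.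
  have /imsetP[m _ ->] := fintype.subsetP (isupp_wlift_sub J i') l hl.
  exact: codom_f.
exact: (free2_proj (pgrad_wlift J x i) (pgrad_wlift J x j) (out i) (out j) (h2 _ _ hij')).
Qed.

Definition pullback n h (J : mindex n h) (F : Windex k0 h -> C -> C) (i : Windex k0 n) : C -> C :=
  if [pick i' | wlift J i' == i] is Some i' then F i' else fun=> 0.

Lemma pullback_wlift n h (J : mindex n h) F i : pullback J F (wlift J i) = F i.
Proof.
rewrite /pullback; case: pickP => [i' /eqP /wlift_inj -> //|/(_ i)].
by rewrite eqxx.
Qed.

Lemma pullback_out n h (J : mindex n h) F i :
  ~~ (isupp i \subset mset J) -> pullback J F i = fun=> 0.
Proof.
move=> hi; rewrite /pullback; case: pickP => // i' /eqP e.
by move: hi; rewrite -e isupp_wlift_sub.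
Qed.

Lemma pullback_rel n h (J : mindex n h) (x : 'rV[C]_n) F :
  abelian_rel (Wfi E h) (coord_proj J x) F -> abelian_rel (Wfi E n) x (pullback J F).
Proof.
move=> [hF [a ha]]; split=> [i|].
  case: (boolP (isupp i \subset mset J)) => hi.
    have [i' ->] := wlift_factor hi.
    by rewrite pullback_wlift Wfi_wliftE.
  rewrite pullback_out //; near=> z; exact: differentiable_cst.
exists a; have := coord_proj_near ha; apply: filterS => y <-.
rewrite (bigID (fun i => isupp i \subset mset J)) /= [X in _ + X]big1 ?addr0 => [|i hi]; last first.
  by rewrite pullback_out.
rewrite (eq_bigl (fun i => i \in codom (wlift J))) => [|i]; last first.
  apply/idP/codomP => [/wlift_factor[i' ->]|[i' ->]]; first by exists i'.
  exact: isupp_wlift_sub.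
rewrite (eq_bigl (mem (wlift J @: [set: Windex k0 h])%SET)) => [|i]; last first.
  by apply/codomP/imsetP => [[i' ->]|[i' _ ->]]; exists i'.
rewrite big_imset /=; last by move=> i j _ _; exact: wlift_inj.
apply: eq_big => [i|i _]; first by rewrite inE.
by rewrite pullback_wlift Wfi_wliftE.
Unshelve. all: by end_near. Qed.

End Gradients.

(** * Counting monomials by support *)

Section Counting.

Definition ext n h (J : mindex n h) (e : 'I_h -> nat) (l : 'I_n) : nat :=
  (\sum_j (tnth (val J) j == l) * e j)%N.

Lemma ext_in n h (J : mindex n h) e j : ext J e (tnth (val J) j) = e j.
Proof.
rewrite /ext (bigD1 j) //= eqxx mul1n big1 ?addn0 // => k hk.
by rewrite (inj_eq (@mindex_inj _ _ J)) (negbTE hk).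
Qed.

Lemma ext_out n h (J : mindex n h) e l : l \notin mset J -> ext J e l = 0%N.
Proof.
move=> hl; rewrite /ext big1 // => j _; case: eqP => // e1.
by move: hl; rewrite -e1 imset_f.
Qed.

Lemma sum_ext n h (J : mindex n h) e : (\sum_l ext J e l = \sum_j e j)%N.
Proof.
rewrite (@big_mset _ _ _ _ _ J) => [|l]; last exact: ext_out.
by apply: eq_bigr => j _; rewrite ext_in.
Qed.

Definition full_mon (m h : nat) : nat := #|[set L in mon h m | msupp L == [set: 'I_h]]%SET|.

Lemma card_mon_msupp n h m (J : mindex n h) :
  #|[set L in mon n m | msupp L == mset J]%SET| = full_mon m h.
Proof.
pose f (L : {ffun 'I_h -> 'I_m.+1}) := expo m (ext J (fun j => L j)).
have fs (L : {ffun 'I_h -> 'I_m.+1}) : L \in mon h m -> (\sum_l ext J (fun j => L j) l)%N = m.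
  by move=> /mon_sum hL; rewrite sum_ext.
have fE L l : L \in mon h m -> f L l = ext J (fun j => L j) l :> nat.
  by move=> hL; rewrite expoE // fs.
rewrite /full_mon -(@card_in_imset _ _ f); last first.
  move=> A B; rewrite inE => /andP[hA _]; rewrite inE => /andP[hB _] e.
  apply: mon_inj => j.
  have := congr1 (fun g : {ffun 'I_n -> 'I_m.+1} => (g (tnth (val J) j) : nat)) e.
  by rewrite /= !fE ?ext_in.
apply: eq_card => L; apply/idP/imsetP.
  rewrite inE => /andP[hL /eqP hs].
  have out l : l \notin mset J -> L l = 0%N :> nat.
    by rewrite -hs inE negbK => /eqP.
  have hs' : (\sum_j (L (tnth (val J) j) : nat))%N = m.
    by apply: etrans (mon_sum hL); apply/esym/(@big_mset _ _ _ _ _ J).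
  exists (expo m (fun j => L (tnth (val J) j) : nat)).
    rewrite inE expo_mon //=; apply/eqP/setP => j; rewrite !inE expoE //.
    have : tnth (val J) j \in msupp L by rewrite hs imset_f.
    by rewrite inE.
  apply: mon_inj => l; rewrite fE ?expo_mon //.
  case: (boolP (l \in mset J)) => [/imsetP[j _ ->]|hl].
    by rewrite ext_in expoE.
  by rewrite out // ext_out.
case=> L' hL0 ->; have /andP[hL' /eqP hs] : (L' \in mon h m) && (msupp L' == [set: 'I_h]%SET) by rewrite inE in hL0.
rewrite inE expo_mon ?fs //=; apply/eqP/setP => l.
case: (boolP (l \in mset J)) => [/imsetP[j _ ->]|hl].
  rewrite inE fE // ext_in.
  have : j \in msupp L' by rewrite hs finset.in_setT.
  by rewrite inE.
by rewrite inE fE // ext_out.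
Qed.

Lemma card_mon_supp_eq n h m :
  #|[set L in mon n m | #|msupp L| == h]%SET| = ('C(n, h) * full_mon m h)%N.
Proof.
rewrite -sum1_card (partition_big (@msupp n m) (fun S : {set 'I_n} => #|S| == h)) /=; last first.
  by move=> L; rewrite inE => /andP[].
rewrite (eq_bigr (fun=> full_mon m h)) => [|S /eqP hS].
  rewrite sum_nat_const; congr (_ * _)%N.
  have := card_draws 'I_n h; rewrite card_ord => <-.
  by apply: eq_card => S; rewrite !inE.
have [J hJ] := mindex_of_set S.
rewrite -hS -(card_mon_msupp m J) -sum1_card; apply: eq_bigl => L.
rewrite !inE hJ; case: (_ == m) => //=.
by case: (msupp L =P S) => [->|]; rewrite ?hS ?eqxx ?andbF.
Qed.

Lemma card_le_split (T : finType) (P : pred T) (f : T -> nat) h : (0 < h)%N ->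
  #|[set t | P t & (f t <= h)%N]%SET| =
  (#|[set t | P t & (f t <= h.-1)%N]%SET| + #|[set t | P t & f t == h]%SET|)%N.
Proof.
move=> hh; rewrite -(cardsID [set t | (f t <= h.-1)%N]%SET); congr (_ + _)%N.
  by apply: eq_card => t; rewrite !inE; case: (P t) => //=; lia.
by apply: eq_card => t; rewrite !inE; case: (P t) => //=; lia.
Qed.

End Counting.

(** * Filtration of the abelian relations by order of vanishing *)

Section AbelianRelations.
Variable R : realType.
Local Notation C := (Cplx R).
Variables (n : nat) (I : finType) (u : I -> 'rV[C]_n -> C) (x : 'rV[C]_n).
Implicit Types (F G : I -> C -> C).

Lemma const_germ_linear (f g : C -> C) z (a : C) :
  const_germ f z -> const_germ g z -> const_germ (fun w => a * f w + g w) z.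
Proof.
move=> [b hb] [d hd]; exists (a * b + d); near=> w.
have -> : f w = b by near: w.
by have -> : g w = d by near: w.
Unshelve. all: by end_near. Qed.

Lemma const_germ0 z : const_germ (fun=> 0 : C) z.
Proof. by exists 0; apply: (@nearW _ (nbhs z)) => w. Qed.

Lemma subsp_abelian_rel : subsp (abelian_rel u x).
Proof.
split.
  split=> [i|]; first by apply: (@nearW _ (nbhs (u i x))) => z; exact: differentiable_cst.
  by exists 0; apply: (@nearW _ (nbhs x)) => y; rewrite big1.
move=> a F G [hF [b hb]] [hG [d hd]]; split=> [i|].
  exact: (hol_germ_linear a (hF i) (hG i)).
exists (a * b + d); near=> y.
have <- : \sum_i F i (u i y) = b by near: y.
have <- : \sum_i G i (u i y) = d by near: y.
by rewrite mulr_sumr -big_split.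
Unshelve. all: by end_near. Qed.

Lemma subsp_trivial_rel : subsp (trivial_rel u x).
Proof.
by split=> [i|a F G hF hG i]; [exact: const_germ0|exact: const_germ_linear].
Qed.

Definition tau F (j : nat) (i : I) : C := tcoef (F i) (u i x) j.

Lemma tau_linear F G (a : C) j i : abelian_rel u x F -> abelian_rel u x G ->
  tau (a *: F + G) j i = a * tau F j i + tau G j i.
Proof. by move=> [hF _] [hG _]; exact: (tcoef_linear a j (hF i) (hG i)). Qed.

Lemma tau_const F j i : abelian_rel u x F -> (0 < j)%N ->
  const_germ (F i) (u i x) -> tau F j i = 0.
Proof. by move=> [hF _] hj /(tcoef_const_germ (hF i)) /(_ j hj). Qed.

Lemma tau0 j i : (0 < j)%N -> tau (fun=> fun=> 0) j i = 0.
Proof.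
move=> hj; apply: tau_const => //; last exact: const_germ0.
exact: (subsp_abelian_rel.1).
Qed.

(** The coefficient of order 0 is left free because components count modulo constants. *)
Definition flat (S : set (I -> C -> C)) (m : nat) : set (I -> C -> C) :=
  [set F | S F /\ forall j i, (1 <= j <= m)%N -> tau F j i = 0].

Lemma subsp_flat S m : subsp S -> S `<=` abelian_rel u x -> subsp (flat S m).
Proof.
move=> hS hSA; split.
  split=> [|j i /andP[hj _]]; first exact: subsp0.
  exact: tau0.
move=> a F G [hF1 hF2] [hG1 hG2]; split=> [|j i hj]; first exact: hS.2.
by rewrite tau_linear ?hF2 ?hG2 ?mulr0 ?addr0 //; exact: hSA.
Qed.

Hypothesis hu : forall i, differentiable (u i) x.

Lemma derive_sum_partial i (v : 'rV[C]_n) :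
  'D_v (u i) x = \sum_l v 0 l * grad (u i) x 0 l.
Proof.
rewrite deriveE // {1}(row_sum_delta v) linear_sum /=.
by apply: eq_bigr => l _; rewrite linearZ /= mxE /partial deriveE.
Qed.

Lemma tau_relation F m : abelian_rel u x F -> (0 < m)%N ->
  (forall j i, (1 <= j < m)%N -> tau F j i = 0) ->
  relation (fun i => grad (u i) x) m (tau F m).
Proof.
move=> hF hm hj L hL.
have H := leading_term hu hF hm (fun i j h => hj j i h).
have H' : forall v : 'rV[C]_n,
    \sum_i tau F m i * (\sum_l v 0 l * grad (u i) x 0 l) ^+ m = 0.
  move=> v; rewrite -[RHS](H v); apply: eq_bigr => i _.
  by rewrite derive_sum_partial.
(* The list of variables in which each [l] occurs [L l] times; polarization along it yields the
   monomial [L]. *)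
pose s := flatten [seq nseq (L l) l | l <- enum 'I_n].
have hs : size s = m.
  rewrite /s size_flatten /shape -map_comp sumnE big_map big_enum /=.
  apply: etrans (mon_sum hL); apply: eq_bigr => l _; exact: size_nseq.
rewrite -[RHS](polarization H' hs); apply: eq_bigr => i _; congr (_ * _).
rewrite /s big_flatten big_map big_enum /=; apply: eq_bigr => l _.
by rewrite big_nseq -Monoid.iteropE.
Qed.

(** Beyond order k the powers stay independent, so the remaining coefficients vanish one order after
    the other. This is why the filtration ends at [k0]. *)
Lemma trivial_of_tau k F : (forall i, grad (u i) x != 0) ->
  col_indep (fun i => grad (u i) x) k -> abelian_rel u x F ->
  (forall j i, (1 <= j <= k)%N -> tau F j i = 0) -> trivial_rel u x F.
Proof.
move=> hp hk hF hj i.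
apply/(tcoef_const_germ (hF.1 i)) => j hj0; rewrite -/(tau F j i).
move: j i hj0; elim/ltn_ind => j IH i hj0.
case: (leqP j k) => hjk; first by apply: hj; rewrite hj0.
apply: (col_indep_geq (ltnW hjk) hp hk).
by apply: tau_relation => // j' i' /andP[h1 h2]; exact: IH.
Qed.

End AbelianRelations.

(** [rank_at] divides by [trivial_rel], which is not given as a subset of the abelian relations,
    whereas chains of quotients require nested subspaces. *)
Lemma quot_dim_setI (K : fieldType) (V : lmodType K) (S T : set V) m :
  subsp S -> quot_dim S T m <-> quot_dim S (S `&` T) m.
Proof.
move=> hS; split=> -[e [h1 h2 h3]]; exists e; split=> //.
- move=> v hv; have [a ha] := h2 v hv; exists a; split => //.
  by apply: subspB => //; apply: subsp_sum => // j _; exact: subspZ.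
- by move=> a [_ /h3].
- by move=> v /h2[a [_ ha]]; exists a.
move=> a ha; apply: h3; split => //.
by apply: subsp_sum => // j _; exact: subspZ.
Qed.

Lemma subsp_lin_span (K : fieldType) (V : lmodType K) (S : set V) : subsp (lin_span S).
Proof.
split.
  exists 0%N, (fun=> 0), (fun=> 0); split=> [[]//|]; by rewrite big_ord0.
move=> a u v [m [b [e [h1 ->]]]] [p [d [f [h2 ->]]]].
exists (m + p)%N, (fun j => match fintype.split j with inl i => a * b i | inr k => d k end),
  (fun j => match fintype.split j with inl i => e i | inr k => f k end).
split=> [j|]; first by case: fintype.splitP.
rewrite big_split_ord /= scaler_sumr; congr (_ + _); apply: eq_bigr => j _.
  by rewrite (unsplitK (inl j)) scalerA.
by rewrite (unsplitK (inr j)).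
Qed.

Lemma sub_lin_span (K : fieldType) (V : lmodType K) (S : set V) : S `<=` lin_span S.
Proof.
move=> v hv; exists 1%N, (fun=> 1), (fun=> v); split=> //.
by rewrite big_ord1 scale1r.
Qed.

Lemma lin_span_sub (K : fieldType) (V : lmodType K) (S T : set V) :
  subsp T -> S `<=` T -> lin_span S `<=` T.
Proof.
move=> hT hST _ [m [a [e [h ->]]]]; apply: subsp_sum => // j _.
by apply: subspZ => //; exact: hST.
Qed.

(** * The filtration at an ordinary point *)

Section AtPoint.
Variables (R : realType) (k0 : nat) (E : web_family R k0).
Local Notation C := (Cplx R).
Hypothesis hk0 : (2 <= k0)%N.
Hypothesis hE : balanced E.

Let k0_gt0 : (0 < k0)%N. Proof. exact: ltnW. Qed.

Definition ord_pt n (x : 'rV[C]_n) := Wdom E n x /\ col_indep (pgrad E x) k0.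

Lemma Wfi_diff n (x : 'rV[C]_n) : (2 <= n)%N -> Wdom E n x ->
  forall i, differentiable (Wfi E n i) x.
Proof. by move=> hn hx i; case: hE => _ _ /(_ n hn)[_ [_ h _ _]]; exact: h. Qed.

(** A condition on each component separately, easier to count than the span [abelian_le];
    [abelian_leE] identifies the two for h <= k0. *)
Definition sle n (x : 'rV[C]_n) h : set (Windex k0 n -> C -> C) :=
  [set F | abelian_rel (Wfi E n) x F /\
    forall i, ~~ (#|isupp i| <= h)%N -> const_germ (F i) (Wfi E n i x)].

Lemma sle_abelian n (x : 'rV[C]_n) h : sle x h `<=` abelian_rel (Wfi E n) x.
Proof. by move=> F []. Qed.

Lemma subsp_sle n (x : 'rV[C]_n) h : subsp (sle x h).
Proof.
have hA := subsp_abelian_rel (Wfi E n) x.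
split; first by split=> [|i _]; [exact: subsp0|exact: const_germ0].
move=> a F G [F1 F2] [G1 G2]; split=> [|i hi]; first exact: hA.2.
by apply: const_germ_linear; [exact: F2|exact: G2].
Qed.

Lemma sle_full n (x : 'rV[C]_n) h : (forall i : Windex k0 n, (#|isupp i| <= h)%N) ->
  sle x h = abelian_rel (Wfi E n) x.
Proof.
move=> H; apply/seteqP; split=> [F []//|F hF].
by split=> // i; rewrite H.
Qed.

Section Filtration.
Variables (n : nat) (x : 'rV[C]_n).
Hypothesis hn : (2 <= n)%N.
Hypothesis hx : ord_pt x.

Local Notation u := (Wfi E n).
Local Notation p := (pgrad E x).

Definition triv : set (Windex k0 n -> C -> C) := abelian_rel u x `&` trivial_rel u x.

Lemma subsp_triv : subsp triv.
Proof. by apply: subspI; [exact: subsp_abelian_rel|exact: subsp_trivial_rel]. Qed.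

Lemma triv_sle h : triv `<=` sle x h.
Proof. by move=> F [hF hT]; split=> // i _; exact: hT. Qed.

Lemma flat_last h : flat u x (sle x h) k0 = triv.
Proof.
apply/seteqP; split=> F.
  move=> [[hF _] hj]; split=> //.
  apply: (trivial_of_tau (Wfi_diff hn hx.1) _ hx.2 hF hj) => i.
  exact: (col_indep_neq0 i k0_gt0 hx.2).
move=> hF; split; first exact: triv_sle.
by move=> j i /andP[hj _]; apply: tau_const => //; [exact: hF.1|exact: hF.2].
Qed.

Lemma flat_tau_rel h m F : flat u x (sle x h) m F -> rel_le p (@isupp k0 n) m.+1 h (tau u x F m.+1).
Proof.
move=> [[hF hc] hj]; split; first exact: (tau_relation (Wfi_diff hn hx.1)).
by move=> i /hc hi; apply: tau_const.
Qed.

Lemma subsp_flat_sle h m : subsp (flat u x (sle x h) m).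
Proof. by apply: subsp_flat; [exact: subsp_sle|exact: sle_abelian]. Qed.

Lemma flat_sub h m : flat u x (sle x h) m.+1 `<=` flat u x (sle x h) m.
Proof.
move=> F [h1 h2]; split=> // j i /andP[hj hjm]; apply: h2.
by rewrite hj ltnW.
Qed.

Lemma flat0 h : flat u x (sle x h) 0 = sle x h.
Proof.
apply/seteqP; split=> F; first by case.
by split=> // j i; case: j.
Qed.

(** The map to coefficients of order m + 1 has the next step of the filtration as kernel, and the
    two hypotheses say that its image is [G]. *)
Lemma flat_step h m g (G : set (Windex k0 n -> C^o)) :
  (forall F, flat u x (sle x h) m F -> G (tau u x F m.+1)) ->
  (forall a, G a -> exists2 F, flat u x (sle x h) m F & tau u x F m.+1 = a) ->
  quot_dim G [set 0] g ->
  quot_dim (flat u x (sle x h) m) (flat u x (sle x h) m.+1) g.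
Proof.
move=> h1 h2; apply: (quot_dim_image (f := fun F => tau u x F m.+1)) => //.
- exact: subsp_flat_sle.
- by move=> a F G' [[hF _] _] [[hG _] _]; apply/funext => i; exact: tau_linear.
move=> F hF; split=> [[_ hj]|e].
  by apply/funext => i; apply: hj; rewrite leqnn.
case: hF => hF hj; split=> // j i /andP[j1]; rewrite leq_eqVlt => /predU1P[->|hjm].
  by rewrite e.
by apply: hj; rewrite j1.
Qed.

Lemma quot_dim_sle h (g : nat -> nat) :
  (forall m, (m < k0)%N -> quot_dim (flat u x (sle x h) m) (flat u x (sle x h) m.+1) (g m)) ->
  quot_dim (sle x h) triv (\sum_(m < k0) g m).
Proof.
move=> H; rewrite -(flat0 h) -(flat_last h).
apply: (@quot_dim_filtration _ _ (flat u x (sle x h))) => //.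
  exact: subsp_flat_sle.
exact: flat_sub.
Qed.

Lemma rel_dim h m : (1 <= m <= k0)%N ->
  exists2 d, quot_dim (rel_le p (@isupp k0 n) m h) [set 0] d &
    (#|[set L in mon n m | (#|msupp L| <= h)%N]%SET| + d = #|[set i : Windex k0 n | (#|isupp i| <= h)%N]%SET|)%N.
Proof.
move=> hm; apply: (quot_dim_rel_le (k0 := k0)) => //.
- exact: pgrad_supp.
- by move=> m' L hm' hL; exact: (pgrad_delta k0_gt0 hx.2 hm' hL).
Qed.

(* The graded pieces of the filtration by order of vanishing embed into the
   spaces of relations, whose dimensions add up to [rho n k0]. *)
Lemma lift_of_rank : rank_at u x (rho n k0) ->
  forall m a, (1 <= m <= k0)%N -> relation p m a ->
  exists F, [/\ abelian_rel u x F, forall j i, (1 <= j < m)%N -> tau u x F j i = 0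
    & forall i, tau u x F m i = a i].
Proof.
move=> hr m a /andP[hm hmk] ha.
have n0 : (0 < n)%N by apply: ltnW.
have hfull : sle x n = abelian_rel u x.
  by apply: sle_full => i; rewrite -[X in (_ <= X)%N](card_ord n) max_card.
have hr' : quot_dim (sle x n) triv (rho n k0).
  by rewrite hfull; exact: (@quot_dim_setI _ _ _ (trivial_rel u x) _ (subsp_abelian_rel u x)).1 hr.
pose G k : set (Windex k0 n -> C^o) := [set tau u x F k.+1 | F in flat u x (sle x n) k].
have hG k : G k `<=` rel_le p (@isupp k0 n) k.+1 n.
  by move=> _ [F hF <-]; exact: flat_tau_rel.
have subG k : subsp (G k).
  split.
    exists (fun=> fun=> 0); first exact: subsp0 (subsp_flat_sle n k).
    by apply/funext => i; exact: tau0.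
  move=> b _ _ [F hF <-] [F' hF' <-]; exists (b *: F + F').
    exact: (subsp_flat_sle n k).2.
  apply/funext => i; apply: tau_linear; [exact: hF.1.1|exact: hF'.1.1].
have hd k : exists d g, (k < k0)%N -> [/\ quot_dim (rel_le p (@isupp k0 n) k.+1 n) [set 0] d,
    (c n k.+1 + d = c n k0)%N, quot_dim (G k) [set 0] g & (g <= d)%N].
  case: (ltnP k k0) => hk; last by exists 0%N, 0%N.
  have [d h1 h2] := @rel_dim n k.+1 hk.
  have [g h3 h4] := quot_dim_sub (subsp_set0 _) (hG k) h1.
  exists d, g => _; split=> //.
  rewrite -(@card_Windex k0 n k0_gt0) -(@card_mon n k.+1 n0).
  have -> : #|Windex k0 n| = #|[set i : Windex k0 n | (#|isupp i| <= n)%N]%SET|.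
    by rewrite -cardsT; apply: eq_card => i; rewrite !inE -[X in (_ <= X)%N](card_ord n) max_card.
  rewrite -h2; congr (_ + _)%N; apply: eq_card => L; rewrite [RHS]inE.
  by rewrite -[X in (_ <= X)%N](card_ord n) max_card andbT.
have [d {}hd] := choice hd; have [g {}hd] := choice hd.
have hq : quot_dim (sle x n) triv (\sum_(k < k0) g k).
  apply: quot_dim_sle => k hk; have [_ _ h3 _] := hd k hk.
  apply: (flat_step _ _ h3) => [F hF|b [F hF <-]]; last by exists F.
  by exists F.
(* The left side is [rho n k0] by maximality of the rank, the right side by definition of [rho]. As
   each [g k] is at most [d k], equality follows term by term. *)
have hsum : (\sum_(k < k0) g k = \sum_(k < k0) d k)%N.
  rewrite (quot_dim_uniq subsp_triv hq hr') /rho big_add1 /= big_mkord.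
  by apply: eq_bigr => k _; have [_ h2 _ _] := hd k (ltn_ord k); lia.
have hgd k : (k < k0)%N -> g k = d k.
  move=> hk; have hle (j : 'I_k0) : (g j <= d j)%N by have [] := hd j (ltn_ord j).
  have [_ heq] := leqif_sum (fun (j : 'I_k0) (_ : true) => leqif_eq (hle j)).
  move: heq; rewrite hsum eqxx => /esym/forallP/(_ (Ordinal hk)) /=.
  by move/eqP.
have hm1 : (m.-1 < k0)%N by case: (m) hm hmk.
have [h1 _ h3 _] := hd m.-1 hm1.
have hsub : rel_le p (@isupp k0 n) m.-1.+1 n `<=` G m.-1.
  apply: (quot_dim_eq_sub (subsp_set0 _) (subG _) (hG _) _ h1).
    by move=> _ ->; exact: subsp0 (subG _).
  by rewrite -hgd.
have : G m.-1 a.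
  apply: hsub; rewrite prednK //; split=> // i.
  by rewrite -[X in (_ <= X)%N](card_ord n) max_card.
case=> F [[hF _] hj] e; exists F; split=> //.
  by move=> j i /andP[j1 j2]; apply: hj; rewrite j1 -ltnS prednK.
by move=> i; rewrite -[in LHS](prednK hm) -e.
Qed.

End Filtration.
End AtPoint.

(** * Abelian relations in few variables *)

Section Main.
Variables (R : realType) (k0 : nat) (E : web_family R k0).
Local Notation C := (Cplx R).
Hypothesis hk0 : (2 <= k0)%N.
Hypothesis hE : balanced E.
Hypothesis hmax : forall n, (2 <= n <= k0)%N -> Wmax_rank E n.

Let k0_gt0 : (0 < k0)%N. Proof. exact: ltnW. Qed.

Section Point.
Variables (n : nat) (x : 'rV[C]_n).
Hypothesis hn : (2 <= n)%N.
Hypothesis hx : ord_pt E x.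

Local Notation u := (Wfi E n).
Local Notation p := (pgrad E x).

Lemma ord_pt_proj h (J : mindex n h) : ord_pt E (coord_proj J x).
Proof. by split; [exact: Wdom_proj hx.1|exact: col_indep_proj hx.2]. Qed.

Lemma relation_proj h (J : mindex n h) m a : relation p m a ->
  (forall i, ~~ (isupp i \subset mset J) -> a i = 0) ->
  relation (pgrad E (coord_proj J x)) m (fun i => a (wlift J i)).
Proof.
move=> ha hout L hL.
have hs : (\sum_l ext J (fun j => L j) l)%N = m by rewrite sum_ext (mon_sum hL).
have := ha _ (expo_mon hs).
have -> : a = push J (fun i => a (wlift J i)).
  apply/funext => i; case: (boolP (isupp i \subset mset J)) => hi.
    by have [i' ->] := wlift_factor hi; rewrite push_wlift.
  by rewrite push_out // hout.
have -> : msum p (push J (fun i => a (wlift J i))) (fun l => expo m (ext J (fun j => L j)) l)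
    = msum p (push J (fun i => a (wlift J i))) (ext J (fun j => L j)).
  by apply: eq_bigr => i _; rewrite mval_expo.
rewrite msum_push_in => [<-|l]; last exact: ext_out.
apply: eq_bigr => i _; rewrite push_wlift; congr (_ * _).
by apply: eq_bigr => j _; rewrite ext_in.
Qed.

(** In one variable there is one first integral and one monomial of each degree, so the count leaves
    dimension 0. This settles single variables, where no rank is assumed. *)
Lemma relation_dim1 (y : 'rV[C]_1) m a : ord_pt E y -> (1 <= m <= k0)%N ->
  relation (pgrad E y) m a -> forall i, a i = 0.
Proof.
move=> hy hm ha i.
have [|d h1 h2] := quot_dim_rel_le (k0 := k0) (@pgrad_supp _ _ E 1 y) _ 1 hm.
  by move=> m' L hm' hL; exact: (pgrad_delta k0_gt0 hy.2 hm' hL).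
have hle (S : {set 'I_1}) : (#|S| <= 1)%N by rewrite -[X in (_ <= X)%N](card_ord 1) max_card.
have d0 : d = 0%N.
  move: h2; have -> : #|[set L in mon 1 m | (#|msupp L| <= 1)%N]%SET| = 1%N.
    have e : c 1 m = 1%N by rewrite /c addnC addn1 subn1 /= binn.
    rewrite -[RHS]e -card_mon //; apply: eq_card => L; rewrite [LHS]inE.
    by rewrite hle andbT.
  have -> : #|[set i : Windex k0 1 | (#|isupp i| <= 1)%N]%SET| = 1%N.
    have e : c 1 k0 = 1%N by rewrite /c addnC addn1 subn1 /= binn.
    rewrite -[RHS]e -(@card_Windex k0 1 k0_gt0) -cardsT; apply: eq_card => j.
    by rewrite !inE hle.
  by lia.
rewrite d0 in h1; have := quot_dim0_sub h1 => h.
have : rel_le (pgrad E y) (@isupp k0 1) m 1 a by split=> // j; rewrite hle.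
by move=> /h /= ->.
Qed.

Definition gen h : set (Windex k0 n -> C -> C) :=
  [set F | abelian_rel u x F /\
    exists J : {set 'I_n}, (#|J| <= h)%N /\ involves_only u (Wdom E n) x J F].

Lemma trivial_gen h F : abelian_rel u x F -> trivial_rel u x F -> gen h F.
Proof.
by move=> hF hT; split=> //; exists finset.set0; rewrite cards0; split=> // i l _ _; exact: hT.
Qed.

Lemma tau_pullback h (J : mindex n h) F j i : (0 < j)%N ->
  tau u x (pullback J F) j (wlift J i) = tau (Wfi E h) (coord_proj J x) F j i.
Proof. by move=> hj; rewrite /tau pullback_wlift Wfi_wliftE. Qed.

Lemma tau_pullback_out h (J : mindex n h) F j i : (0 < j)%N ->
  ~~ (isupp i \subset mset J) -> tau u x (pullback J F) j i = 0.
Proof.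
move=> hj hi; rewrite /tau pullback_out //.
exact: (tau0 u x i hj).
Qed.

(** The relation is projected to the variables [S], lifted there by maximality of the rank of the
    web in [#|S|] variables, and the abelian relation obtained is pulled back. *)
Lemma lift_relation_set (S : {set 'I_n}) m a : (#|S| <= k0)%N -> (1 <= m <= k0)%N ->
  relation p m a -> (forall i, ~~ (isupp i \subset S) -> a i = 0) ->
  exists F, [/\ gen #|S| F, forall j i, (1 <= j < m)%N -> tau u x F j i = 0
    & forall i, tau u x F m i = a i].
Proof.
move=> hS hm ha hout; have hm0 : (0 < m)%N by case/andP: hm.
have trivial_case : (forall i, a i = 0) ->
    exists F, [/\ gen #|S| F, forall j i, (1 <= j < m)%N -> tau u x F j i = 0
      & forall i, tau u x F m i = a i].
  move=> a0; exists 0; split.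
  - by apply: trivial_gen; [exact: subsp0 (subsp_abelian_rel u x)|exact: subsp0 (subsp_trivial_rel u x)].
  - by move=> j i /andP[hj _]; exact: tau0.
  - by move=> i; rewrite a0; exact: tau0.
have [J hJ] := mindex_of_set S.
have hout' i : ~~ (isupp i \subset mset J) -> a i = 0 by rewrite hJ; exact: hout.
have ha' := relation_proj ha hout'.
have hy := ord_pt_proj J.
case: (ltnP #|S| 2) => hS2.
  apply: trivial_case => i; case: (boolP (isupp i \subset S)) => hi; last exact: hout.
  have S1 : #|S| = 1%N.
    have := subset_leq_card hi; have := isupp_neq0 i; rewrite -card_gt0; lia.
  move: J hJ ha' hy hout'; rewrite S1 => J hJ ha' hy hout'.
  have [i' ->] := wlift_factor (J := J) (i := i) (ltac:(by rewrite hJ)).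
  exact: (relation_dim1 hy hm ha').
have hr : rank_at (Wfi E #|S|) (coord_proj J x) (rho #|S| k0).
  apply: hmax; first by rewrite hS2.
    exact: hy.1.
  by apply/ordinary_atP => //; [exact: ltnW|exact: hy.2].
have [F [hF hj hFm]] := lift_of_rank hk0 hE hS2 hy hr hm ha'.
exists (pullback J F); split.
- split; first exact: pullback_rel.
  exists S; split=> // i l hl [y _ hy'].
  rewrite pullback_out; first exact: const_germ0.
  apply: contra hy' => hi; rewrite partial_supp //.
  by apply: contra hl; rewrite -hJ; apply/fintype.subsetP.
- move=> j i hjm; have j0 : (0 < j)%N by case/andP: hjm.
  case: (boolP (isupp i \subset mset J)) => hi; last exact: tau_pullback_out.
  by have [i' ->] := wlift_factor hi; rewrite tau_pullback // hj.
move=> i; case: (boolP (isupp i \subset mset J)) => hi.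
  by have [i' ->] := wlift_factor hi; rewrite tau_pullback // hFm.
by rewrite tau_pullback_out // hout'.
Qed.

(** A first integral with more than h variables has one outside [J]; by [pgrad_neq0] the dependence
    on it is already visible at [x], which serves as witness. *)
Lemma gen_sle h : gen h `<=` sle E x h.
Proof.
move=> F [hF [J [hJ hi]]]; split=> // i hi2.
have [l hl1 hl2] : exists2 l, l \in isupp i & l \notin J.
  by apply/fintype.subsetPn; apply: contra hi2 => /subset_leq_card h1; exact: leq_trans h1 hJ.
apply: (hi i l hl2); exists x; first exact: hx.1.
by have := pgrad_neq0 k0_gt0 hx.2 hl1; rewrite mxE.
Qed.

Lemma subsp_span h : subsp (lin_span (gen h)).
Proof. exact: subsp_lin_span. Qed.

Lemma span_sle h : lin_span (gen h) `<=` sle E x h.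
Proof. by apply: lin_span_sub; [exact: subsp_sle|exact: gen_sle]. Qed.

Lemma tau_sum (T : finType) (F : T -> Windex k0 n -> C -> C) j i : (0 < j)%N ->
  (forall t, abelian_rel u x (F t)) ->
  tau u x (\sum_t F t) j i = \sum_t tau u x (F t) j i.
Proof.
move=> hj hF.
pose P (y : C) (G : Windex k0 n -> C -> C) := tau u x G j i = y /\ abelian_rel u x G.
suff [] : P (\sum_t tau u x (F t) j i) (\sum_t F t) by [].
apply: (big_rec2 P) => [|t y G _ [h1 h2]].
  by split; [exact: tau0|exact: subsp0 (subsp_abelian_rel u x)].
split; last by apply: subspD => //; exact: subsp_abelian_rel.
have e := tau_linear 1 j i (hF t) h2; rewrite scale1r mul1r h1 in e; exact: e.
Qed.

Lemma lift_relation_le h m a : (h <= k0)%N -> (1 <= m <= k0)%N ->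
  rel_le p (@isupp k0 n) m h a ->
  exists F, [/\ lin_span (gen h) F, forall j i, (1 <= j < m)%N -> tau u x F j i = 0
    & forall i, tau u x F m i = a i].
Proof.
move=> hh hm [ha hsup]; have hm0 : (0 < m)%N by case/andP: hm.
have hdl m' (L : {ffun 'I_n -> 'I_m'.+1}) (h1 : (1 <= m' <= k0)%N) (h2 : L \in mon n m') :=
  pgrad_delta k0_gt0 hx.2 h1 h2.
have hsup' i : (h < #|isupp i|)%N -> a i = 0 by rewrite ltnNge; exact: hsup.
have [A [A1 A2 A3 A4]] := relation_decomp (@pgrad_supp R k0 E n x) hdl
  (@isupp_neq0 k0 n) hm ha hsup'.
have hS (S : {set 'I_n}) : exists F, [/\ gen h F, forall j i, (1 <= j < m)%N -> tau u x F j i = 0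
    & forall i, tau u x F m i = A S i].
  case: (leqP #|S| h) => hSh.
    have [F [[hF1 [J [hJ1 hJ2]]] hF2 hF3]] := lift_relation_set (leq_trans hSh hh) hm (A1 S) (A2 S).
    exists F; split=> //; split=> //; exists J; split=> //; exact: leq_trans hJ1 hSh.
  exists 0; split.
  - by apply: trivial_gen; [exact: subsp0 (subsp_abelian_rel u x)|exact: subsp0 (subsp_trivial_rel u x)].
  - by move=> j i /andP[hj _]; exact: tau0.
  - by move=> i; rewrite A3 //; exact: tau0.
have [F hF] := choice hS.
have hFA S : abelian_rel u x (F S) by have [[? _] _ _] := hF S.
exists (\sum_S F S); split.
- apply: subsp_sum; first exact: subsp_span.
  by move=> S _; apply: sub_lin_span; have [] := hF S.
- move=> j i hj; have j0 : (0 < j)%N by case/andP: hj.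
  by rewrite tau_sum // big1 // => S _; have [_ h2 _] := hF S; exact: h2.
move=> i; rewrite tau_sum // A4; apply: eq_bigr => S _.
by have [_ _ h3] := hF S.
Qed.

(** Leading parts are removed order by order by [lift_relation_le]; what remains after order [k0] is
    trivial and lies in every [gen h]. *)
Lemma abelian_leE h : (h <= k0)%N -> abelian_le u (Wdom E n) x h = sle E x h.
Proof.
move=> hh; apply/seteqP; split; first exact: span_sle.
move=> F hF.
suff H m : (m <= k0)%N -> exists2 G, lin_span (gen h) G & flat u x (sle E x h) m (F - G).
  have [G hG] := H k0 (leqnn _); rewrite flat_last // => -[h1 h2].
  rewrite -[F](subrK G); apply: subspD => //; first exact: subsp_span.
  by apply: sub_lin_span; exact: trivial_gen.
elim: m => [_|m IH hm].
  exists 0; first exact: subsp0 (subsp_span h).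
  by rewrite subr0 flat0.
have [G hG hFG] := IH (ltnW hm).
have [G' [h1 h2 h3]] := lift_relation_le hh (hm : (1 <= m.+1 <= k0)%N) (flat_tau_rel hE hn hx hFG).
exists (G + G'); first by apply: subspD => //; exact: subsp_span.
have hG' := span_sle h1.
have -> : F - (G + G') = (-1) *: G' + (F - G) by rewrite scaleN1r opprD addrA addrC.
have [hs hj] := hFG.
split; first by apply: (subsp_sle E x h).2.
move=> j i /andP[j1 j2].
rewrite tau_linear //; [|exact: sle_abelian hG'|exact: sle_abelian hs].
move: j2; rewrite leq_eqVlt => /predU1P[->|j2]; first by rewrite h3 mulN1r addNr.
by rewrite h2 ?hj ?mulr0 ?addr0 // ?j1.
Qed.

Definition alpha h : nat := #|[set i : Windex k0 n | (#|isupp i| <= h)%N]%SET|.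
Definition beta m h : nat := #|[set L in mon n m | (#|msupp L| <= h)%N]%SET|.

(** In order m every relation lifts, so the graded piece has dimension alpha(h) - beta(m,h); the sum
    over orders 1 to [k0] is stated additively to avoid truncated subtraction. *)
Lemma quot_dim_sle_triv h : (h <= k0)%N -> exists2 d,
  quot_dim (sle E x h) (triv E x) d &
  (d + \sum_(m < k0) beta m.+1 h = k0 * alpha h)%N.
Proof.
move=> hh.
have hd m : exists d, (m < k0)%N -> quot_dim (rel_le p (@isupp k0 n) m.+1 h) [set 0] d /\
    (beta m.+1 h + d = alpha h)%N.
  case: (ltnP m k0) => hm; last by exists 0%N.
  by have [d h1 h2] := rel_dim hk0 hx h (hm : (1 <= m.+1 <= k0)%N); exists d.
have [d {}hd] := choice hd.
exists (\sum_(m < k0) d m)%N.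
  apply: quot_dim_sle => // m hm.
  apply: (flat_step _ _ (hd m hm).1) => [F hF|a ha]; first exact: (flat_tau_rel hE hn hx).
  have [F [h1 h2 h3]] := lift_relation_le hh (hm : (1 <= m.+1 <= k0)%N) ha.
  exists F; last exact/funext.
  by split=> [|j i hj]; [exact: span_sle|apply: h2].
rewrite -big_split /= (eq_bigr (fun=> alpha h)); first by rewrite sum_nat_const card_ord.
by move=> m _; rewrite addnC; exact: (hd m (ltn_ord m)).2.
Qed.

Lemma max_rank_at : rank_at u x (rho n k0).
Proof.
have n0 : (0 < n)%N by exact: ltnW.
have hA : sle E x k0 = abelian_rel u x.
  by apply: sle_full => i; rewrite card_isupp ltn_ord.
have [d h1 h2] := quot_dim_sle_triv (leqnn k0).
have hd : d = rho n k0.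
  have ea : alpha k0 = c n k0.
    rewrite -(@card_Windex k0 n k0_gt0) -cardsT; apply: eq_card => i.
    by rewrite !inE card_isupp ltn_ord.
  have eb (m : 'I_k0) : beta m.+1 k0 = c n m.+1.
    rewrite -card_mon //; apply: eq_card => L; rewrite [LHS]inE.
    case: (boolP (L \in mon n m.+1)) => //= hL.
    exact: leq_trans (card_msupp hL) (ltn_ord m).
  (* Ensures that the subtractions in [rho] are not truncated. *)
  have hle (m : 'I_k0) : (c n m.+1 <= c n k0)%N.
    have [d' _ h3] := rel_dim hk0 hx k0 (ltn_ord m : (1 <= m.+1 <= k0)%N).
    by rewrite -ea -eb /alpha -h3 leq_addr.
  move: h2; rewrite ea (eq_bigr _ (fun m _ => eb m)) => h2.
  rewrite /rho big_add1 /= big_mkord; apply/eqP.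
  rewrite -(eqn_add2r (\sum_(m < k0) c n m.+1)) h2 -big_split /=.
  rewrite (eq_bigr (fun=> c n k0)) => [|m _]; last by rewrite subnK.
  by rewrite sum_nat_const card_ord.
apply: (@quot_dim_setI _ _ _ (trivial_rel u x) _ (subsp_abelian_rel u x)).2.
suff : quot_dim (abelian_rel u x) (triv E x) (rho n k0) by [].
by rewrite -hA -hd.
Qed.

(** Over the degrees 1 to [k0], first integrals in all h variables minus monomials in all h
    variables; neither n nor the point enters. *)
Definition N_exact h : nat := (k0 * c h (k0 - h) - \sum_(m < k0) full_mon m.+1 h)%N.

(** The count for h - 1 is subtracted from that for h. Indices and monomials with exactly h
    variables are distributed evenly over the h-subsets, whence the binomial factor. *)
Lemma exact_dim_at h : (1 <= h <= k0)%N ->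
  exact_dim u (Wdom E n) x h (N_exact h * 'C(n, h))%N.
Proof.
move=> /[dup] hh /andP[h0 hk]; have hk' : (h.-1 <= k0)%N by apply: leq_trans hk; exact: leq_pred.
rewrite /exact_dim !abelian_leE //.
have [d h1 h2] := quot_dim_sle_triv hk.
have [d' h3 h4] := quot_dim_sle_triv hk'.
have hsub : sle E x h.-1 `<=` sle E x h.
  move=> F [hF hc]; split=> // i hi; apply: hc; apply: contra hi => h5.
  by apply: leq_trans h5 _; exact: leq_pred.
have hT := subsp_triv E x.
have [b hb] := quot_dim_quo hT (subsp_sle E x h.-1) (@triv_sle _ _ _ _ _ h.-1) h1.
have e := quot_dim_uniq hT h1 (quot_dim_add (subsp_sle E x h.-1) hsub (@triv_sle _ _ _ _ _ h.-1) hb h3).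
suff <- : b = (N_exact h * 'C(n, h))%N by [].
have ea : alpha h = (alpha h.-1 + 'C(n, h) * c h (k0 - h))%N.
  rewrite -card_isupp_eq // /alpha.
  have := @card_le_split _ (fun=> true) (fun i : Windex k0 n => #|isupp i|) h h0.
  by [].
have eb m : beta m h = (beta m h.-1 + 'C(n, h) * full_mon m h)%N.
  rewrite -card_mon_supp_eq /beta.
  have := @card_le_split _ (fun L => L \in mon n m) (fun L => #|msupp L|) h h0.
  by [].
move: h2; rewrite (eq_bigr _ (fun (m : 'I_k0) _ => eb m.+1)) big_split /= -big_distrr /= ea mulnDr.
rewrite /N_exact mulnBl -mulnA (mulnC (c h _)) (mulnC (\sum_(m < k0) _)%N).
move: h4 e; set sb := (\sum_(m < k0) beta _ _)%N; set G := (_ * \sum_(m < k0) _)%N.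
set X := (k0 * (_ * _))%N; set Y := (k0 * alpha _)%N; lia.
Qed.

End Point.
End Main.

Theorem theorem2 (R : realType) (k0 : nat) (E : web_family R k0)
    (hk0 : (2 <= k0)%N)
    (hE : balanced E)
    (hord : forall n, (2 <= n)%N -> Wordinary E n)
    (hmax : forall n, (2 <= n <= k0)%N -> Wmax_rank E n) :
  [/\ forall n, (2 <= n)%N -> Wmax_rank E n,
      forall n, (2 <= n)%N ->
        forall x, Wdom E n x -> ordinary_at (Wfi E n) x ->
          forall F, abelian_rel (Wfi E n) x F ->
            abelian_le (Wfi E n) (Wdom E n) x k0 F
    & exists N : nat -> nat, forall h, (2 <= h <= k0)%N ->
        (forall y, Wdom E h y -> ordinary_at (Wfi E h) y ->
           exact_dim (Wfi E h) (Wdom E h) y h (N h)) /\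
        (forall n, (h <= n)%N ->
           forall x, Wdom E n x -> ordinary_at (Wfi E n) x ->
             exact_dim (Wfi E n) (Wdom E n) x h (N h * 'C(n, h))%N)].
Proof.
have k0_gt0 : (0 < k0)%N by exact: ltnW.
have pt n (x : 'rV[Cplx R]_n) : (2 <= n)%N -> Wdom E n x ->
    ordinary_at (Wfi E n) x -> ord_pt E x.
  by move=> hn hx ho; split=> //; apply/ordinary_atP => //; exact: ltnW.
split.
- by move=> n hn x hx ho; apply: max_rank_at => //; exact: pt.
- move=> n hn x hx ho F hF; rewrite abelian_leE //; last exact: pt.
  by split=> // i; rewrite card_isupp ltn_ord.
exists (N_exact k0) => h /andP[h2 hk].
have H n (x : 'rV[Cplx R]_n) : (h <= n)%N -> Wdom E n x -> ordinary_at (Wfi E n) x ->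
    exact_dim (Wfi E n) (Wdom E n) x h (N_exact k0 h * 'C(n, h))%N.
  move=> hn hx ho; have n2 := leq_trans h2 hn.
  by apply: exact_dim_at => //; [exact: pt|rewrite hk andbT ltnW].
split=> [y hy ho|n hn x]; last exact: H.
(* For n = h the binomial is 1, so the number is indeed the dimension for the web in h variables. *)
by have := H h y (leqnn h) hy ho; rewrite binn muln1.
Qed.
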